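(* Let $N\ge2$ be an integer, $q,t\in(0,1)$, $b<0<a$, and $c=\bar d\in\mathbb C\setminus\mathbb R$. Consider the partial $q$-difference operator $$D_N=\sum_{i=1}^N\left(\prod_{j\ne i}\frac{tx_i-x_j}{x_i-x_j}\,\sigma_N^+(x_i)(S_{q,i}^+-1)+\prod_{j\ne i}\frac{t^{-1}x_i-x_j}{x_i-x_j}\,\sigma_N^-(x_i)(S_{q,i}^--1)\right)$$ on $\mathrm{Sym}(N)$, and regard it as an operator on $C(\widetilde\Omega_N(q,t;a,b))$ with domain the dense subspace $\mathrm{Sym}(N)\subset C(\widetilde\Omega_N(q,t;a,b))$. Then $D_N$ serves as a pre-generator of a Feller semigroup on the space $C(\widetilde\Omega_N(q,t;a,b))$.
   Context: **Operator.** Here $$\sigma_N^+(x)=-\frac{qt^{N-1}}{ab}(c-x^{-1})(d-x^{-1}),\qquad \sigma_N^-(x)=-\frac{q^2t^{N-1}}{ab}(aq^{-1}-x^{-1})(bq^{-1}-x^{-1}),$$ and $S_{q,i}^{\pm}$ replaces $x_i$ by $x_iq^{\pm1}$. $\mathrm{Sym}(N)$ is the algebra of symmetric polynomials in $x_1,\dots,x_N$ with real coefficients. It is known that $D_N$ maps $\mathrm{Sym}(N)$ to itself. **Space.** Let $\overline{\mathbb N}=\{1,2,\dots\}\cup\{\infty\}$ be the one-point compactification of the positive integers, ordered naturally; $q^\infty:=0$. Let $\widetilde\Omega$ be the set of pairs $\omega=(\omega^+,\omega^-)$ of weakly increasing sequences $\omega^+=(k_1\le k_2\le\cdots)$, $\omega^-=(l_1\le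 l_2\le\cdots)$ in $\overline{\mathbb N}$, with the product topology; $|\omega|$ is the total number of coordinates (in both sequences) different from $\infty$. Assign to $\omega$ the sequences $x_i^+=a^{-1}q^{k_i}t^{i-1}$, $x_i^-=b^{-1}q^{l_i}t^{i-1}$, $i\ge1$; this map is injective. $\widetilde\Omega_N(q,t;a,b)$ is the image of the compact set $\{\omega:|\omega|\le N\}$, with the topology transported from $\widetilde\Omega$. An element of it is identified with an $N$-point multiset in $\mathbb R$: the nonzero numbers among the $x_i^\pm$ (at most $N$ of them), complemented by zeros to a total of $N$ points. A polynomial $f\in\mathrm{Sym}(N)$ is evaluated at this $N$-point multiset, which identifies $\mathrm{Sym}(N)$ with a dense subspace of $C(\widetilde\Omega_N(q,t;a,b))$ (real continuous functions with supremum norm). **Feller semigroups.** For a compact metrizable space $E$, a Feller semigroup on $C(E)$ is a strongly continuous one-parameter semigroup $\{T(s):s\ge0\}$ of operators with $T(0)=1$, $\|T(s)\|\le1$, $T(s)f\ge0$ whenever $f\ge0$, and $T(s)1=1$. Its generator is $Af=\lim_{s\to+0}\frac1s(T(s)f-f)$, defined on all $f$ for which the norm limit exists. An operator $A$ is a pre-generator of the semigroup if $A$ is closable and its closure is the generator. *)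

(* Defs.v *)
From HB Require Import structures.
From mathcomp Require Import all_boot all_order all_algebra.
From mathcomp Require Import all_classical all_reals all_analysis.
From mathcomp Require Import complex.
(* Its notations clash with those of mathcomp-analysis. *)
From mathcomp Require Import -(notations) mpoly.

Set Implicit Arguments.
Unset Strict Implicit.
Unset Printing Implicit Defensive.

Import Order.TTheory GRing.Theory Num.Theory.
Import numFieldNormedType.Exports.

Local Open Scope classical_set_scope.
Local Open Scope ring_scope.
Local Open Scope complex_scope.

(** C(E) is the set of continuous elements of [{uniform E -> R}]; for E
    compact, uniform convergence is convergence in the supremum norm. An
    everywhere defined operator on C(E) is a map on all functions E -> R of
    which only the values on continuous functions are constrained; a partially
    defined one is given by its graph. *)
Section Feller.
Context {R : realType} {E : topologicalType}.

Definition sup_norm (f : E -> R) : R := sup [set `|f x| | x in [set: E]].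

Record feller_semigroup (T : R -> (E -> R) -> (E -> R)) : Prop := {
  feller_continuous : forall (s : R) (f : E -> R), 0 <= s -> continuous f -> continuous (T s f);
  feller_linear : forall (s k : R) (f g : E -> R), 0 <= s -> continuous f -> continuous g ->
    T s (fun x => k * f x + g x) = (fun x => k * T s f x + T s g x);
  feller_semigroup0 : forall f : E -> R, continuous f -> T 0 f = f;
  feller_semigroupD : forall (s r : R) (f : E -> R), 0 <= s -> 0 <= r -> continuous f ->
    T (s + r) f = T s (T r f);
  feller_strongly_continuous : forall f : E -> R, continuous f ->
    {within [set s : R | 0 <= s],
      continuous (fun s => T s f : {uniform E -> R})};
  feller_contraction : forall (s : R) (f : E -> R), 0 <= s -> continuous f ->
    sup_norm (T s f) <= sup_norm f;
  feller_positive : forall (s : R) (f : E -> R), 0 <= s -> continuous f ->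
    (forall x, 0 <= f x) -> forall x, 0 <= T s f x;
  feller_conservative : forall s : R, 0 <= s -> T s (fun=> 1) = (fun=> 1)
}.

Definition generator (T : R -> (E -> R) -> (E -> R)) :
    set ({uniform E -> R} * {uniform E -> R}) :=
  [set fg | [/\ continuous (fg.1 : E -> R), continuous (fg.2 : E -> R) &
    {uniform, (fun s : R => fun x => s^-1 * (T s fg.1 x - fg.1 x)) @ 0^'+
      --> fg.2}]].

(** A uniform limit of continuous functions is continuous, so the closure of
    a graph contained in C(E) x C(E) may be taken among all functions. *)
Definition closable (A : set ({uniform E -> R} * {uniform E -> R})) : Prop :=
  forall f g h, closure A (f, g) -> closure A (f, h) -> g = h.

Definition pre_generator (A : set ({uniform E -> R} * {uniform E -> R}))
    (T : R -> (E -> R) -> (E -> R)) : Prop :=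
  closable A /\ closure A = generator T.

End Feller.

(** [Some n] stands for the positive integer n + 1, [None] for infinity. *)
Definition Nbar : topologicalType := one_point_compactification nat.

Definition Nbar_le (k l : option nat) : bool :=
  match k, l with
  | _, None => true
  | None, Some _ => false
  | Some m, Some n => (m <= n)%N
  end.

Definition qpow {R : realType} (q : R) (k : option nat) : R :=
  if k is Some n then q ^+ n.+1 else 0.

Definition Nbar_seq_pair : topologicalType :=
  ({ptws nat -> Nbar} * {ptws nat -> Nbar})%type.

Definition weakly_increasing (k : nat -> option nat) : Prop :=
  forall i j, (i <= j)%N -> Nbar_le (k i) (k j).

Definition Omega_tilde : set Nbar_seq_pair :=
  [set w | weakly_increasing w.1 /\ weakly_increasing w.2].

Definition finite_coords (w : Nbar_seq_pair) : set (nat + nat) :=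
  [set z | match z with
           | inl i => (w.1 i : option nat) <> None
           | inr i => (w.2 i : option nat) <> None
           end].

Definition Omega_le (N : nat) : set Nbar_seq_pair :=
  Omega_tilde `&` [set w | (finite_coords w #<= `I_N)%card].

Section Space.
Context {R : realType}.
Variables (N : nat) (q t a b : R).

(** Sequences are indexed from 0, whence t ^+ i instead of t ^ (i - 1). *)
Definition embed (w : Nbar_seq_pair) : (nat -> R) * (nat -> R) :=
  ((fun i => a^-1 * qpow q (w.1 i) * t ^+ i),
   (fun i => b^-1 * qpow q (w.2 i) * t ^+ i)).

Definition Omega_image : set ((nat -> R) * (nat -> R)) :=
  embed @` Omega_le N.

Definition omega_of (x : set_type Omega_image) : Nbar_seq_pair :=
  sval (cid2 (set_valP x)).

(** [embed] being injective on [Omega_le N], [omega_of] is its inverse, and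
    the initial topology it induces is the transported one. *)
Definition OmegaN : topologicalType := initial_topology omega_of.

(** As at most N of the coordinates are nonzero, and in each sequence they come
    first, they all have indices below N; [nth 0] pads them with zeros. *)
Definition config (x : OmegaN) : 'I_N -> R :=
  let: (xp, xm) := set_val (x : set_type Omega_image) in
  fun i => nth 0 [seq r <- [seq xp j | j <- iota 0 N] ++
                           [seq xm j | j <- iota 0 N] | r != 0] i.

Definition eval_sym (f : mpoly N R) : OmegaN -> R :=
  fun x => meval (config x) f.

End Space.

Section Operator.
Context {R : realType}.
Variables (N : nat) (q t a b : R) (c d : R[i]).

Definition sigma_plus (x : R) : R[i] :=
  - (q * t ^+ N.-1 / (a * b))%:C * ((c - (x^-1)%:C) * (d - (x^-1)%:C)).

Definition sigma_minus (x : R) : R :=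
  - (q ^+ 2 * t ^+ N.-1 / (a * b)) *
    ((a * q^-1 - x^-1) * (b * q^-1 - x^-1)).

Definition scale_at (i : 'I_N) (k : R) (x : 'I_N -> R) : 'I_N -> R :=
  fun j => if j == i then k * x j else x j.

Definition generic_point (x : 'I_N -> R) : Prop :=
  (forall i, x i != 0) /\ injective x.

Definition DN_fun (F : ('I_N -> R) -> R) (x : 'I_N -> R) : R[i] :=
  \sum_(i < N)
    ((\prod_(j < N | j != i) ((t * x i - x j) / (x i - x j)))%:C *
       sigma_plus (x i) * (F (scale_at i q x) - F x)%:C +
     ((\prod_(j < N | j != i) ((t^-1 * x i - x j) / (x i - x j))) *
       sigma_minus (x i) * (F (scale_at i q^-1 x) - F x))%:C).

(** D_N f as a symmetric polynomial: the formula is a rational function, which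
    determines, and is determined by, its values at generic points. *)
Definition DN (f : mpoly N R) : mpoly N R :=
  xget 0 [set g | g \is symmetric /\
    forall x, generic_point x ->
      (meval x g)%:C = DN_fun (fun y => meval y f) x].

Definition DN_graph :
    set ({uniform OmegaN N q t a b -> R} * {uniform OmegaN N q t a b -> R}) :=
  [set (eval_sym f, eval_sym (DN f)) |
     f in [set f : mpoly N R | f \is symmetric]].

End Operator.

(* Main.v *)
Require Import Defs.
From mathcomp Require Import all_boot all_order all_algebra.
From mathcomp Require Import all_classical all_reals all_analysis.
From mathcomp Require Import complex.
From mathcomp Require Import -(notations) mpoly.
From mathcomp Require Import ring lra zify.

Set Implicit Arguments.
Unset Strict Implicit.
Unset Printing Implicit Defensive.

Import Order.TTheory GRing.Theory Num.Theory.
Import numFieldNormedType.Exports.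

Local Open Scope classical_set_scope.
Local Open Scope ring_scope.

(** The closure of an operator generates a Feller semigroup as soon as the
    operator has a dense domain V containing the constants, kills the constants,
    is dissipative, and 1 - h D maps V onto V for all h >= 0. The proof of
    this form of the Hille-Yosida theorem is elementary: the resolvents
    J_h = (1 - h D)^-1 are commuting contractions of V with
    J_h J_k = J_(h + k) + O(h k), hence the backward Euler approximations
    J_(s / 2^k)^(2^k) converge on V, and so on its closure
    ([dissipative_core_pre_generator]).

    Here V is the space of symmetric polynomials, restricted to the compact
    space of configurations. It is dense by the Stone-Weierstrass theorem, since
    the elementary symmetric functions determine a multiset and, on this space,
    the multiset determines the configuration ([symmetric_separates]). The
    operator preserves V and does not raise the degree ([DN_real_degree]): the
    image of a symmetric polynomial is a sum over i of values at x_i of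
    polynomials with symmetric coefficients, divided by the product of the
    x_i - x_j, and Lagrange interpolation turns such sums into symmetric
    polynomials; the poles at x_i = 0 of the two shifts cancel. So 1 - h D,
    being injective by dissipativity, is onto on each of the finite-dimensional
    spaces that exhaust V ([injective_onto]).

    Dissipativity is a maximum principle. At a configuration of N nonzero
    points the operator is a combination of differences f(x') - f(x) with
    nonnegative rates, where the rate of a jump out of the space vanishes
    ([full_maximum]). The configurations with zeros are limits of these, where
    the rates explode. They are handled by perturbation: a small multiple of the
    sum of the positive points is added to f. This function has a kink at the
    origin, and new small points can be created on both sides of the origin, so
    the perturbed function has no maximum at a configuration with a zero
    ([maximum_full]). On the other hand the operator applied to the sum of the
    positive points is bounded below ([positive_part_drift]), so that the
    perturbation is harmless ([approximate_maximum]). *)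

(** * Uniform bounds *)

Section UniformBounds.
Context {R : realType} {E : Type}.
Implicit Types (f g : E -> R).

(** Bounds of the supremum norm, without the supremum. *)
Definition bounded_by f (M : R) := forall x, `|f x| <= M.

Lemma bounded_by_le f M M' : M <= M' -> bounded_by f M -> bounded_by f M'.
Proof. by move=> MM' fM x; exact: le_trans (fM x) MM'. Qed.

Lemma bounded_byD f g M M' :
  bounded_by f M -> bounded_by g M' -> bounded_by (f + g) (M + M').
Proof.
by move=> fM gM x; apply: le_trans (ler_normD _ _) _; exact: lerD.
Qed.

Lemma bounded_byZ k f M : bounded_by f M -> bounded_by (k *: f) (`|k| * M).
Proof. by move=> fM x; rewrite fctE normrM ler_wpM2l. Qed.

Lemma bounded_byN f M : bounded_by f M -> bounded_by (- f) M.
Proof. by move=> fM x; rewrite fctE normrN. Qed.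

Lemma bounded_byB f g M M' :
  bounded_by f M -> bounded_by g M' -> bounded_by (f - g) (M + M').
Proof. by move=> fM /bounded_byN; exact: bounded_byD. Qed.

Lemma bounded_by_sub f g h M M' :
  bounded_by (f - g) M -> bounded_by (g - h) M' -> bounded_by (f - h) (M + M').
Proof.
move=> fg gh; have -> : f - h = (f - g) + (g - h) by rewrite addrA subrK.
exact: bounded_byD.
Qed.

Lemma bounded_by_subC f g M : bounded_by (f - g) M -> bounded_by (g - f) M.
Proof. by move=> /bounded_byN; rewrite opprB. Qed.

Lemma bounded_by_eps f M :
  (forall e, 0 < e -> bounded_by f (M + e)) -> bounded_by f M.
Proof. by move=> fM x; apply/ler_addgt0Pr => e e0; exact: fM. Qed.

Lemma bounded_by0 f : bounded_by f 0 -> f = 0.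
Proof. by move=> f0; apply/funext => x; apply/eqP; rewrite -normr_le0; exact: f0. Qed.

Lemma uniform_cauchy_limit (u : nat -> E -> R) :
  (forall n m, bounded_by (u n - u m) (2 * 2 ^- n + 2 * 2 ^- m)) ->
  exists g, forall n, bounded_by (u n - g) (2 * 2 ^- n).
Proof.
move=> uC.
have h0 : (fun n => 2 * (2^-1)^+n : R) @ \oo --> (0:R).
  rewrite -(mulr0 2); apply: cvgM; first exact: cvg_cst.
  by apply: cvg_expr; rewrite ger0_norm; lra.
have cv x : cvgn (fun n => u n x).
  apply/cauchy_cvgP/cauchy_exP => e e0.
  have e40 : 0 < e / 2 by lra.
  have [n _ Hn] : \forall n \near \oo, 2 * 2^-n < e / 2 :> R.
    by move/cvgrPdist_lt: h0 => /(_ _ e40); apply: filterS => n;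
      rewrite sub0r normrN ger0_norm ?mulr_ge0 ?exprn_ge0 ?invr_ge0// exprVn.
  exists (u n x); exists n => //= m nm; apply: le_lt_trans (uC n m x) _.
  have := Hn _ nm; have := Hn _ (leqnn n) => /=; lra.
exists (fun x => limn (fun n => u n x)) => n x.
have c1 : `|u n x - u m x| @[m --> \oo] --> `|u n x - limn (fun n => u n x)|.
  by apply: cvg_norm; apply: cvgB; [exact: cvg_cst | exact: cv].
have c2 : (2 * 2 ^- n + 2 * (2^-1)^+m : R) @[m --> \oo] --> (2 * 2 ^- n + 0 : R).
  by apply: cvgD => //; exact: cvg_cst.
rewrite -[leRHS]addr0 /=.
rewrite -(cvg_lim (@Rhausdorff R) c1) -(cvg_lim (@Rhausdorff R) c2).
apply: ler_lim; [by apply/cvg_ex; eexists; exact: c1|by apply/cvg_ex; eexists; exact: c2|].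
by apply: nearW => m; rewrite exprVn; exact: uC.
Qed.

End UniformBounds.

(** * Resolvents and Euler approximations *)

Ltac fun_ring := apply/funext => ?; rewrite !fctE /GRing.scale /=; ring.

(** The hypotheses of the Hille-Yosida theorem. The range condition is
    asked for the core itself, not up to closure; it holds for a core that is
    exhausted by finite-dimensional invariant subspaces. *)
Record dissipative_core {R : realType} {E : Type} (V : set (E -> R))
    (A : (E -> R) -> E -> R) : Prop := {
  core_submod : forall (k : R) f g, V f -> V g -> V (k *: f + g);
  core_unit : V 1;
  core_stable : forall f, V f -> V (A f);
  core_linear : forall (k : R) f g, V f -> V g -> A (k *: f + g) = k *: A f + A g;
  core_conservative : A 1 = 0;
  core_dissipative : forall (h : R) f M, 0 <= h -> V f ->
    bounded_by (f - h *: A f) M -> bounded_by f M;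
  core_onto : forall (h : R) f, 0 <= h -> V f -> exists2 g, V g & g - h *: A g = f
}.

Section Resolvents.
Context {R : realType} {E : Type}.
Variables (V : set (E -> R)) (A : (E -> R) -> E -> R).
Hypothesis C : dissipative_core V A.

Let VL := core_submod C.
Let V1 := core_unit C.
Let VA := core_stable C.
Let AL := core_linear C.
Let A1 := core_conservative C.
Let Adiss := core_dissipative C.
Let Aonto := core_onto C.

Let V0 : V 0.
Proof. by have := VL (-1) V1 V1; rewrite scaleN1r addNr. Qed.

Let VD f g : V f -> V g -> V (f + g).
Proof. by move=> Vf Vg; have := VL 1 Vf Vg; rewrite scale1r. Qed.

Let VZ (k : R) f : V f -> V (k *: f).
Proof. by move=> Vf; have := VL k Vf V0; rewrite addr0. Qed.

Let VB f g : V f -> V g -> V (f - g).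
Proof. by move=> Vf Vg; rewrite -scaleN1r; apply: VD => //; exact: VZ. Qed.

(** Operators that share the properties of the resolvents which survive
    composition. *)
Record commuting_contraction (S : (E -> R) -> E -> R) : Prop := {
  cc_stable : forall f, V f -> V (S f);
  cc_linear : forall (k : R) f g, V f -> V g -> S (k *: f + g) = k *: S f + S g;
  cc_contraction : forall f M, V f -> bounded_by f M -> bounded_by (S f) M;
  cc_commute : forall f, V f -> A (S f) = S (A f);
  cc_unit : S 1 = 1
}.

Section OneOperator.
Variable S : (E -> R) -> E -> R.
Hypothesis SC : commuting_contraction S.

Lemma cc0 : S 0 = 0.
Proof.
have := cc_linear SC (-1) V1 V1.
by rewrite !scaleN1r !addNr.
Qed.

Lemma ccD f g : V f -> V g -> S (f + g) = S f + S g.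
Proof. by move=> Vf Vg; have := cc_linear SC 1 Vf Vg; rewrite !scale1r. Qed.

Lemma ccZ (k : R) f : V f -> S (k *: f) = k *: S f.
Proof. by move=> Vf; have := cc_linear SC k Vf V0; rewrite !addr0 cc0 addr0. Qed.

Lemma ccB f g : V f -> V g -> S (f - g) = S f - S g.
Proof.
by move=> Vf Vg; have := cc_linear SC (-1) Vg Vf;
  rewrite !scaleN1r ![- _ + _]addrC.
Qed.

Lemma cc_iter n : commuting_contraction (iter n S).
Proof.
elim: n => [|n IH]; first by split.
split=> /=.
- by move=> f Vf; apply: (cc_stable SC); apply: (cc_stable IH).
- move=> k f g Vf Vg; rewrite (cc_linear IH)// (cc_linear SC)//;
    exact: (cc_stable IH).
- move=> f M Vf fM; apply: (cc_contraction SC); first exact: (cc_stable IH).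
  exact: (cc_contraction IH).
- by move=> f Vf; rewrite (cc_commute SC) ?(cc_commute IH)//; exact: (cc_stable IH).
- by rewrite (cc_unit IH) (cc_unit SC).
Qed.

End OneOperator.

Lemma cc_comp S U : commuting_contraction S -> commuting_contraction U ->
  commuting_contraction (S \o U).
Proof.
move=> SC UC; split=> /=.
- by move=> f Vf; apply: (cc_stable SC); apply: (cc_stable UC).
- move=> k f g Vf Vg; rewrite (cc_linear UC)// (cc_linear SC)//;
    exact: (cc_stable UC).
- move=> f M Vf fM; apply: (cc_contraction SC); first exact: (cc_stable UC).
  exact: (cc_contraction UC).
- by move=> f Vf; rewrite (cc_commute SC) ?(cc_commute UC)//; exact: (cc_stable UC).
- by rewrite (cc_unit UC) (cc_unit SC).
Qed.

(** S^n - U^n telescopes into n terms S^i (S - U) U^j, and U^j f satisfies the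
    same bound on the square of the generator as f. *)
Lemma cc_iter_close S U d n f M :
  commuting_contraction S -> commuting_contraction U ->
  (forall w, V w -> bounded_by (A (A w)) M -> bounded_by (S w - U w) d) ->
  V f -> bounded_by (A (A f)) M ->
  bounded_by (iter n S f - iter n U f) (n%:R * d).
Proof.
move=> SC UC SU Vf fM; elim: n => [|n IH].
  by rewrite mul0r subrr => x; rewrite normr0.
have USn := cc_iter UC n; have SSn := cc_iter SC n.
rewrite /= -natr1 mulrDl mul1r.
apply: (@bounded_by_sub _ _ _ (S (iter n U f))).
  rewrite -(ccB SC); [|exact: (cc_stable SSn)|exact: (cc_stable USn)].
  apply: (cc_contraction SC) => //.
  by apply: VB; [exact: (cc_stable SSn)|exact: (cc_stable USn)].
apply: SU; first exact: (cc_stable USn).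
rewrite (cc_commute USn)// (cc_commute USn); last exact: VA.
by apply: (cc_contraction USn) => //; exact: VA (VA Vf).
Qed.

Definition resolvent (h : R) (f : E -> R) : E -> R :=
  xget 0 [set g | V g /\ g - h *: A g = f].
Local Notation J := resolvent.

Lemma resolventP h f : 0 <= h -> V f -> V (J h f) /\ J h f - h *: A (J h f) = f.
Proof.
move=> h0 Vf; rewrite /J; case: xgetP => [g _ [] //|no].
by have [g Vg gf] := Aonto h0 Vf; case: (no g).
Qed.

Lemma A0 : A 0 = 0.
Proof. by have := AL (-1) V1 V1; rewrite !scaleN1r !addNr. Qed.

Lemma AZ (k : R) f : V f -> A (k *: f) = k *: A f.
Proof. by move=> Vf; have := AL k Vf V0; rewrite !addr0 A0 addr0. Qed.

Lemma AB f g : V f -> V g -> A (f - g) = A f - A g.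
Proof.
by move=> Vf Vg; have := AL (-1) Vg Vf; rewrite !scaleN1r ![- _ + _]addrC.
Qed.

Lemma resolvent_unique h f g : 0 <= h -> V f -> V g -> g - h *: A g = f -> g = J h f.
Proof.
move=> h0 Vf Vg gf; have [VJ Jf] := resolventP h0 Vf.
apply/eqP; rewrite -subr_eq0; apply/eqP; apply: bounded_by0.
apply: (Adiss h0 (VB Vg VJ)); rewrite AB// scalerBr.
rewrite (_ : _ - _ = (g - h *: A g) - (J h f - h *: A (J h f))); last first.
  by fun_ring.
by rewrite gf Jf subrr => x; rewrite normr0.
Qed.

Lemma resolvent_cc h : 0 <= h -> commuting_contraction (J h).
Proof.
move=> h0; have JP := @resolventP h _ h0; split.
- by move=> f /JP[].
- move=> k f g Vf Vg; have [VJf Jf] := JP _ Vf; have [VJg Jg] := JP _ Vg.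
  symmetry; apply: resolvent_unique; [by []|exact: VL|exact: VL|].
  rewrite AL// -[in RHS]Jf -[in RHS]Jg.
  by fun_ring.
- by move=> f M Vf fM; have [VJf Jf] := JP _ Vf; apply: (Adiss h0 VJf); rewrite Jf.
- move=> f Vf; have [VJf Jf] := JP _ Vf.
  apply: resolvent_unique; [by []|exact: VA|exact: VA|].
  by rewrite -[in RHS]Jf AB ?AZ//; [exact: VA|exact/VZ/VA].
- by symmetry; apply: resolvent_unique => //; rewrite A1 scaler0 subr0.
Qed.

Lemma resolvent0 f : V f -> J 0 f = f.
Proof. by move=> Vf; symmetry; apply: resolvent_unique; rewrite ?scale0r ?subr0. Qed.

Lemma resolvent_comm h k f : 0 <= h -> 0 <= k -> V f -> J h (J k f) = J k (J h f).
Proof.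
move=> h0 k0 Vf; have [VJf Jf] := resolventP h0 Vf.
have Ch := resolvent_cc h0; have Ck := resolvent_cc k0.
symmetry; apply: resolvent_unique => //; [exact: (cc_stable Ck)|exact: (cc_stable Ck)|].
rewrite (cc_commute Ck)// -(ccZ Ck); last exact: VA.
by rewrite -(ccB Ck)// ?Jf//; exact/VZ/VA.
Qed.

(** Since (1 - hA)(1 - kA) - (1 - (h + k)A) = hk A^2, the resolvents are
    multiplicative up to second order. *)
Lemma resolvent_mul h k f M : 0 <= h -> 0 <= k -> V f -> bounded_by (A (A f)) M ->
  bounded_by (J h (J k f) - J (h + k) f) (h * k * M).
Proof.
move=> h0 k0 Vf fM; have hk0 : 0 <= h + k by apply: addr_ge0.
have Ch := resolvent_cc h0; have Ck := resolvent_cc k0.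
have Chk := resolvent_cc hk0.
have [Vg gE] := resolventP hk0 Vf; set g := J (h + k) f in Vg gE *.
have Vw : V (A (A g)) by exact/VA/VA.
have VJ u : V u -> V (J h (J k u)).
  by move=> Vu; apply: (cc_stable Ch); exact: (cc_stable Ck).
have gfE : J h (J k f) + (h * k) *: J h (J k (A (A g))) = g.
  have -> : (h * k) *: J h (J k (A (A g))) = J h (J k ((h * k) *: A (A g))).
    by rewrite (ccZ Ck)// (ccZ Ch)//; exact: (cc_stable Ck).
  have Vz : V ((h * k) *: A (A g)) by exact: VZ.
  rewrite -(ccD Ch); [|exact: (cc_stable Ck)|exact: (cc_stable Ck)].
  rewrite -(ccD Ck)//.
  have VhA : V (g - h *: A g) by apply: VB => //; exact/VZ/VA.
  have -> : f + (h * k) *: A (A g) = (g - h *: A g) - k *: A (g - h *: A g).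
    rewrite -[in LHS]gE AB ?AZ//; [|exact: VA|exact/VZ/VA].
    by fun_ring.
  have <- := @resolvent_unique k _ _ k0 _ VhA erefl.
    by rewrite -(@resolvent_unique h _ _ h0 _ Vg erefl).
  by apply: VB => //; exact/VZ/VA.
have -> : J h (J k f) - g = (- (h * k)) *: J h (J k (A (A g))).
  by rewrite -{1}gfE scaleNr opprD addrA subrr add0r.
have -> : h * k * M = `|- (h * k)| * M by rewrite normrN ger0_norm// mulr_ge0.
apply: bounded_byZ; apply: (cc_contraction Ch); first exact: (cc_stable Ck).
apply: (cc_contraction Ck) => //.
rewrite /g (cc_commute Chk)// (cc_commute Chk); last exact: VA.
by apply: (cc_contraction Chk) => //; exact/VA/VA.
Qed.

Lemma resolvent_increment h f M : 0 <= h -> V f -> bounded_by (A f) M ->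
  bounded_by (J h f - f) (h * M).
Proof.
move=> h0 Vf fM; have [VJ JE] := resolventP h0 Vf.
have -> : J h f - f = h *: A (J h f).
  by rewrite -[in X in _ - X]JE; fun_ring.
have -> : h * M = `|h| * M by rewrite ger0_norm.
apply: bounded_byZ; have Ch := resolvent_cc h0.
by rewrite (cc_commute Ch)//; apply: (cc_contraction Ch) => //; exact: VA.
Qed.

Lemma iter_resolvent_increment h n f M : 0 <= h -> V f -> bounded_by (A f) M ->
  bounded_by (iter n (J h) f - f) (n%:R * h * M).
Proof.
move=> h0 Vf fM; have Ch := resolvent_cc h0; elim: n => [|n IH].
  by rewrite !mul0r subrr => x; rewrite normr0.
have Cn := cc_iter Ch n; rewrite /= -natr1 !mulrDl mul1r.
apply: (@bounded_by_sub _ _ _ (J h f)); last exact: resolvent_increment.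
rewrite -(ccB Ch)//; last exact: (cc_stable Cn).
apply: (cc_contraction Ch) => //; apply: VB => //; exact: (cc_stable Cn).
Qed.

(** The remainder is h times the sum of J^i (A f) - A f for 0 < i <= n. This
    is small because A f is close to an element w of the core, which J^i moves
    by at most h i |A w|. *)
Lemma iter_resolvent_expansion h n f w d M : 0 <= h -> V f -> V w ->
  bounded_by (A f - w) d -> bounded_by (A w) M ->
  bounded_by (iter n (J h) f - f - (n%:R * h) *: A f)
    (n%:R * h * (2 * d + n%:R * h * M)).
Proof.
move=> h0 Vf Vw fd wM; have Ch := resolvent_cc h0.
have VAf := VA Vf.
suff H m : (m <= n)%N -> bounded_by (iter m (J h) f - f - (m%:R * h) *: A f)
    (m%:R * h * (2 * d + n%:R * h * M)) by exact: H.
have [x0|/forallNP xM] := pselect (exists x : E, True); last first.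
  by move=> _ x; case: (xM x).
have M0 : 0 <= M by case: x0 => x _; exact: le_trans (wM x).
elim: m => [_|m IH mn].
  by rewrite !mul0r scale0r subr0 subrr => x; rewrite normr0.
have Cm := cc_iter Ch m; have CSm := cc_iter Ch m.+1.
have Vm := cc_stable Cm Vf.
rewrite -natr1 (mulrDl _ 1 h) mul1r (mulrDl _ h).
have -> : iter m.+1 (J h) f - f - (m%:R * h + h) *: A f =
  (iter m (J h) f - f - (m%:R * h) *: A f) +
  h *: (iter m.+1 (J h) (A f) - A f).
  have [_ JE] := resolventP h0 Vm.
  have -> : h *: (iter m.+1 (J h) (A f) - A f) =
     iter m.+1 (J h) f - iter m (J h) f - h *: A f.
    rewrite scalerBr -(cc_commute CSm)// -[X in _ - X - _]JE /=.
    by fun_ring.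
  by fun_ring.
apply: bounded_byD; first by apply: IH; exact: ltnW.
set B := 2 * d + _; have -> : h * B = `|h| * B by rewrite ger0_norm.
apply: bounded_byZ.
apply: (@bounded_by_le _ _ _ (d + m.+1%:R * h * M + d)).
  rewrite /B;
  suff : m.+1%:R * h * M <= n%:R * h * M by lra.
  by rewrite ler_wpM2r// ler_wpM2r// ler_nat.
apply: (@bounded_by_sub _ _ _ w); last exact: bounded_by_subC.
apply: (@bounded_by_sub _ _ _ (iter m.+1 (J h) w)).
  rewrite -(ccB CSm)//; apply: (cc_contraction CSm) => //; exact: VB.
exact: iter_resolvent_increment.
Qed.

(** The backward Euler scheme for u' = A u; two consecutive approximations
    differ by powers of J_(2 h) and J_h^2, which [resolvent_mul] compares. *)
Definition euler (k : nat) (s : R) : (E -> R) -> E -> R :=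
  iter (2 ^ k) (J (s / 2 ^+ k)).

Lemma step_ge0 k (s : R) : 0 <= s -> 0 <= s / 2 ^+ k.
Proof. by move=> s0; rewrite divr_ge0// exprn_ge0. Qed.

Lemma euler_cc k s : 0 <= s -> commuting_contraction (euler k s).
Proof. by move=> s0; apply/cc_iter/resolvent_cc/step_ge0. Qed.

Lemma euler_succ k s f M : 0 <= s -> V f -> bounded_by (A (A f)) M ->
  bounded_by (euler k.+1 s f - euler k s f) (s ^+ 2 * M * (2^-1) ^+ (k + 2)).
Proof.
move=> s0 Vf fM; set h := s / 2 ^+ k.+1.
have h0 : 0 <= h by exact: step_ge0.
have h2 : s / 2 ^+ k = h + h by rewrite /h exprS; field; rewrite expf_neq0.
have p0 : (2 : R) ^+ k != 0 by rewrite expf_neq0.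
have -> : euler k.+1 s f = iter (2 ^ k) (J h \o J h) f.
  by rewrite /euler expnS mulnC iterM.
have -> : s ^+ 2 * M * 2^-1 ^+ (k + 2) = (2 ^ k)%:R * (h * h * M).
  by rewrite natrX /h exprVn exprD (exprS 2 k); field.
apply: cc_iter_close => //; [by apply: cc_comp; exact: resolvent_cc|
  by apply: resolvent_cc; exact: step_ge0|].
by move=> w Vw wM; rewrite h2; exact: resolvent_mul.
Qed.

Lemma euler_close k m s f M : 0 <= s -> V f -> bounded_by (A (A f)) M ->
  (k <= m)%N ->
  bounded_by (euler m s f - euler k s f) (s ^+ 2 * M * (2^-1) ^+ k.+1).
Proof.
move=> s0 Vf fM km.
have [x0|/forallNP xM] := pselect (exists x : E, True); last first.
  by move=> x; case: (xM x).
have M0 : 0 <= M by case: x0 => x _; exact: le_trans (fM x).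
have sM : 0 <= s ^+ 2 * M by rewrite mulr_ge0// sqr_ge0.
suff H : bounded_by (euler m s f - euler k s f)
    (s ^+ 2 * M * (2^-1 ^+ k.+1 - 2^-1 ^+ m.+1)).
  apply: bounded_by_le H; rewrite ler_wpM2l//.
  by rewrite gerBl exprn_ge0// invr_ge0.
elim: m km => [|m IH].
  by rewrite leqn0 => /eqP ->; rewrite !subrr mulr0 => x; rewrite normr0.
rewrite leq_eqVlt => /predU1P[->|]; first by rewrite !subrr mulr0 => x; rewrite normr0.
rewrite ltnS => /IH {}IH.
have -> : s ^+ 2 * M * (2^-1 ^+ k.+1 - 2^-1 ^+ m.+2) =
  s ^+ 2 * M * 2^-1 ^+ (m + 2) + s ^+ 2 * M * (2^-1 ^+ k.+1 - 2^-1 ^+ m.+1).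
  by rewrite addnC !exprS; field.
by apply: bounded_by_sub IH; exact: euler_succ.
Qed.

Lemma euler_mul k s r f M : 0 <= s -> 0 <= r -> V f -> bounded_by (A (A f)) M ->
  bounded_by (euler k s (euler k r f) - euler k (s + r) f)
    (s * r * M * (2^-1) ^+ k).
Proof.
move=> s0 r0 Vf fM.
have sk := step_ge0 k s0; have rk := step_ge0 k r0.
have p0 : (2 : R) ^+ k != 0 by rewrite expf_neq0.
set S := J (s / 2 ^+ k); set U := J (r / 2 ^+ k).
have SC : commuting_contraction S by exact: resolvent_cc.
have UC : commuting_contraction U by exact: resolvent_cc.
have SiU n w : V w -> U (iter n S w) = iter n S (U w).
  move=> Vw; elim: n => //= n IH; rewrite -IH /U /S resolvent_comm//.
  exact: (cc_stable (cc_iter SC n)).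
have -> : euler k s (euler k r f) = iter (2 ^ k) (S \o U) f.
  rewrite /euler -/S -/U; elim: (2 ^ k)%N => //= n <-.
  rewrite SiU//; exact: (cc_stable (cc_iter UC n)).
have -> : s * r * M * 2^-1 ^+ k = (2 ^ k)%:R * (s / 2 ^+ k * (r / 2 ^+ k) * M).
  by rewrite natrX exprVn; field.
have SU : commuting_contraction (S \o U) by exact: cc_comp.
have SUC : commuting_contraction (J ((s + r) / 2 ^+ k)).
  by apply/resolvent_cc/step_ge0/addr_ge0.
apply: (@cc_iter_close (S \o U) (J ((s + r) / 2 ^+ k))) => // w Vw wM.
by rewrite mulrDl; exact: resolvent_mul.
Qed.

Lemma euler_expansion (k : nat) (s : R) f w d M : 0 <= s -> V f -> V w ->
  bounded_by (A f - w) d -> bounded_by (A w) M ->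
  bounded_by (euler k s f - f - s *: A f) (s * (2 * d + s * M)).
Proof.
move=> s0 Vf Vw fd wM.
have H := iter_resolvent_expansion (2 ^ k) (step_ge0 k s0) Vf Vw fd wM.
have p0 : (2 : R) ^+ k != 0 by rewrite expf_neq0.
have e : (2 ^ k)%:R * (s / 2 ^+ k) = s by rewrite natrX; field.
by rewrite e in H.
Qed.

Lemma euler_increment k s f M : 0 <= s -> V f -> bounded_by (A f) M ->
  bounded_by (euler k s f - f) (s * M).
Proof.
move=> s0 Vf fM; have H := iter_resolvent_increment (2 ^ k) (step_ge0 k s0) Vf fM.
have p0 : (2 : R) ^+ k != 0 by rewrite expf_neq0.
have e : (2 ^ k)%:R * (s / 2 ^+ k) = s by rewrite natrX; field.
by rewrite e in H.
Qed.

Lemma euler0 k f : V f -> euler k 0 f = f.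
Proof.
move=> Vf; rewrite /euler mul0r; elim: (2 ^ k)%N => //= n ->.
exact: resolvent0.
Qed.

End Resolvents.

(** * The Hille-Yosida theorem on a core *)

Section UniformTopology.
Context {R : realType} {E : topologicalType}.
Implicit Types (f g : E -> R).

Lemma nbhs_uniformP (f : {uniform E -> R}) (P : set {uniform E -> R}) :
  nbhs f P <->
  exists2 e : R, 0 < e & forall g : E -> R, bounded_by ((f : E -> R) - g) e -> P g.
Proof.
rewrite uniform_nbhs; split=> [[B [entB BP]]|[e e0 eP]].
  move: entB; rewrite -entourage_ballE => -[e /= e0 eB].
  exists (e / 2); first by rewrite divr_gt0.
  move=> g fg; apply: BP => y _; apply: eB => /=.
  by apply: le_lt_trans (fg y) _; rewrite gtr_pMr// invf_lt1// ltr1n.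
exists [set xy : R * R | ball xy.1 e xy.2]; split.
  by rewrite -entourage_ballE; exists e.
by move=> g fg; apply: eP => x; apply: ltW; exact: fg.
Qed.

Lemma cvg_uniformP (F : set_system (E -> R)) f : Filter F ->
  {uniform, F --> f} <->
  forall e : R, 0 < e -> F [set g | bounded_by (f - g) e].
Proof.
move=> FF; split=> [Ff e e0|Ff P /nbhs_uniformP[e e0 eP]].
  by apply: Ff; apply/nbhs_uniformP; exists e.
by apply: filterS (Ff e e0) => g; exact: eP.
Qed.

Lemma uniform_approx_continuous f :
  (forall e : R, 0 < e -> exists2 g, continuous g & bounded_by (f - g) e) ->
  continuous f.
Proof.
move=> fg x; apply/cvgrPdist_le => e e0.
have [g gc gf] := fg (e / 3) (divr_gt0 e0 (ltr0Sn _ 2)).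
have /cvgrPdist_le/(_ (e / 3) (divr_gt0 e0 (ltr0Sn _ 2))) := gc x.
apply: filterS => y gxy.
have := gf x; have := gf y; move: gxy; rewrite !fctE !ler_norml.
move=> /andP[? ?] /andP[? ?] /andP[? ?]; apply/andP; split; lra.
Qed.

Lemma closure_graphP (V : set (E -> R)) (A : (E -> R) -> E -> R)
    (f g : {uniform E -> R}) :
  closure [set ((v : {uniform E -> R}), (A v : {uniform E -> R})) | v in V] (f, g) <->
  forall e : R, 0 < e -> exists2 v, V v &
    bounded_by ((f : E -> R) - v) e /\ bounded_by ((g : E -> R) - A v) e.
Proof.
split=> [cl e e0|H B [[P Q]/= [/nbhs_uniformP[e e0 eP] /nbhs_uniformP[d d0 dQ]] PQB]].
  have [|_ [[v Vv <-]/= [fv gv]]] := cl ([set h | bounded_by ((f : E -> R) - h) e] `*`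
    [set h | bounded_by ((g : E -> R) - h) e]).
    exists ([set h | bounded_by ((f : E -> R) - h) e],
      [set h | bounded_by ((g : E -> R) - h) e]) => //.
    by split; apply/nbhs_uniformP; exists e.
  by exists v.
have [|v Vv [fv gv]] := H (Num.min e d); first by rewrite lt_min e0.
exists (v, A v); split; first by exists v.
apply: PQB; split => /=.
  by apply: eP; apply: bounded_by_le fv; rewrite ge_min lexx.
by apply: dQ; apply: bounded_by_le gv; rewrite ge_min lexx orbT.
Qed.

Lemma sup_norm_le f M : bounded_by f M -> 0 <= M -> sup_norm f <= M.
Proof.
move=> fM M0; rewrite /sup_norm.
have [x0|/forallNP xM] := pselect (exists x : E, True).
  apply: ge_sup; first by case: x0 => x _; exists `|f x|; exists x.
  by move=> _ [x _ <-]; exact: fM.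
rewrite (_ : [set _ | _ in _] = set0) ?sup0//.
by apply/seteqP; split => // y [x _ _]; case: (xM x).
Qed.

Lemma bounded_by_sup_norm f M : bounded_by f M -> bounded_by f (sup_norm f).
Proof.
move=> fM x; apply: ub_le_sup; last by exists x.
by exists M => _ [y _ <-]; exact: fM.
Qed.

End UniformTopology.

Section HilleYosida.
Context {R : realType} {E : topologicalType}.
Variables (V : set (E -> R)) (A : (E -> R) -> E -> R).
Hypothesis C : dissipative_core V A.
Hypothesis Vcont : forall f, V f -> continuous f.
Hypothesis Vdense : forall f (e : R), continuous f -> 0 < e ->
  exists2 v, V v & bounded_by (f - v) e.
Hypothesis bounded : forall f : E -> R, continuous f -> exists M, bounded_by f M.

Local Notation euler := (euler V A).

Lemma geometric_small (K e : R) : 0 < e ->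
  \forall k \near \oo, K * 2^-1 ^+ k.+1 <= e.
Proof.
move=> e0.
have h0 : (fun k => K * (2^-1) ^+ k.+1 : R) @ \oo --> (0 : R).
  rewrite -(mulr0 K); apply: cvgM; first exact: cvg_cst.
  by rewrite cvg_shiftS; apply: cvg_expr; rewrite ger0_norm; lra.
move/cvgrPdist_le: h0 => /(_ _ e0); apply: filterS => k.
by rewrite sub0r normrN; apply: le_trans; exact: ler_norm.
Qed.

(** The value at f is pinned down by its distance to the Euler approximations
    of all elements of the core: the error is the distance e of f to that
    element plus the discretization error. This defines the semigroup on all
    continuous functions at once. *)
Definition limit_semigroup (s : R) (f : E -> R) : E -> R :=
  xget 0 [set g | forall v e k M, V v -> bounded_by (f - v) e ->
    bounded_by (A (A v)) M ->
    bounded_by (g - euler k s v) (e + s ^+ 2 * M * 2^-1 ^+ k.+1)].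
Local Notation T := limit_semigroup.

(** The limit is taken along elements v_n of the core that converge to f,
    with a number of time steps that may grow with the size of A^2 v_n. *)
Lemma limit_semigroupP s f v e k M : 0 <= s -> continuous f -> V v ->
  bounded_by (f - v) e -> bounded_by (A (A v)) M ->
  bounded_by (T s f - euler k s v) (e + s ^+ 2 * M * 2^-1 ^+ k.+1).
Proof.
move=> s0 fc; move: v e k M; rewrite /T; case: xgetP => [g _ Hg|no]; first exact: Hg.
exfalso.
have p2 n : 0 < 2 ^- n :> R by rewrite invr_gt0 exprn_gt0.
have /choice[p pP] n : exists p : (E -> R) * R * nat, [/\ V p.1.1,
    bounded_by (f - p.1.1) (2 ^- n), bounded_by (A (A p.1.1)) p.1.2 &
    s ^+ 2 * p.1.2 * 2^-1 ^+ p.2.+1 <= 2 ^- n].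
  have [v Vv fv] := Vdense fc (p2 n).
  have [M vM] := bounded (Vcont (core_stable C (core_stable C Vv))).
  have [k _ kP] := geometric_small (s ^+ 2 * M) (p2 n).
  by exists (v, M, k); split => //; apply: kP => /=.
set u := fun n => euler (p n).2 s (p n).1.1.
have uP n v e k M : V v -> bounded_by (f - v) e -> bounded_by (A (A v)) M ->
    bounded_by (u n - euler k s v) (2 * 2 ^- n + e + s ^+ 2 * M * 2^-1 ^+ k.+1).
  move=> Vv fv vM; have [Vp fp pM pk] := pP n.
  set m := maxn k (p n).2.
  rewrite (_ : 2 * 2 ^- n + e + _ = 2 ^- n + (2 ^- n + e + s ^+ 2 * M * 2^-1 ^+ k.+1));
    last by rewrite mulr2n mulrDl mul1r; ring.
  apply: (@bounded_by_sub _ _ _ (euler m s (p n).1.1)).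
    apply: bounded_by_subC; apply: bounded_by_le pk _.
    by apply: (euler_close C) => //; rewrite leq_maxr.
  apply: (@bounded_by_sub _ _ _ (euler m s v)); last first.
    by apply: (euler_close C) => //; rewrite leq_maxl.
  have Cm := euler_cc C m s0.
  rewrite -(ccB Cm)//; apply: (cc_contraction Cm).
    rewrite (_ : _ - _ = (-1) *: v + (p n).1.1); last by rewrite scaleN1r addrC.
    exact: (core_submod C).
  by apply: bounded_by_sub fv; exact: bounded_by_subC.
have [n m|g gP] := @uniform_cauchy_limit _ _ u.
  have [Vp fp pM pk] := pP m; apply: bounded_by_le (uP n _ _ (p m).2 _ Vp fp pM).
  by move: pk; rewrite /= -/(2 ^- m); lra.
apply: (no g) => v e k M Vv fv vM; apply: bounded_by_eps => d d0.
have [n _ nP] := geometric_small 8 d0.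
rewrite (_ : _ + _ + d = d + (e + s ^+ 2 * M * 2^-1 ^+ k.+1)); last by ring.
have dn : 4 * 2^-n <= d.
  by apply: le_trans (nP n (leqnn n)); rewrite /= exprS exprVn; lra.
apply: (@bounded_by_le _ _ _ (2 * 2 ^- n + (2 * 2 ^- n + e + s ^+ 2 * M * 2^-1 ^+ k.+1))).
  by move: dn; lra.
by apply: bounded_by_sub (uP _ _ _ _ _ Vv fv vM); exact: bounded_by_subC.
Qed.

Lemma limit_semigroup_near s f v e d : 0 <= s -> continuous f -> V v ->
  bounded_by (f - v) e -> 0 < d ->
  \forall k \near \oo, bounded_by (T s f - euler k s v) (e + d).
Proof.
move=> s0 fc Vv fv d0.
have [M vM] := bounded (Vcont (core_stable C (core_stable C Vv))).
apply: filterS (geometric_small (s ^+ 2 * M) d0) => k kd.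
by apply: bounded_by_le (limit_semigroupP k s0 fc Vv fv vM); rewrite lerD2l.
Qed.

Let sub0_bounded (v : E -> R) : bounded_by (v - v) 0.
Proof. by rewrite subrr => x; rewrite normr0. Qed.

Lemma semigroup_continuous s f : 0 <= s -> continuous f -> continuous (T s f).
Proof.
move=> s0 fc; apply: uniform_approx_continuous => e e0.
have e2 : 0 < e / 2 by lra.
have [v Vv fv] := Vdense fc e2.
have [k _ /(_ k (leqnn k)) kP] := limit_semigroup_near s0 fc Vv fv e2.
exists (euler k s v); first exact/Vcont/(cc_stable (euler_cc C k s0)).
by apply: bounded_by_le kP; lra.
Qed.

Lemma semigroup_linear s (k : R) f g : 0 <= s -> continuous f -> continuous g ->
  T s (k *: f + g) = k *: T s f + T s g.
Proof.
move=> s0 fc gc; apply/eqP; rewrite -subr_eq0; apply/eqP/bounded_by0.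
apply: bounded_by_eps => d d0; rewrite add0r.
have k0 : 0 <= `|k| by [].
have e0 : 0 < d / (3 * `|k| + 4) by apply: divr_gt0 => //; lra.
set e := d / _ in e0.
have [v Vv fv] := Vdense fc e0; have [w Vw gw] := Vdense gc e0.
have kfg : bounded_by (k *: f + g - (k *: v + w)) (`|k| * e + e).
  rewrite (_ : _ - _ = k *: (f - v) + (g - w)); last by fun_ring.
  by apply: bounded_byD gw; exact: bounded_byZ.
have kfgc : continuous (k *: f + g).
  by move=> x; apply: cvgD; [apply: cvgZr; exact: fc|exact: gc].
have [m _ /(_ m (leqnn m)) [h1 h2 h3]] : \forall m \near \oo,
    [/\ bounded_by (T s (k *: f + g) - euler m s (k *: v + w)) (`|k| * e + e + e),
       bounded_by (T s f - euler m s v) (e + e) &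
       bounded_by (T s g - euler m s w) (e + e)].
  have Vvw := core_submod C k Vv Vw.
  have F1 := limit_semigroup_near s0 kfgc Vvw kfg e0.
  have F2 := limit_semigroup_near s0 fc Vv fv e0.
  have F3 := limit_semigroup_near s0 gc Vw gw e0.
  by near=> m; split; near: m.
have Cm := euler_cc C m s0; move: h1; rewrite (cc_linear Cm)// => h1.
rewrite (_ : _ - _ = (T s (k *: f + g) - (k *: euler m s v + euler m s w)) -
  (k *: (T s f - euler m s v) + (T s g - euler m s w))); last by fun_ring.
have -> : d = (`|k| * e + e + e) + (`|k| * (e + e) + (e + e)).
  rewrite [LHS](_ : _ = (3 * `|k| + 4) * e); last first.
    by rewrite /e; field; lra.
  ring.
apply: bounded_byB h1 _; apply: bounded_byD h3; exact: bounded_byZ.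
Unshelve. all: by end_near. Qed.

Lemma semigroup_zero f : continuous f -> T 0 f = f.
Proof.
move=> fc; apply/eqP; rewrite -subr_eq0; apply/eqP/bounded_by0.
apply: bounded_by_eps => e e0; rewrite add0r.
have e2 : 0 < e / 2 by lra.
have [v Vv fv] := Vdense fc e2.
have [M vM] := bounded (Vcont (core_stable C (core_stable C Vv))).
have := limit_semigroupP 0 (lexx 0) fc Vv fv vM.
rewrite (euler0 C)// expr0n /= !mul0r addr0 => h.
have -> : e = e / 2 + e / 2 by field.
by apply: bounded_by_sub h _; exact: bounded_by_subC.
Qed.

Lemma semigroup_add s r f : 0 <= s -> 0 <= r -> continuous f ->
  T (s + r) f = T s (T r f).
Proof.
move=> s0 r0 fc; apply/eqP; rewrite -subr_eq0; apply/eqP/bounded_by0.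
apply: bounded_by_eps => d d0; rewrite add0r.
have e0 : 0 < d / 6 by lra.
set e := d / 6 in e0; have sr0 : 0 <= s + r by exact: addr_ge0.
have [v Vv fv] := Vdense fc e0.
have [M vM] := bounded (Vcont (core_stable C (core_stable C Vv))).
have [k _ /(_ k (leqnn k)) [h1 h2 h3 h4]] : \forall k \near \oo,
    [/\ bounded_by (T (s + r) f - euler k (s + r) v) (e + e),
       bounded_by (T r f - euler k r v) (e + e),
       s ^+ 2 * M * 2^-1 ^+ k.+1 <= e & s * r * M * 2 * 2^-1 ^+ k.+1 <= e].
  have F1 := limit_semigroup_near sr0 fc Vv fv e0.
  have F2 := limit_semigroup_near r0 fc Vv fv e0.
  have F3 := geometric_small (s ^+ 2 * M) e0.
  have F4 := geometric_small (s * r * M * 2) e0.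
  by near=> m; split; near: m.
have Ck := euler_cc C k r0; have Vk := cc_stable Ck Vv.
have kM : bounded_by (A (A (euler k r v))) M.
  rewrite (cc_commute Ck)// (cc_commute Ck); last exact: (core_stable C).
  by apply: (cc_contraction Ck) => //; exact/(core_stable C)/(core_stable C).
have h5 := limit_semigroupP k s0 (semigroup_continuous r0 fc) Vk h2 kM.
have h6 := euler_mul C k s0 r0 Vv vM.
have -> : d = (e + e) + (e + (e + e + e)) by rewrite /e; field.
apply: (bounded_by_sub h1); apply: bounded_by_subC.
rewrite (addrC e).
apply: (@bounded_by_sub _ _ _ (euler k s (euler k r v))).
  by apply: bounded_by_le h5; rewrite lerD2l.
apply: bounded_by_le h6; apply: le_trans h4.
by rewrite exprS; lra.
Unshelve. all: by end_near. Qed.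

Lemma semigroup_contraction s f M : 0 <= s -> continuous f ->
  bounded_by f M -> bounded_by (T s f) M.
Proof.
move=> s0 fc fM; apply: bounded_by_eps => d d0.
have e0 : 0 < d / 3 by lra.
set e := d / 3 in e0; have [v Vv fv] := Vdense fc e0.
have [k _ /(_ k (leqnn k)) h] := limit_semigroup_near s0 fc Vv fv e0.
have vM : bounded_by v (M + e).
  by rewrite -(subKr f v); exact: bounded_byB.
have -> : M + d = (e + e) + (M + e) by rewrite /e; field.
rewrite -(subrK (euler k s v) (T s f)); apply: bounded_byD h _.
exact: (cc_contraction (euler_cc C k s0)).
Qed.

Lemma semigroup_unit s : 0 <= s -> T s 1 = 1.
Proof.
move=> s0; apply/eqP; rewrite -subr_eq0; apply/eqP/bounded_by0.
have V1 := core_unit C.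
have b0 : bounded_by (A (A 1)) 0.
  by rewrite (core_conservative C) (A0 C) => x; rewrite normr0.
have := limit_semigroupP 0 s0 (Vcont V1) V1 (sub0_bounded 1) b0.
by rewrite (cc_unit (euler_cc C 0 s0)) mulr0 mul0r addr0.
Qed.

(** For 0 <= f <= M the function f - M is bounded by M in absolute value,
    so positivity follows from contraction and T 1 = 1. *)
Lemma semigroup_positive (s : R) (f : E -> R) : 0 <= s -> continuous f -> (forall x, 0 <= f x) ->
  forall x, 0 <= T s f x.
Proof.
move=> s0 fc f0 x; have [M fM] := bounded fc.
have c1 : continuous (1 : E -> R) by exact/Vcont/(core_unit C).
have gM : bounded_by ((- M) *: (1 : E -> R) + f) M.
  move=> y; have := fM y; have := f0 y; rewrite !fctE /GRing.scale/= mulr1 => ?.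
  by rewrite !ler_norml => /andP[? ?]; apply/andP; split; lra.
have gc : continuous ((- M) *: (1 : E -> R) + f).
  by move=> y; apply: cvgD; [apply: cvgZr; exact: c1|exact: fc].
have := semigroup_contraction s0 gc gM x.
rewrite semigroup_linear// semigroup_unit// !fctE /GRing.scale/= mulr1 ler_norml => /andP[+ _].
lra.
Qed.

Lemma semigroup_increment s f M : 0 <= s -> V f -> bounded_by (A f) M ->
  bounded_by (T s f - f) (s * M).
Proof.
move=> s0 Vf fM; apply: bounded_by_eps => e e0.
have [k _ /(_ k (leqnn k)) h] := limit_semigroup_near s0 (Vcont Vf) Vf (sub0_bounded f) e0.
have -> : s * M + e = (0 + e) + s * M by rewrite add0r addrC.
apply: bounded_by_sub h _.
exact: (euler_increment C).
Qed.

Lemma semigroup_expansion s f w d M : 0 <= s -> V f -> V w ->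
  bounded_by (A f - w) d -> bounded_by (A w) M ->
  bounded_by (T s f - f - s *: A f) (s * (2 * d + s * M)).
Proof.
move=> s0 Vf Vw fd wM; apply: bounded_by_eps => e e0.
have [k _ /(_ k (leqnn k)) h] := limit_semigroup_near s0 (Vcont Vf) Vf (sub0_bounded f) e0.
have -> : s * (2 * d + s * M) + e = (0 + e) + s * (2 * d + s * M).
  by rewrite add0r addrC.
rewrite (_ : _ - _ = T s f - euler k s f + (euler k s f - f - s *: A f)); last by fun_ring.
by apply: bounded_byD h _; exact: (euler_expansion C k s0 Vf Vw fd wM).
Qed.

Lemma semigroup_small_time f e : continuous f -> 0 < e ->
  exists2 d, 0 < d & forall s, 0 <= s -> s <= d -> bounded_by (T s f - f) e.
Proof.
move=> fc e0; have e3 : 0 < e / 3 by lra.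
have [v Vv fv] := Vdense fc e3.
have [M vM] := bounded (Vcont (core_stable C Vv)).
have M0 : 0 < `|M| + 1 by rewrite ltr_wpDl.
exists (e / 3 / (`|M| + 1)); first exact: divr_gt0.
move=> s s0 sd; have vc := Vcont Vv.
have -> : e = e / 3 + (e / 3 + e / 3) by field.
apply: (@bounded_by_sub _ _ _ (T s v)).
  have fvc : continuous ((-1) *: v + f).
    by move=> x; apply: cvgD; [apply: cvgZr; exact: vc|exact: fc].
  have := @semigroup_contraction s _ (e / 3) s0 fvc.
  by rewrite semigroup_linear// !scaleN1r ![- _ + _]addrC; apply.
apply: (@bounded_by_sub _ _ _ v); last exact: bounded_by_subC.
apply: (@bounded_by_le _ _ _ (s * (`|M| + 1))).
  by rewrite -ler_pdivlMr.
apply: semigroup_increment => //; apply: bounded_by_le vM.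
by apply: le_trans (ler_norm M) _; rewrite lerDl.
Qed.

Lemma semigroup_diff s f g : 0 <= s -> continuous f -> continuous g ->
  T s (f - g) = T s f - T s g.
Proof.
move=> s0 fc gc; have := semigroup_linear (-1) s0 gc fc.
by rewrite !scaleN1r ![- _ + _]addrC.
Qed.

Lemma continuousB_fun (f g : E -> R) : continuous f -> continuous g -> continuous (f - g).
Proof. by move=> fc gc x; apply: cvgB; [exact: fc|exact: gc]. Qed.

Lemma semigroup_strongly_continuous f : continuous f ->
  {within [set s : R | 0 <= s], continuous (fun s => T s f : {uniform E -> R})}.
Proof.
move=> fc; apply/(@subspace_continuousP _ _ {uniform E -> R}) => s /= s0.
apply/cvg_uniformP => e e0.
have [d d0 dP] := semigroup_small_time fc e0.
rewrite /= /within /=.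
exists d => //= t /= std t0.
have key (a b : R) : 0 <= a -> a <= b -> b - a < d -> bounded_by (T b f - T a f) e.
  move=> a0 ab bad; have ba0 : 0 <= b - a by rewrite subr_ge0.
  have -> : T b f = T a (T (b - a) f) by rewrite -semigroup_add// addrC subrK.
  have cT := semigroup_continuous ba0 fc.
  rewrite -semigroup_diff//; apply: semigroup_contraction => //; first exact: continuousB_fun.
  by apply: dP => //; exact: ltW.
have [ts|st] := leP t s.
  by apply: key => //; apply: le_lt_trans std; exact: ler_norm.
apply: bounded_by_subC; apply: key => //; first exact: ltW.
by apply: le_lt_trans std; rewrite distrC; exact: ler_norm.
Qed.

Lemma limit_semigroup_feller : feller_semigroup T.
Proof.
split.
- exact: semigroup_continuous.
- by move=> s k f g s0 fc gc; exact: (semigroup_linear k s0 fc gc).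
- exact: semigroup_zero.
- exact: semigroup_add.
- exact: semigroup_strongly_continuous.
- move=> s f s0 fc; have [M fM] := bounded fc.
  have fb := bounded_by_sup_norm fM.
  have [x0|/forallNP xM] := pselect (exists x : E, True).
    apply: sup_norm_le; first exact: semigroup_contraction.
    by case: x0 => x _; exact: le_trans (fb x).
  rewrite (_ : T s f = f)//; apply/funext => x; by case: (xM x).
- exact: semigroup_positive.
- by move=> s s0; exact: semigroup_unit.
Qed.

Let graph := [set ((v : {uniform E -> R}), (A v : {uniform E -> R})) | v in V].

Lemma generatorP (f g : E -> R) :
  generator T ((f : {uniform E -> R}), (g : {uniform E -> R})) <->
  [/\ continuous f, continuous g & forall e, 0 < e -> \forall s \near 0^'+,
    bounded_by (T s f - f - s *: g) (s * e)].
Proof.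
rewrite /generator /=; split=> -[fc gc H]; split=> //.
  move=> e e0; move/cvg_uniformP: H => /(_ e e0) /= H.
  near=> s; have s0 : 0 < s by near: s; exact: nbhs_right_gt.
  have Hs : bounded_by (g - (fun x => s^-1 * (T s f x - f x))) e by near: s; exact: H.
  move=> x; have := Hs x; rewrite !fctE /GRing.scale/= distrC => h.
  rewrite (_ : _ - _ = s * (s^-1 * (T s f x - f x) - g x)); last first.
    by rewrite mulrBr mulVKf// gt_eqF.
  by rewrite normrM gtr0_norm// ler_wpM2l// ltW.
apply/cvg_uniformP => e e0; have := H e e0 => {}H; rewrite /=.
near=> s; have s0 : 0 < s by near: s; exact: nbhs_right_gt.
have Hs : bounded_by (T s f - f - s *: g) (s * e) by near: s; exact: H.
move=> x; have := Hs x; rewrite !fctE /GRing.scale/= distrC => h.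
rewrite -(ler_pM2l s0); apply: le_trans h.
by rewrite -{1}(gtr0_norm s0) -normrM mulrBr mulVKf ?gt_eqF.
Unshelve. all: by end_near. Qed.

Lemma closure_core_generator (f g : E -> R) :
  closure graph ((f : {uniform E -> R}), (g : {uniform E -> R})) -> generator T (f, g).
Proof.
move=> /closure_graphP cl; apply/generatorP.
have fc : continuous f.
  by apply: uniform_approx_continuous => e /cl[v Vv [fv _]]; exists v => //; exact: Vcont.
have gc : continuous g.
  apply: uniform_approx_continuous => e /cl[v Vv [_ gv]]; exists (A v) => //.
  exact/Vcont/(core_stable C).
split=> // e e0; have e3 : 0 < e / 4 by lra.
have [w Vw gw] := Vdense gc e3.
have [M wM] := bounded (Vcont (core_stable C Vw)).
have M0 : 0 < `|M| + 1 by rewrite ltr_wpDl.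
have dd : 0 < e / 2 / (`|M| + 1) by apply: divr_gt0 => //; lra.
near=> s; have s0 : 0 < s by near: s; exact: nbhs_right_gt.
have sd : s <= e / 2 / (`|M| + 1) by near: s; exact: nbhs_right_le.
apply: (@bounded_by_le _ _ _ (s * (2 * (e / 4) + s * (`|M| + 1)))).
  apply: ler_wpM2l; first exact: ltW.
  by move: sd; rewrite ler_pdivlMr// => ?; lra.
apply: bounded_by_eps => d d0.
(* Compare with a core element v so close to (f, g) that the error is d. *)
have a0 : 0 < d / (2 + 3 * s) by apply: divr_gt0 => //; lra.
set a := d / _ in a0.
have [v Vv [fv gv]] := cl a a0.
have vw : bounded_by (A v - w) (a + e / 4).
  by apply: bounded_by_sub gw; exact: bounded_by_subC.
have wM' : bounded_by (A w) (`|M| + 1).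
  by apply: bounded_by_le wM; apply: le_trans (ler_norm M) _; rewrite lerDl.
have h := semigroup_expansion (ltW s0) Vv Vw vw wM'.
have vc := Vcont Vv; have fvc := continuousB_fun fc vc.
have h2 : bounded_by (T s f - T s v) a.
  rewrite -semigroup_diff//.
  by apply: semigroup_contraction => //; exact: ltW.
rewrite (_ : T s f - f - s *: g = (T s v - v - s *: A v) +
  ((T s f - T s v) - (f - v) - s *: (g - A v))); last by fun_ring.
rewrite (_ : _ + d = s * (2 * (a + e / 4) + s * (`|M| + 1)) + (a + a + `|s| * a)); last first.
  by rewrite (gtr0_norm s0) /a; field; lra.
apply: bounded_byD h _; apply: bounded_byB; first exact: bounded_byB.
exact: bounded_byZ.
Unshelve. all: by end_near. Qed.

(** An eigenfunction of the generator for the eigenvalue 1 would grow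
    exponentially under a contraction semigroup. *)
Lemma generator_eigen1 (f : E -> R) : generator T (f, f) -> f = 0.
Proof.
move=> /generatorP[fc _ H]; have [M0 fM0] := bounded fc.
have fM := bounded_by_sup_norm fM0; set M := sup_norm f in fM.
apply: bounded_by0; apply: bounded_by_eps => e e0; rewrite add0r.
have e2 : 0 < e / 2 by lra.
have {}H := H _ e2.
have [s [s0 sH]] : exists s : R, 0 < s /\ bounded_by (T s f - f - s *: f) (s * (e / 2)).
  near (0 : R)^'+ => s; exists s; split; near: s => //; exact: nbhs_right_gt.
have [x0|/forallNP xM] := pselect (exists x : E, True); last first.
  by move=> x; case: (xM x).
have M0' : 0 <= M by case: x0 => x _; exact: le_trans (fM x).
have s10 : 0 < 1 + s by lra.
(* T f - f = s f + o(s) bounds |f| by (M + s e / 2) / (1 + s), hence also M. *)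
have b : bounded_by f ((M + s * (e / 2)) / (1 + s)).
  move=> x; rewrite ler_pdivlMr// -{1}(gtr0_norm s10) mulrC -normrM.
  have := sH x; have := semigroup_contraction (ltW s0) fc fM x.
  rewrite !fctE /GRing.scale/= !ler_norml => /andP[? ?] /andP[? ?].
  by apply/andP; split; lra.
have : M <= (M + s * (e / 2)) / (1 + s).
  by apply: sup_norm_le b _; apply: divr_ge0; [nra|exact: ltW].
rewrite ler_pdivlMr// => hM; apply: bounded_by_le fM.
have : s * M <= s * (e / 2) by lra.
by rewrite ler_pM2l//; lra.
Unshelve. all: by end_near. Qed.

Lemma generatorB (f g f' g' : E -> R) : generator T (f, g) -> generator T (f', g') ->
  generator T (f - f', g - g').
Proof.
move=> /generatorP[fc gc H] /generatorP[fc' gc' H']; apply/generatorP.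
split; [exact: continuousB_fun|exact: continuousB_fun|] => e e0.
have e2 : 0 < e / 2 by lra.
have {}H := H _ e2; have {}H' := H' _ e2.
near=> s; have s0 : 0 < s by near: s; exact: nbhs_right_gt.
rewrite semigroup_diff//.
rewrite (_ : _ - _ = (T s f - f - s *: g) - (T s f' - f' - s *: g')); last by fun_ring.
have -> : s * e = s * (e / 2) + s * (e / 2) by field.
by apply: bounded_byB; near: s.
Unshelve. all: by end_near. Qed.

Lemma generator_functional (f g g' : E -> R) :
  generator T (f, g) -> generator T (f, g') -> g = g'.
Proof.
move=> fg fg'; have /generatorP[_ _] := generatorB fg fg'.
rewrite subrr => H; apply/eqP; rewrite -subr_eq0; apply/eqP/bounded_by0.
apply: bounded_by_eps => e e0; rewrite add0r; have {}H := H e e0.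
have [s [s0 sH]] : exists s : R, 0 < s /\
    bounded_by (T s 0 - 0 - s *: (g - g')) (s * e).
  near (0 : R)^'+ => s; exists s; split; near: s => //; exact: nbhs_right_gt.
have T0 : T s 0 = 0.
  by apply: bounded_by0; apply: semigroup_contraction; [exact: ltW| exact: cst_continuous|
    move=> x; rewrite normr0].
move=> x; rewrite -(ler_pM2l s0) -{1}(gtr0_norm s0) -normrM.
have := sH x; rewrite T0 subrr sub0r.
by rewrite fctE normrN.
Unshelve. all: by end_near. Qed.

(** The range of 1 - A being dense, each (f, g) in the generator has the same
    f - g as some (f', g') in the closure of the core, and then f = f'. *)
Lemma generator_closure_core (f g : E -> R) :
  generator T (f, g) -> closure graph ((f : {uniform E -> R}), (g : {uniform E -> R})).
Proof.
move=> fg; have /generatorP[fc gc _] := fg.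
have uc := continuousB_fun fc gc.
have p2 n : 0 < 2 ^- n :> R by rewrite invr_gt0 exprn_gt0.
have /choice[v vP] n : exists v, V v /\ bounded_by (f - g - (v - A v)) (2 ^- n).
  have [u Vu fgu] := Vdense uc (p2 n).
  have [v Vv vu] := core_onto C ler01 Vu.
  by exists v; split=> //; move: vu; rewrite scale1r => ->.
have VB (a b : E -> R) : V a -> V b -> V (a - b).
  move=> Va Vb; rewrite (_ : a - b = (-1) *: b + a); last by rewrite scaleN1r addrC.
  exact: (core_submod C).
have AB (a b : E -> R) : V a -> V b -> A (a - b) = A a - A b.
  move=> Va Vb; have := core_linear C (-1) Vb Va.
  by rewrite !scaleN1r ![- _ + _]addrC.
have [n m|f' f'P] := @uniform_cauchy_limit _ _ v.
  have [Vn fn] := vP n; have [Vm fm] := vP m.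
  apply: (@bounded_by_le _ _ _ (2 ^- n + 2 ^- m)).
    by have := ltW (p2 n); have := ltW (p2 m); lra.
  apply: (core_dissipative C ler01); first exact: VB.
  rewrite scale1r AB//.
  rewrite (_ : _ - _ = (v n - A (v n)) - (v m - A (v m))); last by fun_ring.
  by apply: bounded_by_sub fm; exact: bounded_by_subC.
have cl' : closure graph ((f' : {uniform E -> R}), (f' - (f - g) : {uniform E -> R})).
  apply/closure_graphP => e e0.
  have [n _ /(_ n (leqnn n)) /= nP] := geometric_small 8 e0.
  have {}nP : 4 * 2 ^- n <= e.
    by apply: le_trans nP; rewrite exprS exprVn; lra.
  have [Vn fn] := vP n; exists (v n) => //; have pn := ltW (p2 n); split.
    by apply: bounded_by_le (bounded_by_subC (f'P n)); lra.
  rewrite (_ : _ - _ = (f' - v n) - (f - g - (v n - A (v n)))); last by fun_ring.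
  apply: (@bounded_by_le _ _ _ (2 * 2 ^- n + 2 ^- n)); first by lra.
  by apply: bounded_byB fn; exact: bounded_by_subC.
have fg' := closure_core_generator cl'.
have h := generatorB fg fg'.
have ff' : f = f'.
  apply/eqP; rewrite -subr_eq0; apply/eqP; apply: generator_eigen1.
  by rewrite (_ : f - f' = g - (f' - (f - g))) in h *; [|fun_ring].
by move: cl'; rewrite -ff' (_ : f - (f - g) = g)//; fun_ring.
Qed.

Theorem dissipative_core_pre_generator :
  feller_semigroup T /\ pre_generator graph T.
Proof.
split; first exact: limit_semigroup_feller.
split.
  move=> f g h /closure_core_generator fg /closure_core_generator fh.
  exact: generator_functional fg fh.
apply/seteqP; split => -[f g].
  exact: closure_core_generator.
exact: generator_closure_core.
Qed.

End HilleYosida.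

(** * The Stone-Weierstrass theorem *)

Section CompactLocality.
Context {E : topologicalType}.
Hypothesis Ecompact : compact [set: E].

(** If Q failed globally, the complements of the sets that satisfy Q would
    form a filter without cluster point. *)
Lemma compact_local_to_global (Q : set E -> Prop) :
  Q set0 -> (forall A B, Q A -> Q B -> Q (A `|` B)) ->
  (forall A B, A `<=` B -> Q B -> Q A) ->
  (forall x : E, exists2 U : set E, nbhs x U & Q U) -> Q setT.
Proof.
move=> Q0 QU QS Qloc; apply: contrapT => nQ.
pose F : set_system E := [set A | Q (~` A)].
have FF : ProperFilter F.
  split; first by rewrite /F /= setC0.
  split; first by rewrite /F /= setCT.
    by move=> A B QA QB; rewrite /F /= setCI; exact: QU.
  by move=> A B AB; apply: QS; exact: subsetC.
have [|x [_ xF]] := Ecompact FF; first by rewrite /F /= setCT.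
have [U Ux QUx] := Qloc x.
have [|y [nUy Uy]] := xF (~` U) U _ Ux; first by rewrite /F /= setCK.
exact: nUy.
Qed.

Lemma compact_bounded {R : realType} (f : E -> R) : continuous f ->
  exists M, bounded_by f M.
Proof.
move=> fc; pose Q (A : set E) := exists M, forall x, A x -> `|f x| <= M.
suff [M HM] : Q setT by exists M => x; exact: HM.
apply: compact_local_to_global.
- by exists 0.
- move=> A B [M AM] [M' BM]; exists (Num.max M M') => x [Ax|Bx].
    by rewrite le_max AM.
  by rewrite le_max BM ?orbT.
- by move=> A B AB [M BM]; exists M => x /AB; exact: BM.
- move=> x; exists [set y | `|f x - f y| <= 1].
    by have /cvgrPdist_le/(_ 1 ltr01) := fc x.
  exists (`|f x| + 1) => y /= xy.
  have -> : f y = f x - (f x - f y) by ring.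
  by apply: le_trans (ler_normB _ _) _; rewrite lerD2l.
Qed.

End CompactLocality.

Section AbsoluteValue.
Context {R : realType}.

(** Newton-like iteration for the square root of x^2; each step is a
    polynomial in x. *)
Fixpoint abs_iter (n : nat) (x : R) : R :=
  if n is m.+1 then abs_iter m x + (x ^+ 2 - abs_iter m x ^+ 2) / 2 else 0.

(** The distance y - p to y = |x| is multiplied by 1 - (y + p) / 2 at each
    step. *)
Lemma abs_iter_bound n (x : R) : `|x| <= 1 ->
  0 <= abs_iter n x <= `|x| /\ `|x| - abs_iter n x <= `|x| * (1 - `|x| / 2) ^+ n.
Proof.
move=> x1; have y0 : 0 <= `|x| by [].
elim: n => [|n [/andP[p0 px] IH]] /=; first by split; rewrite ?expr0 ?subr0 ?mulr1 ?lexx ?y0.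
rewrite -(real_normK (num_real x)); set y := `|x| in x1 y0 p0 px IH *.
set p := abs_iter n x in p0 px IH *.
have e : y - (p + (y ^+ 2 - p ^+ 2) / 2) = (y - p) * (1 - (y + p) / 2) by field.
split; last first.
  rewrite e exprSr mulrA; apply: ler_pM => //; [by rewrite subr_ge0|lra|lra].
have : 0 <= y - (p + (y ^+ 2 - p ^+ 2) / 2).
  by rewrite e mulr_ge0 ?subr_ge0//; lra.
rewrite subr_ge0 => ->; rewrite andbT.
have : 0 <= (y - p) * (y + p) by apply: mulr_ge0; lra.
by rewrite -subr_sqr; lra.
Qed.

Lemma bernoulli_inv n (u : R) : 0 <= u <= 1 -> (1 + n%:R * u) * (1 - u) ^+ n <= 1.
Proof.
move=> /andP[u0 u1]; elim: n => [|n IH]; first by rewrite mul0r addr0 mulr1.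
apply: le_trans IH; rewrite exprS mulrA; apply: ler_wpM2r.
  by apply: exprn_ge0; lra.
rewrite -natr1; have : 0 <= n%:R :> R by []. nra.
Qed.

Lemma abs_iter_uniform n (x : R) : `|x| <= 1 ->
  `| `|x| - abs_iter n.+1 x | <= 2 / n.+1%:R.
Proof.
move=> x1; have [/andP[p0 px] H] := abs_iter_bound n.+1 x1.
rewrite ger0_norm ?subr_ge0//; apply: (le_trans H).
have y0 : 0 <= `|x| by [].
set y := `|x| in x1 y0 H *.
have u01 : 0 <= y / 2 <= 1 by apply/andP; split; lra.
have := bernoulli_inv n.+1 u01.
set w := (1 - y / 2) ^+ n.+1.
have w0 : 0 <= w by apply: exprn_ge0; lra.
rewrite ler_pdivlMr ?ltr0n//; set m : R := n.+1%:R.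
nra.
Qed.

End AbsoluteValue.

Section StoneWeierstrass.
Context {R : realType} {E : topologicalType}.
Hypothesis Ecompact : compact [set: E].
Variable B : set (E -> R).
Hypothesis Bcont : forall f, B f -> continuous f.
Hypothesis BL : forall (k : R) f g, B f -> B g -> B (k *: f + g).
Hypothesis BM : forall f g, B f -> B g -> B (fun x => f x * g x).
Hypothesis B1 : B 1.
Hypothesis Bsep : forall x y, x <> y -> exists2 f, B f & f x <> f y.

Let cl (f : E -> R) : Prop :=
  forall e : R, 0 < e -> exists2 v, B v & bounded_by (f - v) e.

Let BclW f : B f -> cl f.
Proof. by move=> Bf e e0; exists f => // x; rewrite subrr normr0 ltW. Qed.

Let cl_cont f : cl f -> continuous f.
Proof.
move=> cf; apply: uniform_approx_continuous => e /cf[v Bv fv].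
by exists v => //; exact: Bcont.
Qed.

Let cl_cl f : (forall e : R, 0 < e -> exists2 v, cl v & bounded_by (f - v) e) -> cl f.
Proof.
move=> cf e e0; have e2 : 0 < e / 2 by lra.
have [v cv fv] := cf _ e2; have [w Bw vw] := cv _ e2.
exists w => //; have -> : e = e / 2 + e / 2 by field.
exact: bounded_by_sub fv vw.
Qed.

Let clL (k : R) f g : cl f -> cl g -> cl (k *: f + g).
Proof.
move=> cf cg e e0; have k0 : 0 <= `|k| by [].
have d0 : 0 < e / (`|k| + 1) by apply: divr_gt0 => //; lra.
set d := e / _ in d0.
have [v Bv fv] := cf _ d0; have [w Bw gw] := cg _ d0.
exists (k *: v + w); first exact: BL.
rewrite (_ : _ - _ = k *: (f - v) + (g - w)); last by fun_ring.
have -> : e = `|k| * d + d by rewrite /d; field; lra.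
by apply: bounded_byD gw; exact: bounded_byZ.
Qed.

Let clM f g : cl f -> cl g -> cl (fun x => f x * g x).
Proof.
move=> cf cg e e0.
have [M fM] := compact_bounded Ecompact (cl_cont cf).
have [K gK] := compact_bounded Ecompact (cl_cont cg).
have d0 : 0 < Num.min 1 (e / (`|M| + `|K| + 1)).
  by rewrite lt_min ltr01 divr_gt0// ltr_wpDl// addr_ge0.
set d := Num.min _ _ in d0.
have d1 : d <= 1 by rewrite ge_min lexx.
have de : d * (`|M| + `|K| + 1) <= e.
  by rewrite -ler_pdivlMr ?ltr_wpDl ?addr_ge0// ge_min lexx orbT.
have [v Bv fv] := cf _ d0; have [w Bw gw] := cg _ d0.
exists (fun x => v x * w x); first exact: BM.
move=> x; apply: le_trans de.
have -> : ((fun x => f x * g x) - (fun x => v x * w x)) x =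
    f x * (g x - w x) + (f x - v x) * g x - (f x - v x) * (g x - w x).
  by rewrite !fctE; ring.
have h1 := fv x; have h2 := gw x; rewrite !fctE in h1 h2.
have h3 := le_trans (fM x) (ler_norm M); have h4 := le_trans (gK x) (ler_norm K).
apply: le_trans (ler_normB _ _) _; apply: le_trans (lerD (ler_normD _ _) (lexx _)) _.
rewrite !normrM.
have := ler_pM (normr_ge0 _) (normr_ge0 _) h3 h2.
have := ler_pM (normr_ge0 _) (normr_ge0 _) h1 h4.
have := ler_pM (normr_ge0 _) (normr_ge0 _) h1 h2.
nra.
Qed.

Let cl_abs f : cl f -> cl (fun x => `|f x|).
Proof.
move=> cf; have [M fM] := compact_bounded Ecompact (cl_cont cf).
have K0 : 0 < `|M| + 1 by rewrite ltr_wpDl.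
set K := `|M| + 1 in K0.
have cl0 : cl 0 by have := clL (-1) (BclW B1) (BclW B1); rewrite scaleN1r addNr.
have clZ k g : cl g -> cl (k *: g) by move=> cg; have := clL k cg cl0; rewrite addr0.
have c1 : cl (K^-1 *: f) by exact: clZ.
have g1 x : `|(K^-1 *: f) x| <= 1.
  rewrite fctE /GRing.scale/= normrM gtr0_norm ?invr_gt0// mulrC ler_pdivrMr// mul1r.
  by apply: le_trans (fM x) _; apply: le_trans (ler_norm M) _; rewrite lerDl.
set g := K^-1 *: f in c1 g1.
have cit n : cl (fun x => abs_iter n (g x)).
  elim: n => [//|n IH] /=.
  have := clL 2^-1 (clL (-1) (clM IH IH) (clM c1 c1)) IH.
  rewrite (_ : _ + _ = fun x => abs_iter n (g x) + (g x ^+ 2 - abs_iter n (g x) ^+ 2) / 2)//.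
  by apply/funext => x; rewrite !fctE /GRing.scale/=; field.
have cg : cl (fun x => `|g x|).
  apply: cl_cl => e e0.
  have [n _ /(_ n (leqnn n)) nP] : \forall n \near \oo, 2 / n.+1%:R <= e.
    have h0 : (fun n => 2 * n.+1%:R^-1 : R) @ \oo --> (0 : R).
      by rewrite -(mulr0 2); apply: cvgM; [exact: cvg_cst|exact: cvg_harmonic].
    move/cvgrPdist_le: h0 => /(_ _ e0); apply: filterS => n.
    by rewrite sub0r normrN; apply: le_trans; exact: ler_norm.
  exists (fun x => abs_iter n.+1 (g x)); first exact: cit.
  by move=> x; apply: le_trans nP; exact: abs_iter_uniform.
have := clZ K _ cg; rewrite (_ : _ *: _ = fun x => `|f x|)//.
apply/funext => x; rewrite !fctE /g fctE /GRing.scale/= normrM.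
by rewrite (gtr0_norm (_ : 0 < K^-1)) ?invr_gt0// mulVKf// gt_eqF.
Qed.

Let cl_max f g : cl f -> cl g -> cl (fun x => Num.max (f x) (g x)).
Proof.
move=> cf cg.
have cB := clL (-1) cg cf.
have cl0 : cl 0 by have := clL (-1) (BclW B1) (BclW B1); rewrite scaleN1r addNr.
have := clL 2^-1 (clL 1 (cl_abs cB) (clL 1 cf cg)) cl0.
rewrite (_ : _ + _ = fun x => Num.max (f x) (g x))//.
apply/funext => x; rewrite !fctE /GRing.scale/=.
rewrite mulN1r !mul1r addr0; case: leP => fg.
  by rewrite ler0_norm; [field|lra].
by rewrite gtr0_norm; [field|lra].
Qed.

Let cl_min f g : cl f -> cl g -> cl (fun x => Num.min (f x) (g x)).
Proof.
move=> cf cg.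
have cl0 : cl 0 by have := clL (-1) (BclW B1) (BclW B1); rewrite scaleN1r addNr.
have cN h : cl h -> cl (- h) by move=> ch; have := clL (-1) ch cl0; rewrite addr0 scaleN1r.
have := cN _ (cl_max (cN _ cf) (cN _ cg)).
rewrite (_ : - _ = fun x => Num.min (f x) (g x))//.
by apply/funext => x; rewrite !fctE oppr_max !opprK.
Qed.

Let interpolate (f : E -> R) x y : exists h, [/\ cl h, h x = f x & h y = f y].
Proof.
have [->|xy] := pselect (x = y).
  exists (f y *: (1 : E -> R) + 0); split.
  - apply: clL; first exact: BclW.
    by have := clL (-1) (BclW B1) (BclW B1); rewrite scaleN1r addNr.
  - by rewrite !fctE /GRing.scale/= mulr1 addr0.
  - by rewrite !fctE /GRing.scale/= mulr1 addr0.
have [g Bg gxy] := Bsep xy.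
have d0 : g x - g y != 0 by rewrite subr_eq0; apply/eqP.
pose k := (f x - f y) / (g x - g y).
exists (k *: g + ((f x - k * g x) *: (1 : E -> R) + 0)); split.
- apply: clL; first exact: BclW.
  apply: clL; first exact: BclW.
  by have := clL (-1) (BclW B1) (BclW B1); rewrite scaleN1r addNr.
- by rewrite !fctE /GRing.scale/= mulr1 addr0; ring.
- by rewrite !fctE /GRing.scale/= mulr1 addr0 /k; field.
Qed.

(** The uniform closure of the algebra is a lattice, so interpolation at two
    points extends by compactness to one-sided, then two-sided, approximation. *)
Theorem stone_weierstrass f (e : R) : continuous f -> 0 < e ->
  exists2 v, B v & bounded_by (f - v) e.
Proof.
move=> fc e0; suff: cl f by apply.
apply: cl_cl => {}e {}e0.
have near_lt (h : E -> R) x : cl h -> h x = f x ->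
    \forall z \near x, `|h z - f z| < e.
  move=> ch hx; have hfc : continuous (h - f).
    by move=> z; apply: cvgB; [exact: cl_cont|exact: fc].
  have /cvgrPdist_lt/(_ _ e0) := hfc x; apply: filterS => z /=.
  by rewrite !fctE hx subrr sub0r normrN.
have below x : exists h, [/\ cl h, h x = f x & forall z, h z < f z + e].
  pose Q (A : set E) := exists h, [/\ cl h, h x = f x & forall z, A z -> h z < f z + e].
  suff [h [ch hx hf]] : Q setT by exists h; split => // z; exact: hf.
  apply: (compact_local_to_global Ecompact).
  - by have [h [ch hx _]] := interpolate f x x; exists h; split.
  - move=> A A' [h [ch hx hA]] [h' [ch' hx' hA']].
    exists (fun z => Num.min (h z) (h' z)); split; first exact: cl_min.
      by rewrite hx hx' minxx.
    by move=> z [/hA|/hA'] lt; rewrite gt_min lt ?orbT.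
  - by move=> A A' AA' [h [ch hx hA]]; exists h; split => // z /AA'; exact: hA.
  - move=> y; have [h [ch hx hy]] := interpolate f x y.
    exists [set z | `|h z - f z| < e]; first exact: near_lt.
    by exists h; split => // z /=; rewrite ltr_norml => /andP[_]; lra.
pose Q (A : set E) := exists h, [/\ cl h, forall z, h z < f z + e &
  forall z, A z -> f z - e < h z].
have [h [ch hf fh]] : Q setT.
  apply: (compact_local_to_global Ecompact).
  - have [[x _]|nE] := pselect (exists x : E, True).
      have [h [ch hx hf]] := below x; by exists h; split.
    exists (1 : E -> R); split=> [|z|//]; first exact: BclW.
    by case: nE; exists z.
  - move=> A A' [h [ch hx hA]] [h' [ch' hx' hA']].
    exists (fun z => Num.max (h z) (h' z)); split; first exact: cl_max.
      by move=> z; rewrite gt_max hx hx'.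
    by move=> z [/hA|/hA'] lt; rewrite lt_max lt ?orbT.
  - by move=> A A' AA' [h [ch hx hA]]; exists h; split => // z /AA'; exact: hA.
  - move=> y; have [h [ch hy hf]] := below y.
    exists [set z | `|h z - f z| < e]; first exact: near_lt.
    by exists h; split => // z /=; rewrite ltr_norml => /andP[+ _]; lra.
exists h => // z; rewrite !fctE ler_norml.
by have := hf z; have := fh z I; move=> ? ?; apply/andP; split; lra.
Qed.

End StoneWeierstrass.

(** * Symmetric polynomials and Lagrange interpolation *)

Section SymmetricInduction.
Context {R : realType} {N : nat}.

(** The fundamental theorem of symmetric polynomials as an induction
    principle. *)
Lemma symmetric_induction (P : mpoly N R -> Prop) :
  (forall c, P (mpolyC N c)) ->
  (forall f g, P f -> P g -> P (f + g)) ->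
  (forall f g, P f -> P g -> P (f * g)) ->
  (forall k : 'I_N, P (mesym N R k.+1)) ->
  forall f, f \is symmetric -> P f.
Proof.
move=> PC PD PM PS f /sym_fundamental[u [<- _]].
elim/mpolyind: u => [|k m p _ _ IH].
  by rewrite comp_mpoly0 -mpolyC0; exact: PC.
rewrite comp_mpolyD comp_mpolyZ comp_mpolyX; apply: PD => //.
rewrite -mul_mpolyC; apply: (PM); first exact: PC.
apply: (big_ind P) => [|//|i _]; first by rewrite -mpolyC1; exact: PC.
rewrite tnth_mktuple; elim: (m i) => [|j IHj].
  by rewrite expr0 -mpolyC1; exact: PC.
by rewrite exprS; exact: PM.
Qed.

Definition root_poly (x : 'I_N -> R) : {poly R} := \prod_(j < N) ('X - (x j)%:P).

Lemma mesym_root_poly (x : 'I_N -> R) (k : nat) : (k <= N)%N ->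
  meval x (mesym N R k) = (-1) ^+ k * (root_poly x)`_(N - k).
Proof.
move=> kN; have kN' : (k < N.+1)%N by [].
have := mroots_coeff [tuple x i | i < N] (Ordinal kN'); rewrite /= /root_poly.
have -> : \prod_(c <- [tuple x i | i < N]) ('X - c%:P) = \prod_(j < N) ('X - (x j)%:P).
  by rewrite big_map big_enum.
move=> ->; rewrite mulrA -exprD addnn -signr_odd odd_double mul1r.
by apply: meval_eq => i; rewrite tnth_mktuple.
Qed.

Lemma size_root_poly (x : 'I_N -> R) : size (root_poly x) = N.+1.
Proof. by rewrite /root_poly size_prod_XsubC /index_enum -enumT size_enum_ord. Qed.

Lemma meval_root_poly (x y : 'I_N -> R) f : root_poly x = root_poly y ->
  f \is symmetric -> meval x f = meval y f.
Proof.
move=> xy; move: f; apply: symmetric_induction => [c|f g fE gE|f g fE gE|k].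
- by rewrite !mevalC.
- by rewrite !mevalD fE gE.
- by rewrite !mevalM fE gE.
- by rewrite !mesym_root_poly// xy.
Qed.

Lemma meval_continuous (T : topologicalType) (x : T -> 'I_N -> R) f :
  (forall k, continuous (fun u => (root_poly (x u))`_k)) ->
  f \is symmetric -> continuous (fun u => meval (x u) f).
Proof.
move=> xc; move: f; apply: symmetric_induction => [c|f g fc gc|f g fc gc|k].
- rewrite (_ : (fun _ => _) = fun=> c); last by apply/funext => u; rewrite mevalC.
  by move=> u; exact: cvg_cst.
- rewrite (_ : (fun _ => _) = fun u => meval (x u) f + meval (x u) g).
    by move=> u; apply: cvgD; [exact: fc|exact: gc].
  by apply/funext => u; rewrite mevalD.
- rewrite (_ : (fun _ => _) = fun u => meval (x u) f * meval (x u) g).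
    by move=> u; apply: cvgM; [exact: fc|exact: gc].
  by apply/funext => u; rewrite mevalM.
- rewrite (_ : (fun _ => _) =
      fun u => (-1) ^+ k.+1 * (root_poly (x u))`_(N - k.+1)).
    by move=> u; apply: cvgM; [exact: cvg_cst|exact: xc].
  by apply/funext => u; rewrite mesym_root_poly.
Qed.

(** The numerators of the summands of the operator have this form, and
    [symcoef_sum_sym] sums them. *)
Definition symcoef (phi : 'I_N -> ('I_N -> R) -> R) : Prop :=
  exists2 r : {poly (mpoly N R)}, r \is a polyOver (@symmetric_pred N R) &
    forall i x, phi i x = (map_poly (meval x) r).[x i].

Lemma symcoef_eq phi psi : (forall i x, phi i x = psi i x) -> symcoef psi -> symcoef phi.
Proof. by move=> e [r rs rE]; exists r => // i x; rewrite e rE. Qed.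

Lemma symcoef_sym f : f \is symmetric -> symcoef (fun _ x => meval x f).
Proof.
move=> fs; exists f%:P; first by rewrite polyOverC.
by move=> i x; rewrite map_polyC /= hornerC.
Qed.

Lemma symcoef_cst c : symcoef (fun _ _ => c).
Proof.
apply: (@symcoef_eq _ (fun _ x => meval x (mpolyC N c))).
  by move=> i x; rewrite mevalC.
apply: symcoef_sym; apply/issymP => s; rewrite -[mpolyC N c]mulr1 mul_mpolyC msymZ.
by rewrite msym1.
Qed.

Lemma symcoef_var : symcoef (fun i x => x i).
Proof.
exists 'X; first exact: polyOverX.
by move=> i x; rewrite map_polyX hornerX.
Qed.

Lemma symcoefD phi psi : symcoef phi -> symcoef psi ->
  symcoef (fun i x => phi i x + psi i x).
Proof.
move=> [r rs rE] [p ps pE]; exists (r + p); first exact: rpredD.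
by move=> i x; rewrite rE pE rmorphD /= hornerD.
Qed.

Lemma symcoefM phi psi : symcoef phi -> symcoef psi ->
  symcoef (fun i x => phi i x * psi i x).
Proof.
move=> [r rs rE] [p ps pE]; exists (r * p); first exact: rpredM.
by move=> i x; rewrite rE pE rmorphM /= hornerM.
Qed.

Lemma symcoefZ c phi : symcoef phi -> symcoef (fun i x => c * phi i x).
Proof. by apply: symcoefM; exact: symcoef_cst. Qed.

Lemma symcoefB phi psi : symcoef phi -> symcoef psi ->
  symcoef (fun i x => phi i x - psi i x).
Proof.
move=> hphi /(symcoefZ (-1)) hpsi; apply: symcoef_eq (symcoefD hphi hpsi) => i x.
by rewrite mulN1r.
Qed.

Lemma symcoefX phi n : symcoef phi -> symcoef (fun i x => phi i x ^+ n).
Proof.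
move=> hphi; elim: n => [|n IH]; first exact: symcoef_cst.
by apply: symcoef_eq (symcoefM hphi IH) => i x; rewrite exprS.
Qed.

Lemma symcoef_sum n (phi : nat -> 'I_N -> ('I_N -> R) -> R) :
  (forall k, symcoef (phi k)) -> symcoef (fun i x => \sum_(k < n) phi k i x).
Proof.
move=> hphi; elim: n => [|n IH].
  by apply: symcoef_eq (symcoef_cst 0) => i x; rewrite big_ord0.
by apply: symcoef_eq (symcoefD IH (hphi n)) => i x; rewrite big_ord_recr.
Qed.

Lemma root_poly_coef_sym k : exists2 f, f \is symmetric &
  forall x : 'I_N -> R, (root_poly x)`_k = meval x f.
Proof.
have [kN|kN] := leqP k N; last first.
  exists 0; first exact: rpred0.
  by move=> x; rewrite meval0 nth_default// size_root_poly.
exists ((-1) ^+ (N - k) * mesym N R (N - k)).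
  by apply: rpredM (mesym_sym _ _ _); rewrite rpredX// rpredN rpred1.
move=> x; rewrite mevalM mesym_root_poly ?leq_subr// subKn// rmorphXn rmorphN1.
by rewrite mulrA -exprD addnn -signr_odd odd_double mul1r.
Qed.

Definition cofactor_poly (i : 'I_N) (x : 'I_N -> R) : {poly R} :=
  \prod_(j < N | j != i) ('X - (x j)%:P).

Lemma root_poly_cofactor i x : root_poly x = ('X - (x i)%:P) * cofactor_poly i x.
Proof. by rewrite /root_poly (bigD1 i). Qed.

Lemma size_cofactor_poly i x : size (cofactor_poly i x) = N.
Proof.
have := size_root_poly x; rewrite (root_poly_cofactor i) size_monicM ?monicXsubC//.
  by rewrite size_XsubC => -[].
by rewrite monic_neq0// monic_prod_XsubC.
Qed.

Lemma cofactor_coef i x k :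
  (cofactor_poly i x)`_k = (root_poly x)`_k.+1 + x i * (cofactor_poly i x)`_k.+1.
Proof.
by rewrite (root_poly_cofactor i) mulrBl coefB coefXM /= coefCM subrK.
Qed.

(** Downward induction on k along [cofactor_coef]. *)
Lemma symcoef_cofactor k : symcoef (fun i x => (cofactor_poly i x)`_k).
Proof.
suff H m : forall k, (N <= k + m)%N -> symcoef (fun i x => (cofactor_poly i x)`_k).
  by apply: (H N); rewrite leq_addl.
elim: m => [|m IH] {}k.
  rewrite addn0 => Nk; apply: symcoef_eq (symcoef_cst 0) => i x.
  by rewrite nth_default// size_cofactor_poly.
rewrite addnS -addSn => /IH Ck; have [f fs fE] := root_poly_coef_sym k.+1.
apply: symcoef_eq (symcoefD (symcoef_sym fs) (symcoefM symcoef_var Ck)) => i x.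
by rewrite cofactor_coef fE.
Qed.

Lemma cofactor_scale i s x : cofactor_poly i (scale_at i s x) = cofactor_poly i x.
Proof. by apply: eq_bigr => j ji; rewrite /scale_at (negPf ji). Qed.

Lemma root_poly_scale i s x :
  root_poly (scale_at i s x) = root_poly x + ((1 - s) * x i) *: cofactor_poly i x.
Proof.
rewrite !(root_poly_cofactor i) cofactor_scale /scale_at eqxx -mul_polyC -mulrDl.
by congr (_ * _); rewrite mulrBl mul1r rmorphB /=; ring.
Qed.

(** First-order expansion in x_i of the effect of scaling one variable. The
    linear coefficient is symmetric and its dependence on the scaling factor
    s is explicit, which is what makes the poles of the operator cancel. *)
Lemma scale_expansion f : f \is symmetric ->
  exists2 L, L \is symmetric & forall s, exists2 M, symcoef M &
    forall i x, meval (scale_at i s x) f =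
      meval x f + (s - 1) * x i * meval x L + x i ^+ 2 * M i x.
Proof.
move=> fs; suff: f \is symmetric /\ exists2 L, L \is symmetric & forall s,
    exists2 M, symcoef M & forall i x, meval (scale_at i s x) f =
      meval x f + (s - 1) * x i * meval x L + x i ^+ 2 * M i x by case.
move: f fs; apply: symmetric_induction => [c|f g|f g|k].
- split.
    apply/issymP => s; rewrite -[mpolyC N c]mulr1 mul_mpolyC msymZ.
    by rewrite msym1.
  exists 0; first exact: rpred0.
  move=> s; exists (fun _ _ => 0); first exact: symcoef_cst.
  by move=> i x; rewrite !mevalC; ring.
- move=> [fs [L Ls fE]] [gs [K Ks gE]]; split; first exact: rpredD.
  exists (L + K); first exact: rpredD.
  move=> s; have [M Ms {}fE] := fE s; have [P Ps {}gE] := gE s.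
  exists (fun i x => M i x + P i x); first exact: symcoefD.
  by move=> i x; rewrite !mevalD fE gE; ring.
- move=> [fs [L Ls fE]] [gs [K Ks gE]]; split; first exact: rpredM.
  exists (L * g + f * K); first by apply: rpredD; exact: rpredM.
  move=> s; have [M Ms {}fE] := fE s; have [P Ps {}gE] := gE s.
  have Ff := symcoef_sym fs; have Fg := symcoef_sym gs.
  have FL := symcoef_sym Ls; have FK := symcoef_sym Ks; have X := symcoef_var.
  exists (fun i x => meval x f * P i x + meval x g * M i x +
    ((s - 1) * meval x L + x i * M i x) * ((s - 1) * meval x K + x i * P i x)).
    apply: symcoefD; first by apply: symcoefD; exact: symcoefM.
    by apply: symcoefM; (apply: symcoefD; [exact: symcoefZ|exact: symcoefM]).
  by move=> i x; rewrite !(mevalD, mevalM) fE gE; ring.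
- split; first exact: mesym_sym.
  set n := (N - k.+1)%N; have [p ps pE] := root_poly_coef_sym n.+1.
  exists ((-1) ^+ k * p); first by apply: rpredM ps; rewrite rpredX// rpredN rpred1.
  move=> s; exists (fun i x => (-1) ^+ k * (s - 1) * (cofactor_poly i x)`_n.+1).
    exact/symcoefZ/symcoef_cofactor.
  move=> i x; rewrite !mesym_root_poly// -/n root_poly_scale coefD coefZ.
  rewrite cofactor_coef mevalM pE rmorphXn rmorphN1 exprS; ring.
Qed.

Definition vandermonde_factor (i : 'I_N) (x : 'I_N -> R) : R :=
  \prod_(j < N | j != i) (x i - x j).

Lemma vandermonde_factor_neq0 i x : injective x -> vandermonde_factor i x != 0.
Proof.
move=> xi; rewrite /vandermonde_factor prodf_seq_neq0; apply/allP => j _.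
by apply/implyP => ji; rewrite subr_eq0; apply: contra ji => /eqP/xi ->.
Qed.

Lemma cofactor_horner i x y :
  (cofactor_poly i x).[y] = \prod_(j < N | j != i) (y - x j).
Proof.
by rewrite /cofactor_poly horner_prod; apply: eq_bigr => j _; rewrite hornerXsubC.
Qed.

Lemma cofactor_lead i x : (cofactor_poly i x)`_N.-1 = 1.
Proof.
have := monic_prod_XsubC (index_enum 'I_N) (fun j => j != i) x.
by move/monicP; rewrite lead_coefE -/(cofactor_poly i x) size_cofactor_poly.
Qed.

(** Lagrange interpolation of r, compared at the top coefficient. *)
Lemma lagrange_sum (x : 'I_N -> R) (r : {poly R}) : injective x -> (size r <= N)%N ->
  \sum_(i < N) r.[x i] / vandermonde_factor i x = r`_N.-1.
Proof.
move=> xi rN; set p := \sum_(i < N)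
  (r.[x i] / vandermonde_factor i x) *: cofactor_poly i x.
have pN : (size p <= N)%N.
  apply: (leq_trans (size_sum _ _ _)); apply/bigmax_leqP => i _.
  by apply: (leq_trans (size_scale_leq _ _)); rewrite size_cofactor_poly.
have pE k : p.[x k] = r.[x k].
  rewrite /p horner_sum (bigD1 k)//= hornerZ cofactor_horner -/(vandermonde_factor k x).
  rewrite divfK ?vandermonde_factor_neq0// big1 ?addr0// => i ik.
  by rewrite hornerZ cofactor_horner (bigD1 k) 1?eq_sym//= subrr mul0r mulr0.
have -> : r = p.
  apply/eqP; rewrite -subr_eq0; apply/eqP.
  apply: (@roots_geq_poly_eq0 _ _ (map x (enum 'I_N))).
  - by apply/allP => _ /mapP[i _ ->]; rewrite /root hornerD hornerN pE subrr.
  - by rewrite map_inj_uniq ?enum_uniq.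
  - rewrite size_map size_enum_ord; apply: (leq_trans (size_polyD _ _)).
    by rewrite size_polyN geq_max rN.
rewrite {2}/p coef_sum; apply: eq_bigr => i _.
by rewrite -pE coefZ cofactor_lead mulr1.
Qed.

(** For m < N this is interpolation; larger powers reduce to smaller ones
    because x_i is a root of the root polynomial. *)
Lemma power_sum_sym m : exists2 g, g \is symmetric & forall x : 'I_N -> R,
  injective x -> \sum_(i < N) x i ^+ m / vandermonde_factor i x = meval x g.
Proof.
elim/ltn_ind: m => m IH; have [mN|Nm] := ltnP m N.
  exists ((m == N.-1)%:R); first by case: eqP; rewrite ?rpred1 ?rpred0.
  move=> x xi; have := @lagrange_sum x 'X^m xi; rewrite size_polyXn coefXn => /(_ mN).
  rewrite eq_sym; under eq_bigr => i _ do rewrite hornerXn.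
  by move=> ->; rewrite rmorph_nat.
have /choice[p pP] k : exists p : mpoly N R, p \is symmetric /\
  forall x : 'I_N -> R, (root_poly x)`_k = meval x p.
  by have [p ps pE] := root_poly_coef_sym k; exists p.
have /choice[g gP] (k : 'I_N) : exists g : mpoly N R, g \is symmetric /\
    forall x : 'I_N -> R, injective x ->
    \sum_(i < N) x i ^+ (m - N + k) / vandermonde_factor i x = meval x g.
  have [|g gs gE] := IH (m - N + k)%N; first by have := ltn_ord k; lia.
  by exists g.
exists (- \sum_(k < N) p k * g k).
  by rewrite rpredN rpred_sum// => k _; apply: rpredM; [case: (pP k)|case: (gP k)].
move=> x xi; rewrite mevalN (rmorph_sum (meval x)) /=.
under [in RHS]eq_bigr => k _.
  rewrite mevalM -(pP k).2 -(gP k).2// mulr_sumr.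
  over.
rewrite exchange_big /= -sumrN; apply: eq_bigr => i _.
have : (root_poly x).[x i] = 0.
  by rewrite (root_poly_cofactor i) hornerM hornerXsubC subrr mul0r.
rewrite horner_coef size_root_poly big_ord_recr /= {2}/root_poly.
have -> : (root_poly x)`_N = 1.
  have := monic_prod_XsubC (index_enum 'I_N) xpredT x.
  by move/monicP; rewrite lead_coefE -/(root_poly x) size_root_poly.
rewrite mul1r => /eqP; rewrite addrC addr_eq0 => /eqP xN.
rewrite -{1}(subnK Nm) exprD xN mulrN mulNr; congr (- _).
rewrite mulr_sumr mulr_suml; apply: eq_bigr => k _.
by rewrite exprD; ring.
Qed.

Lemma symcoef_sum_sym phi : symcoef phi -> exists2 g, g \is symmetric &
  forall x : 'I_N -> R, injective x ->
    \sum_(i < N) phi i x / vandermonde_factor i x = meval x g.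
Proof.
move=> [r /polyOverP rs rE].
have /choice[h hP] (m : nat) : exists h : mpoly N R, h \is symmetric /\
    forall x : 'I_N -> R, injective x ->
    \sum_(i < N) x i ^+ m / vandermonde_factor i x = meval x h.
  by have [h hs hE] := power_sum_sym m; exists h.
exists (\sum_(m < size r) r`_m * h m).
  by apply: rpred_sum => m _; apply: rpredM; [exact: rs|case: (hP m)].
move=> x xi; rewrite (rmorph_sum (meval x)) /=.
under [in RHS]eq_bigr => m _.
  rewrite mevalM -(hP m).2// mulr_sumr.
  over.
rewrite exchange_big /=; apply: eq_bigr => i _.
rewrite rE (@horner_coef_wide _ (size r)) ?size_poly//.
rewrite mulr_suml; apply: eq_bigr => m _.
by rewrite coef_map /= mulrA.
Qed.

End SymmetricInduction.

(** * The operator on symmetric polynomials *)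

Section RealOperator.
Context {R : realType}.
Variables (N : nat) (q t a b : R) (c d : R[i]).
Hypotheses (hq : 0 < q < 1) (ht : 0 < t < 1) (hb : b < 0) (ha : 0 < a)
  (hcd : c = Num.conj d).

Definition rate_scale : R := - (t ^+ N.-1 / (a * b)).

(** The real form of [sigma_plus], for c conjugate to d. *)
Definition rate_plus (x : R) : R :=
  rate_scale * q * ((complex.Re d - x^-1) ^+ 2 + complex.Im d ^+ 2).

Definition weight (s : R) (i : 'I_N) (x : 'I_N -> R) : R :=
  \prod_(j < N | j != i) ((s * x i - x j) / (x i - x j)).

Definition DN_real (F : ('I_N -> R) -> R) (x : 'I_N -> R) : R :=
  \sum_(i < N)
    (weight t i x * rate_plus (x i) * (F (scale_at i q x) - F x) +
     weight t^-1 i x * sigma_minus N q t a b (x i) * (F (scale_at i q^-1 x) - F x)).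

Lemma sigma_plusE x : sigma_plus N q t a b c d x = real_complex R (rate_plus x).
Proof.
rewrite /sigma_plus /rate_plus /rate_scale hcd; case: d => u v /=.
by simpc; rewrite /real_complex_def; congr Complex; ring.
Qed.

Lemma DN_funE F x : DN_fun q t a b c d F x = real_complex R (DN_real F x).
Proof.
rewrite /DN_fun /DN_real rmorph_sum /=; apply: eq_bigr => i _.
by rewrite sigma_plusE [RHS]rmorphD !rmorphM.
Qed.

Lemma weightE s i x : weight s i x = (cofactor_poly i x).[s * x i] / vandermonde_factor i x.
Proof. by rewrite cofactor_horner /weight prodf_div. Qed.

Lemma symcoef_cofactor_tail s : exists2 U : 'I_N -> ('I_N -> R) -> R, symcoef U &
  forall i x, (cofactor_poly i x).[s * x i] = (cofactor_poly i x)`_0 + s * x i * U i x.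
Proof.
exists (fun i x => \sum_(k < N) (cofactor_poly i x)`_k.+1 * (s * x i) ^+ k).
  apply: (@symcoef_sum _ _ _ (fun k i x => (cofactor_poly i x)`_k.+1 * (s * x i) ^+ k)) => k.
  apply: symcoefM; first exact: symcoef_cofactor.
  exact/symcoefX/symcoefZ/symcoef_var.
move=> i x; rewrite (@horner_coef_wide _ N.+1) ?size_cofactor_poly//.
rewrite big_ord_recl expr0 mulr1; congr (_ + _).
rewrite mulr_sumr; apply: eq_bigr => k _.
by rewrite lift0 exprS; ring.
Qed.

(** Each summand is phi(x_i) divided by the product of the x_i - x_j, where
    phi has symmetric coefficients and no pole at 0: the residues at x_i = 0 of
    the two shifts are proportional to q (q - 1) and q^2 (q^-1 - 1), which add
    up to 0. *)
Lemma DN_real_symmetric f : f \is symmetric -> exists2 g, g \is symmetric &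
  forall x, generic_point x -> DN_real (fun y => meval y f) x = meval x g.
Proof.
move=> fs; have [L Ls LE] := scale_expansion fs.
have [M Ms ME] := LE q; have [M' Ms' ME'] := LE q^-1.
have [U Us UE] := symcoef_cofactor_tail t.
have [U' Us' UE'] := symcoef_cofactor_tail t^-1.
pose cc := complex.Re d ^+ 2 + complex.Im d ^+ 2.
pose cs := 2 * complex.Re d.
pose ga := a * b / q ^+ 2; pose de := (a + b) / q.
pose kap := rate_scale.
pose phi (i : 'I_N) (x : 'I_N -> R) :=
  kap * q * (t * U i x * ((q - 1) * meval x L) +
    ((cofactor_poly i x)`_0 + t * (x i * U i x)) *
      (M i x + (cc * x i - cs) * ((q - 1) * meval x L + x i * M i x))) +
  kap * q ^+ 2 * (t^-1 * U' i x * ((q^-1 - 1) * meval x L) +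
    ((cofactor_poly i x)`_0 + t^-1 * (x i * U' i x)) *
      (M' i x + (ga * x i - de) * ((q^-1 - 1) * meval x L + x i * M' i x))).
have phis : symcoef phi.
  have X := @symcoef_var R N; have C0 := @symcoef_cofactor R N 0.
  have SL := symcoef_sym Ls.
  have lin (u : R) V : symcoef V -> symcoef (fun i x => u * meval x L + x i * V i x).
    by move=> Vs; apply: symcoefD; [exact: symcoefZ|exact: symcoefM].
  have half (s u v w : R) V W : symcoef V -> symcoef W -> symcoef (fun i x =>
    (s * V i x * (u * meval x L) + ((cofactor_poly i x)`_0 + s * (x i * V i x)) *
      (W i x + (v * x i - w) * (u * meval x L + x i * W i x)))).
    move=> Vs Ws; apply: symcoefD.
      by apply: symcoefM; exact: symcoefZ.
    apply: symcoefM.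
      by apply: symcoefD => //; apply: symcoefZ; exact: symcoefM.
    apply: symcoefD => //; apply: symcoefM; last exact: lin.
    by apply: symcoefB; [exact: symcoefZ|exact: symcoef_cst].
  by apply: symcoefD; apply: symcoefZ; exact: half.
have [g gs gE] := symcoef_sum_sym phis.
exists g => // x [x0 xi]; rewrite -gE//; apply: eq_bigr => i _.
rewrite !weightE UE UE' ME ME' /rate_plus /sigma_minus /phi.
have w0 := vandermonde_factor_neq0 i xi.
have xi0 := x0 i.
rewrite /cc /cs /ga /de /kap /rate_scale.
have q0 : q != 0 by rewrite gt_eqF//; case/andP: hq.
have t0 : t != 0 by rewrite gt_eqF//; case/andP: ht.
have b0 : b != 0 by rewrite lt_eqF.
have a0 : a != 0 by rewrite gt_eqF.
by field; rewrite q0 t0 b0 a0 w0 xi0.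
Qed.

End RealOperator.

(** * The degree filtration *)

Section Degree.
Context {R : realType}.

Lemma poly_eq0_nonzero_points (p : {poly R}) :
  (forall l, l != 0 -> p.[l] = 0) -> p = 0.
Proof.
move=> p0; apply: (@roots_geq_poly_eq0 _ _ [seq k.+1%:R | k <- iota 0 (size p)]).
- by apply/allP => _ /mapP[k _ ->]; rewrite /root p0 ?pnatr_eq0.
- rewrite map_inj_uniq ?iota_uniq// => i j /eqP.
  by rewrite eqr_nat => /eqP[].
- by rewrite size_map size_iota.
Qed.

Variable N : nat.

Lemma meval_homog (n : nat) (g : mpoly N R) (l : R) x :
  g \is ishomog1 n (@mdeg N) ->
  meval (fun j => l * x j) g = l ^+ n * meval x g.
Proof.
move=> /dhomogP gn; rewrite !mevalE mulr_sumr !big_seq; apply: eq_bigr => m /gn mn.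
rewrite mulrCA; congr (_ * _).
under eq_bigr do rewrite exprMn.
rewrite big_split /= -mn /= mdegE; congr (_ * _).
by rewrite -expr_sum.
Qed.

Definition ray_poly (g : mpoly N R) (x : 'I_N -> R) : {poly R} :=
  \poly_(n < msize g) meval x (pihomog (@mdeg N) n g).

Lemma ray_polyE g x l : (ray_poly g x).[l] = meval (fun j => l * x j) g.
Proof.
rewrite horner_poly [in RHS](@pihomog_partitionE _ _ (@mdeg N) _ g (leqnn _)).
rewrite (rmorph_sum (meval _)); apply: eq_bigr => n _ /=.
by rewrite (@meval_homog n)// 1?mulrC//; exact: pihomogP.
Qed.


Lemma size_ray_poly g x : (size (ray_poly g x) <= msize g)%N.
Proof. exact: size_poly. Qed.

Lemma coef_ray_poly g x n : (ray_poly g x)`_n = meval x (pihomog (@mdeg N) n g).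
Proof.
rewrite coef_poly; case: ltnP => // gn; apply/esym/eqP.
rewrite pihomogE big_seq_cond big1 ?meval0// => m /andP[mg /eqP mn].
by have := msize_mdeg_lt mg; rewrite mn ltnNge gn.
Qed.

Variables (q t a b : R) (d : R[i]).
Hypotheses (hq : 0 < q < 1) (ht : 0 < t < 1) (hb : b < 0) (ha : 0 < a).

Lemma weight_homog s i l (x : 'I_N -> R) : l != 0 ->
  weight s i (fun j => l * x j) = weight s i x.
Proof.
move=> l0; apply: eq_bigr => j ji.
by rewrite mulrCA -!mulrBr -mulf_div divff// mul1r.
Qed.

Lemma scale_at_homog i s l (x : 'I_N -> R) :
  scale_at i s (fun j => l * x j) = (fun j => l * scale_at i s x j).
Proof. by apply/funext => j; rewrite /scale_at; case: eqP => // _; rewrite mulrCA. Qed.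

(** The weights are homogeneous of degree 0, and l^2 times a rate at l x is a
    quadratic polynomial in l. *)
Lemma DN_real_ray f (x : 'I_N -> R) : generic_point x ->
  exists2 p : {poly R}, (size p <= (msize f).+2)%N & forall l, l != 0 ->
    l ^+ 2 * DN_real q t a b d (fun y => meval y f) (fun j => l * x j) = p.[l].
Proof.
move=> [x0 xi]; set k := rate_scale N t a b.
pose rp z : {poly R} := (k * q) *: Poly [:: z^-1 ^+ 2; - (2 * complex.Re d * z^-1);
  complex.Re d ^+ 2 + complex.Im d ^+ 2].
pose rm z : {poly R} := (k * q ^+ 2) *: Poly [:: z^-1 ^+ 2; - ((a + b) / q * z^-1);
  a * b / q ^+ 2].
pose df s i := ray_poly f (scale_at i s x) - ray_poly f x.
have df_size s i : (size (df s i) <= msize f)%N.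
  apply: leq_trans (size_polyD _ _) _.
  by rewrite size_polyN geq_max !size_ray_poly.
have sz (r p : {poly R}) w : (size r <= 3)%N -> (size p <= msize f)%N ->
    (size (w *: (r * p)) <= (msize f).+2)%N.
  move=> r3 pf; apply: leq_trans (size_scale_leq _ _) _.
  by apply: leq_trans (size_polyMleq _ _) _; lia.
exists (\sum_(i < N) (weight t i x *: (rp (x i) * df q i) +
    weight t^-1 i x *: (rm (x i) * df q^-1 i))).
  apply: leq_trans (size_sum _ _ _) _; apply/bigmax_leqP => i _.
  apply: leq_trans (size_polyD _ _) _; rewrite geq_max.
  by apply/andP; split; apply: sz => //; apply: leq_trans (size_scale_leq _ _) _;
    exact: size_Poly.
move=> l l0; rewrite horner_sum mulr_sumr; apply: eq_bigr => i _.
rewrite hornerD !hornerZ !hornerM !hornerZ !horner_Poly /= /df !hornerD !hornerN.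
rewrite !ray_polyE !weight_homog// !scale_at_homog.
rewrite /rate_plus /sigma_minus -/k.
have xi0 := x0 i.
have q0 : q != 0 by rewrite gt_eqF//; case/andP: hq.
have b0 : b != 0 by rewrite lt_eqF.
have a0 : a != 0 by rewrite gt_eqF.
rewrite /k /rate_scale.
by field; rewrite q0 b0 a0 l0 xi0.
Qed.

Lemma msize_pihomog n (g : mpoly N R) : (msize (pihomog (@mdeg N) n g) <= n.+1)%N.
Proof.
rewrite msizeE; apply/bigmax_leqP_seq => m mg _.
by have /dhomogP/(_ _ mg) /= -> := pihomogP (@mdeg N) n g.
Qed.

(** By [DN_real_ray] the homogeneous components of the image of degree larger
    than that of f vanish at generic points, so they can be dropped. *)
Lemma DN_real_degree (f : mpoly N R) : f \is symmetric -> exists g, [/\ g \is symmetric,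
  (msize g <= msize f)%N & forall x, generic_point x ->
    DN_real q t a b d (fun y => meval y f) x = meval x g].
Proof.
move=> fs; have [g gs gE] := DN_real_symmetric d hq ht hb ha fs.
exists (\sum_(n < msize f) pihomog (@mdeg N) n g); split.
- by apply: rpred_sum => n _; exact: pihomog_sym.
- apply: leq_trans (mmeasure_sum _ _ _ _) _; apply/bigmax_leqP => n _.
  by apply: leq_trans (msize_pihomog _ _) _; exact: ltn_ord.
move=> x xg; rewrite gE//.
have [p ps pE] := DN_real_ray f xg.
have e : 'X^2 * ray_poly g x = p.
  apply/eqP; rewrite -subr_eq0; apply/eqP; apply: poly_eq0_nonzero_points => l l0.
  rewrite hornerD hornerN hornerM hornerXn ray_polyE -pE// gE ?subrr//.
  case: xg => x0 xi; split=> [i|i j /(mulfI l0)]; last exact: xi.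
  by rewrite mulf_neq0.
have hz n : (msize f <= n)%N -> meval x (pihomog (@mdeg N) n g) = 0.
  move=> fn; rewrite -coef_ray_poly; have := coefXnM 2 (ray_poly g x) n.+2.
  by rewrite e nth_default ?subn2//= (leq_trans ps).
have gP := @pihomog_partitionE _ _ (@mdeg N) _ g (leq_maxr (msize f) (msize g)).
rewrite [in LHS]gP !(rmorph_sum (meval x)) /=.
rewrite -(subnKC (leq_maxl (msize f) (msize g))) big_split_ord /=.
rewrite [X in _ + X]big1 ?addr0// => i _.
by apply: hz; rewrite leq_addr.
Qed.

End Degree.

(** * The space of pairs of sequences *)

Section Coordinates.
Context {R : realType}.
Variable q : R.
Hypothesis hq : 0 < q < 1.

Let q0 : 0 < q. Proof. by case/andP: hq. Qed.
Let q1 : q < 1. Proof. by case/andP: hq. Qed.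

Lemma qpow_ge0 k : 0 <= qpow q k.
Proof. by case: k => [n|] //=; rewrite exprn_ge0// ltW. Qed.

Lemma qpow_gt0 n : 0 < qpow q (Some n).
Proof. by rewrite /= exprn_gt0. Qed.

Lemma qpow_eq0 k : (qpow q k == 0) = (k == None).
Proof. by case: k => [n|]; rewrite ?eqxx// gt_eqF// qpow_gt0. Qed.

Lemma qpow_le k l : (qpow q l <= qpow q k) = Nbar_le k l.
Proof.
case: k l => [m|] [n|] //=; rewrite ?lexx//.
- by rewrite ler_iXn2l.
- by rewrite exprn_ge0// ltW.
- by rewrite leNgt exprn_gt0.
Qed.

Lemma Nbar_le_refl k : Nbar_le k k. Proof. by case: k => /=. Qed.

Lemma Nbar_le_anti k l : Nbar_le k l -> Nbar_le l k -> k = l.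
Proof.
by case: k l => [m|] [n|] //= mn nm; congr Some; apply/eqP; rewrite eqn_leq mn.
Qed.

Lemma qpow_inj k l : qpow q k = qpow q l -> k = l.
Proof. by move=> kl; apply: Nbar_le_anti; rewrite -qpow_le kl. Qed.

Lemma qpow_continuous : continuous (qpow q : Nbar -> R).
Proof.
move=> x; apply/(@cvgrPdist_lt _ _ _ _ (nbhs_filter (x : Nbar))) => e e0.
case: x => [n|].
  suff : nbhs n (Some @^-1` [set k | `|qpow q (Some n) - qpow q k| < e]) by [].
  apply: (@filterS _ (nbhs (n : nat)) (nbhs_filter (n : nat))) (@discrete_set1 nat n).
  by move=> k -> /=; rewrite subrr normr0.
have h0 : (fun k => q ^+ k.+1 : R) @ \oo --> (0 : R).
  by rewrite cvg_shiftS; apply: cvg_expr; rewrite ger0_norm// ltW.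
have [n _ nP] : \forall k \near \oo, q ^+ k.+1 < e.
  move/cvgrPdist_lt: h0 => /(_ _ e0); apply: filterS => k.
  by rewrite sub0r normrN ger0_norm// exprn_ge0// ltW.
exists (`I_n).
  split; first exact/finite_compact/finite_II.
  exact: discrete_closed.
move=> _ [[k /= /negP kn <-]|->] /=; last by rewrite subrr normr0.
rewrite sub0r normrN ger0_norm ?exprn_ge0 ?ltW//.
by apply: nP; rewrite /= leqNgt.
Qed.

End Coordinates.

Section Levels.

Lemma Nbar_le_trans k l m : Nbar_le k l -> Nbar_le l m -> Nbar_le k m.
Proof. by case: k l m => [?|] [?|] [?|] //=; apply: leq_trans. Qed.

Definition has_level (k : nat -> option nat) (p : nat) : Prop :=
  forall j, (k j == None) = (p <= j)%N.

Lemma weakly_increasing_level k : weakly_increasing k ->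
  (exists p, has_level k p) \/ forall j, k j <> None.
Proof.
move=> kinc; have [ex|/forallNP nex] := pselect (exists i, k i == None); last first.
  by right => j kj; apply: (nex j); rewrite kj.
left; exists (ex_minn ex); case: ex_minnP => p /eqP kp pmin j.
apply/idP/idP => [/pmin//|pj].
by have := kinc _ _ pj; rewrite kp; case: (k j).
Qed.

Lemma Omega_le_level N (w : Nbar_seq_pair) : Omega_le N w -> exists p r,
  [/\ (p + r <= N)%N, has_level (w.1 : nat -> option nat) p &
      has_level (w.2 : nat -> option nat) r].
Proof.
case=> -[inc1 inc2] /= card.
have bound n (g : nat + nat -> nat) :
    `I_n `<=` g @` finite_coords w -> (n <= N)%N.
  move=> sub; rewrite -card_le_II; apply: card_le_trans card.
  exact: card_le_trans (subset_card_le sub) (card_image_le _ _).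
have [[p hp]|no] := weakly_increasing_level inc1; last first.
  have := bound N.+1 (fun z => match z with inl i => i | inr j => j end).
  rewrite ltnn => h; suff : false by []; apply: h => i _.
  by exists (inl i) => //=; exact: no.
have [[r hr]|no] := weakly_increasing_level inc2; last first.
  have := bound N.+1 (fun z => match z with inl i => i | inr j => j end).
  rewrite ltnn => h; suff : false by []; apply: h => i _.
  by exists (inr i) => //=; exact: no.
exists p, r; split=> //.
apply: (bound _ (fun z => match z with inl i => i | inr j => p + j end)%N).
move=> i /= ipr; have [ip|pi] := ltnP i p.
  by exists (inl i) => //= e; have := hp i; rewrite e eqxx leqNgt ip.
exists (inr (i - p)%N) => /=; last by rewrite subnKC.
by move=> e; have := hr (i - p)%N; rewrite e eqxx; lia.
Qed.

Lemma level_Omega_le N (w : Nbar_seq_pair) p r :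
  weakly_increasing (w.1 : nat -> option nat) ->
  weakly_increasing (w.2 : nat -> option nat) ->
  (w.1 p : option nat) = None -> (w.2 r : option nat) = None -> (p + r <= N)%N ->
  Omega_le N w.
Proof.
move=> inc1 inc2 wp wr prN; split; first by split.
apply: (@card_le_trans _ _ _
  ((fun i : nat => if (i < p)%N then inl i else inr (i - p)%N) @` `I_N)); last first.
  exact: card_image_le.
apply: subset_card_le => -[i|i] /= wi.
  have ip : (i < p)%N.
    rewrite ltnNge; apply/negP => pi; have := inc1 _ _ pi.
    by rewrite wp; case: (w.1 i : option nat) wi.
  by exists i; rewrite ?ip//= (leq_trans _ prN)// ltn_addr.
have ir : (i < r)%N.
  rewrite ltnNge; apply/negP => ri; have := inc2 _ _ ri.
  by rewrite wr; case: (w.2 i : option nat) wi.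
exists (p + i)%N => /=; last by rewrite ltnNge leq_addr/= addKn.
by apply: leq_trans prN; rewrite ltn_add2l.
Qed.

End Levels.

Section ClosedConditions.
Context {R : realType} {T : topologicalType}.

Lemma closed_nonincreasing (f : nat -> T -> R) : (forall j, continuous (f j)) ->
  closed [set w | forall i j, (i <= j)%N -> f j w <= f i w].
Proof.
move=> fc; have -> : [set w | forall i j, (i <= j)%N -> f j w <= f i w] =
  \bigcap_(ij in [set ij : nat * nat | (ij.1 <= ij.2)%N])
    ((fun w => f ij.1 w - f ij.2 w) @^-1` [set y | 0 <= y]).
  apply/seteqP; split => w /= H; first by move=> [i j] /= ij; rewrite subr_ge0 H.
  by move=> i j ij; have := H (i, j) ij; rewrite /= subr_ge0.
apply: closed_bigI => -[i j] _.
have c : continuous (fun w => f i w - f j w).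
  by move=> w; apply: cvgB; exact: fc.
by have := (continuous_closedP _).1 c [set y | 0 <= y] (@closed_ge R 0).
Qed.

Lemma closed_add_eq0 (f g : T -> R) : continuous f -> continuous g ->
  closed [set w | f w + g w = 0].
Proof.
move=> fc gc; have c : continuous (fun w => f w + g w).
  by move=> w; apply: cvgD; [exact: fc|exact: gc].
by have := (continuous_closedP _).1 c [set y | y = 0] (@closed_eq R 0).
Qed.

End ClosedConditions.

Section SpaceTopology.
Context {R : realType}.
Variables (N : nat) (q t a b : R).
Hypotheses (hq : 0 < q < 1) (ht : 0 < t < 1) (hb : b < 0) (ha : 0 < a).

Let t0 : 0 < t. Proof. by case/andP: ht. Qed.
Let t1 : t < 1. Proof. by case/andP: ht. Qed.

Lemma coord1_continuous j : continuous (fun w : Nbar_seq_pair => (w.1 j : Nbar)).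
Proof.
move=> w.
have h : {for w.1, continuous (fun k : {ptws nat -> Nbar} => (k j : Nbar))}.
  exact: (@proj_continuous nat (fun=> Nbar) j w.1).
have h2 : {for w, continuous (fun w : Nbar_seq_pair => w.1)} by exact: cvg_fst.
exact: (@continuous_comp Nbar_seq_pair {ptws nat -> Nbar} Nbar fst
  (fun k : {ptws nat -> Nbar} => (k j : Nbar)) w h2 h).
Qed.

Lemma coord2_continuous j : continuous (fun w : Nbar_seq_pair => (w.2 j : Nbar)).
Proof.
move=> w.
have h : {for w.2, continuous (fun k : {ptws nat -> Nbar} => (k j : Nbar))}.
  exact: (@proj_continuous nat (fun=> Nbar) j w.2).
have h2 : {for w, continuous (fun w : Nbar_seq_pair => w.2)} by exact: cvg_snd.
exact: (@continuous_comp Nbar_seq_pair {ptws nat -> Nbar} Nbar snd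
  (fun k : {ptws nat -> Nbar} => (k j : Nbar)) w h2 h).
Qed.

Lemma qpow1_continuous j : continuous (fun w : Nbar_seq_pair => qpow q (w.1 j)).
Proof.
move=> w.
exact: (@continuous_comp Nbar_seq_pair Nbar R (fun w => (w.1 j : Nbar)) (qpow q)
  w (@coord1_continuous j w) (@qpow_continuous R q hq (w.1 j))).
Qed.

Lemma qpow2_continuous j : continuous (fun w : Nbar_seq_pair => qpow q (w.2 j)).
Proof.
move=> w.
exact: (@continuous_comp Nbar_seq_pair Nbar R (fun w => (w.2 j : Nbar)) (qpow q)
  w (@coord2_continuous j w) (@qpow_continuous R q hq (w.2 j))).
Qed.

(** Since [qpow] is decreasing, monotonicity is a family of inequalities
    between continuous functions; the bound on the number of finite coordinates
    says that for some p <= N the coordinates p and N - p are infinite. *)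
Lemma Omega_le_closed : closed (Omega_le N).
Proof.
have -> : Omega_le N =
    [set w | forall i j, (i <= j)%N -> qpow q (w.1 j) <= qpow q (w.1 i)] `&`
    [set w | forall i j, (i <= j)%N -> qpow q (w.2 j) <= qpow q (w.2 i)] `&`
    \big[setU/set0]_(p <- iota 0 N.+1) (fun w : Nbar_seq_pair =>
      qpow q (w.1 p) + qpow q (w.2 (N - p)%N) = 0).
  apply/seteqP; split => w.
    move=> wN; have [p [r [pr hp hr]]] := Omega_le_level wN; case: wN => -[i1 i2] _.
    split; first by split=> i j ij /=; rewrite qpow_le//; [exact: i1|exact: i2].
    have pN : p \in iota 0 N.+1 by rewrite mem_iota; lia.
    rewrite -bigcup_seq; exists p => //.
    have /eqP -> : (w.1 p : option nat) == None by rewrite hp.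
    have /eqP -> : (w.2 (N - p)%N : option nat) == None by rewrite hr; lia.
    by rewrite /mkset /= addr0.
  move=> [[i1 i2]]; rewrite -bigcup_seq => -[p pI /eqP].
  have {pI} pN : (p < N.+1)%N by have : p \in iota 0 N.+1 by []; rewrite mem_iota.
  rewrite paddr_eq0 ?qpow_ge0// !qpow_eq0// => /andP[/eqP w1 /eqP w2].
  apply: level_Omega_le w1 w2 _; last by lia.
    by move=> i j ij; rewrite -(qpow_le hq); exact: i1.
  by move=> i j ij; rewrite -(qpow_le hq); exact: i2.
apply: closedI; first apply: closedI.
- exact: (closed_nonincreasing qpow1_continuous).
- exact: (closed_nonincreasing qpow2_continuous).
apply: closed_bigsetU => p _.
exact: (closed_add_eq0 (@qpow1_continuous p) (@qpow2_continuous (N - p)%N)).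
Qed.

Lemma Omega_le_compact : compact (Omega_le N).
Proof.
apply: (subclosed_compact Omega_le_closed (B := [set: Nbar_seq_pair])); last by [].
have h : compact [set: {ptws nat -> Nbar}].
  have := @tychonoff nat (fun=> Nbar) (fun=> setT)
    (fun=> one_point_compactification_compact).
  by rewrite (_ : [set f | _] = setT)//; apply/seteqP; split.
have := compact_setX h h.
by rewrite (_ : _ `*` _ = setT)//; apply/seteqP; split.
Qed.

Local Notation E := (OmegaN N q t a b).

Definition coords (e : E) : Nbar_seq_pair := omega_of e.

Lemma coordsP (e : E) : Omega_le N (coords e).
Proof. by rewrite /coords /omega_of; case: cid2. Qed.

Lemma embed_coords (e : E) : embed q t a b (coords e) = set_val e.
Proof. by rewrite /coords /omega_of; case: cid2. Qed.

Lemma embed_inj w w' : embed q t a b w = embed q t a b w' -> w = w'.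
Proof.
case: w w' => [w1 w2] [u1 u2] [] /= e1 e2.
have tj j : t ^+ j != 0 by rewrite gt_eqF// exprn_gt0.
congr pair; apply/funext => j; apply: (qpow_inj hq).
  have /mulIf := tj j; apply.
  have /mulfI : a^-1 != 0 by rewrite invr_eq0 gt_eqF.
  by apply; rewrite !mulrA; exact: (congr1 (fun f => f j) e1).
have /mulIf := tj j; apply.
have /mulfI : b^-1 != 0 by rewrite invr_eq0 lt_eqF.
by apply; rewrite !mulrA; exact: (congr1 (fun f => f j) e2).
Qed.

Lemma coords_inj : injective coords.
Proof.
move=> e e' ee'; apply: val_inj.
by have := embed_coords e; rewrite ee' embed_coords set_valE => /esym.
Qed.

Lemma coords_surj w : Omega_le N w -> exists e : E, coords e = w.
Proof.
move=> wN; have wI : Omega_image N q t a b (embed q t a b w) by exists w.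
exists (SigSub (mem_set wI) : set_type (Omega_image N q t a b)).
by apply: embed_inj; rewrite embed_coords.
Qed.

Lemma coords_continuous : continuous coords.
Proof. exact: initial_continuous. Qed.

Lemma OmegaN_compact : compact [set: E].
Proof.
move=> F FF _.
have [w [wN wF]] : Omega_le N `&` cluster (coords @ F) !=set0.
  apply: Omega_le_compact; rewrite /= /nbhs /=.
  by apply: filterS filterT => e _; exact: coordsP.
have [e ew] := coords_surj wN; exists e; split=> // A B FA eB.
have [U [[V oV VU] Ue UB]] : exists U, [/\ open U, U e & U `<=` B].
  by move: eB; rewrite nbhsE => -[U [oU Ue] UB]; exists U.
have FA' : (coords @ F) (coords @` A).
  by apply: (@filterS _ F _ A) => // z Az; exists z.
have nV : nbhs w V.
  rewrite -ew; apply: open_nbhs_nbhs; split => //.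
  by move: Ue; rewrite -VU.
have [_ [[z Az <-] Vz]] := wF _ _ FA' nV.
by exists z; split => //; apply: UB; rewrite -VU.
Qed.

End SpaceTopology.

(** * Configurations *)

Section PolyContinuity.
Context {R : realType} {T : topologicalType}.

Lemma sum_continuous n (g : nat -> T -> R) : (forall i, continuous (g i)) ->
  continuous (fun u => \sum_(i < n) g i u).
Proof.
move=> gc; elim: n => [|m IHm].
  rewrite (_ : (fun _ => _) = fun=> 0); first by move=> u; exact: cvg_cst.
  by apply/funext => u; rewrite big_ord0.
rewrite (_ : (fun _ => _) = fun u => \sum_(i < m) g i u + g m u).
  by move=> u; apply: cvgD; [exact: IHm|exact: gc].
by apply/funext => u; rewrite big_ord_recr.
Qed.

Lemma prod_coef_continuous (F : nat -> T -> {poly R}) n :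
  (forall j k, continuous (fun u => (F j u)`_k)) ->
  forall k, continuous (fun u => (\prod_(j < n) F j u)`_k).
Proof.
move=> Fc; elim: n => [|n IH] k.
  rewrite (_ : (fun _ => _) = fun=> (1 : {poly R})`_k); first by move=> u; exact: cvg_cst.
  by apply/funext => u; rewrite big_ord0.
rewrite (_ : (fun _ => _) = fun u => \sum_(i < k.+1)
    (\prod_(j < n) F j u)`_i * (F n u)`_(k - i)); last first.
  by apply/funext => u; rewrite big_ord_recr /= coefM.
apply: (@sum_continuous _ (fun i u => (\prod_(j < n) F j u)`_i * (F n u)`_(k - i))) => i u.
by apply: cvgM; [exact: IH|exact: Fc].
Qed.

Lemma scale2_continuous (c d : R) (f : T -> R) : continuous f ->
  continuous (fun u => c * f u * d).
Proof.
move=> fc u; apply: cvgM; last exact: cvg_cst.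
by apply: cvgM; [exact: cvg_cst|exact: fc].
Qed.

Lemma XsubC_coef_continuous (y : T -> R) k : continuous y ->
  continuous (fun u => ('X - (y u)%:P)`_k).
Proof.
move=> yc; rewrite (_ : (fun _ => _) = fun u => ('X : {poly R})`_k - (if k == 0 then y u else 0)).
  move=> u; apply: cvgB; first exact: cvg_cst.
  by case: eqP => _; [exact: yc|exact: cvg_cst].
by apply/funext => u; rewrite coefB coefC.
Qed.

End PolyContinuity.

Section Configurations.
Context {R : realType}.
Variables (N : nat) (q t a b : R).
Hypotheses (hq : 0 < q < 1) (ht : 0 < t < 1) (hb : b < 0) (ha : 0 < a).

Let t0 : 0 < t. Proof. by case/andP: ht. Qed.
Let t1 : t < 1. Proof. by case/andP: ht. Qed.
Let q0 : 0 < q. Proof. by case/andP: hq. Qed.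
Let q1 : q < 1. Proof. by case/andP: hq. Qed.

Local Notation E := (OmegaN N q t a b).

Definition pos_point (w : Nbar_seq_pair) (j : nat) : R := a^-1 * qpow q (w.1 j) * t ^+ j.
Definition neg_point (w : Nbar_seq_pair) (j : nat) : R := b^-1 * qpow q (w.2 j) * t ^+ j.

Lemma pos_point_eq0 w j : (pos_point w j == 0) = ((w.1 j : option nat) == None).
Proof.
rewrite /pos_point !mulf_eq0 invr_eq0 (gt_eqF ha) /= (qpow_eq0 hq).
by rewrite (gt_eqF (exprn_gt0 _ t0)) orbF.
Qed.

Lemma neg_point_eq0 w j : (neg_point w j == 0) = ((w.2 j : option nat) == None).
Proof.
rewrite /neg_point !mulf_eq0 invr_eq0 (lt_eqF hb) /= (qpow_eq0 hq).
by rewrite (gt_eqF (exprn_gt0 _ t0)) orbF.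
Qed.

Lemma pos_point_ge0 w j : 0 <= pos_point w j.
Proof. by rewrite /pos_point !mulr_ge0 ?invr_ge0 ?exprn_ge0 ?qpow_ge0// ltW. Qed.

Lemma neg_point_le0 w j : neg_point w j <= 0.
Proof.
rewrite /neg_point -mulrA; apply: mulr_le0_ge0; first by rewrite invr_le0 ltW.
by rewrite mulr_ge0 ?qpow_ge0// exprn_ge0// ltW.
Qed.

(** Positive points first, in decreasing order, then the negative ones; the
    remaining entries are zeros because [neg_point] vanishes there. *)
Lemma config_level (e : E) p r : (p + r <= N)%N ->
  has_level ((coords e).1 : nat -> option nat) p ->
  has_level ((coords e).2 : nat -> option nat) r ->
  config e = fun i : 'I_N =>
    if (i < p)%N then pos_point (coords e) i else neg_point (coords e) (i - p).
Proof.
move=> prN hp hr; apply/funext => i; rewrite /config -embed_coords /embed /=.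
set w := coords e in hp hr *.
have filt (f : nat -> R) m : (m <= N)%N -> (forall j, (f j == 0) = (m <= j)%N) ->
    [seq r <- [seq f j | j <- iota 0 N] | r != 0] = [seq f j | j <- iota 0 m].
  move=> mN fm; rewrite filter_map; congr map.
  rewrite -(subnKC mN) iotaD filter_cat add0n.
  have /all_filterP -> : all (preim f (fun r => r != 0)) (iota 0 m).
    by apply/allP => j; rewrite mem_iota add0n /= fm -ltnNge.
  rewrite (@eq_in_filter _ _ pred0) ?filter_pred0 ?cats0// => j.
  by rewrite mem_iota /= => /andP[mj _]; rewrite fm mj.
rewrite filter_cat.
have pN : (p <= N)%N by apply: leq_trans prN; rewrite leq_addr.
have rN : (r <= N)%N by apply: leq_trans prN; rewrite leq_addl.
rewrite (filt (pos_point w) p)//; last by move=> j; rewrite pos_point_eq0 hp.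
rewrite (filt (neg_point w) r)//; last by move=> j; rewrite neg_point_eq0 hr.
rewrite nth_cat size_map size_iota; case: ltnP => ip.
  by rewrite (nth_map 0) ?size_iota// nth_iota.
have [ir|ri] := ltnP (i - p) r; first by rewrite (nth_map 0) ?size_iota// nth_iota.
rewrite nth_default ?size_map ?size_iota//; apply/esym/eqP.
by rewrite neg_point_eq0 hr.
Qed.

Lemma config_levels (e : E) : exists p r, [/\ (p + r <= N)%N,
  has_level ((coords e).1 : nat -> option nat) p,
  has_level ((coords e).2 : nat -> option nat) r &
  config e = fun i : 'I_N =>
    if (i < p)%N then pos_point (coords e) i else neg_point (coords e) (i - p)].
Proof.
have [p [r [prN hp hr]]] := Omega_le_level (coordsP e).
by exists p, r; split => //; exact: (config_level prN hp hr).
Qed.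

(** The zeros that complete the multiset are accounted for by the power of
    the variable. *)
Lemma root_poly_config (e : E) : root_poly (config e) * 'X^N =
  (\prod_(j < N) ('X - (pos_point (coords e) j)%:P)) *
  (\prod_(j < N) ('X - (neg_point (coords e) j)%:P)).
Proof.
have [p [r [prN hp hr ->]]] := config_levels e; set w := coords e in hp hr *.
have pN : (p <= N)%N by apply: leq_trans prN; rewrite leq_addr.
have tail (f : nat -> R) m : (m <= N)%N -> (forall j, (m <= j)%N -> f j = 0) ->
    \prod_(j < N) ('X - (f j)%:P) = (\prod_(0 <= j < m) ('X - (f j)%:P)) * 'X^(N - m).
  move=> mN f0; rewrite -(big_mkord xpredT (fun j => 'X - (f j)%:P)).
  rewrite (@big_cat_nat _ _ _ m)//=; congr (_ * _).
  rewrite (@eq_big_nat _ _ _ _ _ _ (fun=> 'X)); last first.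
    by move=> j /andP[mj _]; rewrite f0// subr0.
  by rewrite prodr_const_nat.
rewrite (tail (pos_point w) p)//; last first.
  by move=> j pj; apply/eqP; rewrite pos_point_eq0 hp.
rewrite (tail (neg_point w) (N - p)%N) ?leq_subr//; last first.
  by move=> j pj; apply/eqP; rewrite neg_point_eq0 hr; lia.
rewrite mulrACA -exprD subKn// subnK// mulrC [RHS]mulrC; congr (_ * _).
rewrite /root_poly -(big_mkord xpredT (fun i =>
  'X - (if (i < p)%N then pos_point w i else neg_point w (i - p))%:P)).
rewrite (@big_cat_nat _ _ _ p)//=; congr (_ * _).
  by apply: eq_big_nat => i /andP[_ ->].
rewrite -{1}(add0n p) big_addn; apply: eq_big_nat => i _.
by rewrite ltnNge leq_addl /= addnK.
Qed.

Lemma pos_point_continuous j : continuous (fun e : E => pos_point (coords e) j).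
Proof.
have h : continuous (fun e : E => qpow q ((coords e).1 j)).
  move=> e; exact: (@continuous_comp E Nbar_seq_pair R (@coords R N q t a b)
    (fun w => qpow q (w.1 j)) e (@coords_continuous R N q t a b e)
    (@qpow1_continuous R q hq j (coords e))).
by have := @scale2_continuous R E a^-1 (t ^+ j) _ h.
Qed.

Lemma neg_point_continuous j : continuous (fun e : E => neg_point (coords e) j).
Proof.
have h : continuous (fun e : E => qpow q ((coords e).2 j)).
  move=> e; exact: (@continuous_comp E Nbar_seq_pair R (@coords R N q t a b)
    (fun w => qpow q (w.2 j)) e (@coords_continuous R N q t a b e)
    (@qpow2_continuous R q hq j (coords e))).
by have := @scale2_continuous R E b^-1 (t ^+ j) _ h.
Qed.

Lemma eval_sym_continuous (f : mpoly N R) : f \is symmetric ->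
  continuous (eval_sym f : E -> R).
Proof.
move=> fs; apply: meval_continuous => // k.
rewrite (_ : (fun _ => _) = fun e : E => \sum_(i < (k + N).+1)
  (\prod_(j < N) ('X - (pos_point (coords e) j)%:P))`_i *
  (\prod_(j < N) ('X - (neg_point (coords e) j)%:P))`_(k + N - i)); last first.
  apply/funext => e; rewrite -coefM -root_poly_config coefMXn.
  by rewrite ltnNge leq_addl /= addnK.
have c1 i : continuous (fun e : E =>
    (\prod_(j < N) ('X - (pos_point (coords e) j)%:P))`_i).
  apply: (@prod_coef_continuous R E (fun j (e : E) => 'X - (pos_point (coords e) j)%:P) N).
  by move=> j m; apply: XsubC_coef_continuous => e; exact: pos_point_continuous.
have c2 i : continuous (fun e : E =>
    (\prod_(j < N) ('X - (neg_point (coords e) j)%:P))`_i).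
  apply: (@prod_coef_continuous R E (fun j (e : E) => 'X - (neg_point (coords e) j)%:P) N).
  by move=> j m; apply: XsubC_coef_continuous => e; exact: neg_point_continuous.
apply: (@sum_continuous R E (k + N).+1 (fun i (e : E) =>
  (\prod_(j < N) ('X - (pos_point (coords e) j)%:P))`_i *
  (\prod_(j < N) ('X - (neg_point (coords e) j)%:P))`_(k + N - i))) => i e.
exact: (cvgM (@c1 i e) (@c2 (k + N - i)%N e)).
Qed.

Lemma pos_point_step (w : Nbar_seq_pair) i j :
  weakly_increasing (w.1 : nat -> option nat) -> (i < j)%N ->
  pos_point w j <= t * pos_point w i.
Proof.
move=> inc ij; have := inc _ _ (ltnW ij); rewrite -(qpow_le hq) => h.
rewrite /pos_point mulrCA -exprS -!mulrA; apply: ler_wpM2l; first by rewrite invr_ge0 ltW.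
apply: ler_pM => //; [exact: qpow_ge0|by rewrite exprn_ge0// ltW|].
by rewrite ler_wiXn2l// ltW.
Qed.

Lemma neg_point_step (w : Nbar_seq_pair) i j :
  weakly_increasing (w.2 : nat -> option nat) -> (i < j)%N ->
  t * neg_point w i <= neg_point w j.
Proof.
move=> inc ij; have := inc _ _ (ltnW ij); rewrite -(qpow_le hq) => h.
rewrite /neg_point mulrCA -exprS -!mulrA; apply: ler_wnM2l; first by rewrite invr_le0 ltW.
apply: ler_pM => //; [exact: qpow_ge0|by rewrite exprn_ge0// ltW|].
by rewrite ler_wiXn2l// ltW.
Qed.

(** Being sorted, this list is determined by the multiset of its entries, which
    is that of the configuration and N more zeros. *)
Let sorted_points (w : Nbar_seq_pair) (k : nat) : R :=
  if (k < N)%N then pos_point w k else neg_point w (N + N - k.+1).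

Let sorted_pointsP w : Omega_le N w -> sorted >=%R (mkseq (sorted_points w) (N + N)).
Proof.
case=> -[i1 i2] _; apply/(sortedP 0) => k; rewrite size_mkseq => kN.
rewrite !nth_mkseq//; last exact: ltnW.
rewrite /sorted_points /= ; have [kN1|kN1] := ltnP k.+1 N.
  rewrite (ltnW kN1); apply: (le_trans (pos_point_step i1 (ltnSn k))).
  by have := pos_point_ge0 w k; have := t1; nra.
have [kN2|kN2] := ltnP k N.
  exact: le_trans (neg_point_le0 _ _) (pos_point_ge0 _ _).
have e : (N + N - k.+1 = (N + N - k.+2).+1)%N by lia.
rewrite e; apply: le_trans (neg_point_step i2 (ltnSn _)).
have := neg_point_le0 w (N + N - k.+2)%N; have := t1; nra.
Qed.

Lemma sorted_points_root (e : E) : root_poly (config e) * 'X^N =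
  \prod_(r <- mkseq (sorted_points (coords e)) (N + N)) ('X - r%:P).
Proof.
rewrite root_poly_config big_map.
have -> : iota 0 (N + N) = index_iota 0 (N + N) by rewrite /index_iota subn0.
rewrite (@big_cat_nat _ _ _ N) ?leq_addr//=; congr (_ * _).
  rewrite big_mkord; apply: eq_bigr => i _.
  by rewrite /sorted_points ltn_ord.
have := @big_addn _ 1 *%R 0 (N + N) N xpredT
  (fun i => 'X - (sorted_points (coords e) i)%:P).
rewrite add0n addnK => ->; rewrite big_nat_rev /= add0n big_mkord.
apply: eq_bigr => i _; rewrite /sorted_points ltnNge leq_addl /=.
by congr ('X - (neg_point _ _)%:P); have := ltn_ord i; lia.
Qed.

(** The symmetric polynomials determine the root polynomial, hence the sorted
    list of points, from which the exponents are read off. *)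
Lemma symmetric_separates (e e' : E) : e <> e' ->
  exists2 f : mpoly N R, f \is symmetric & eval_sym f e <> eval_sym f e'.
Proof.
move=> ee'; apply: contrapT => /forall2NP same; apply: ee'.
have rp : root_poly (config e) = root_poly (config e').
  apply/polyP => k; have [f fs fE] := @root_poly_coef_sym R N k.
  by rewrite !fE; case: (same f) => // /contrapT.
have ee : mkseq (sorted_points (coords e)) (N + N) =
    mkseq (sorted_points (coords e')) (N + N).
  apply: (@sorted_eq _ >=%R) => //.
  - by move=> x y z xy yz; exact: le_trans yz xy.
  - by move=> x y /andP[? ?]; apply/eqP; rewrite eq_le; apply/andP.
  - exact/sorted_pointsP/coordsP.
  - exact/sorted_pointsP/coordsP.
  by apply: prod_XsubC_eq; rewrite -!sorted_points_root rp.
have nthE k : (k < N + N)%N -> sorted_points (coords e) k = sorted_points (coords e') k.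
  by move=> kN; have := congr1 (nth 0 ^~ k) ee; rewrite !nth_mkseq.
have [p [r [prN hp hr _]]] := config_levels e.
have [p' [r' [prN' hp' hr' _]]] := config_levels e'.
apply: coords_inj; apply: (@embed_inj R q t a b) => //.
rewrite /embed; congr pair; apply/funext => j.
  have [jN|Nj] := ltnP j N.
    by have := nthE j; rewrite /sorted_points jN; apply; lia.
  have /eqP -> : ((coords e).1 j : option nat) == None by rewrite hp; lia.
  by have /eqP -> : ((coords e').1 j : option nat) == None by rewrite hp'; lia.
have [jN|Nj] := ltnP j N.
  have := nthE (N + N - j.+1)%N; rewrite /sorted_points.
  have -> : (N + N - j.+1 < N)%N = false by lia.
  have -> : (N + N - (N + N - j.+1).+1 = j)%N by lia.
  by apply; lia.
have /eqP -> : ((coords e).2 j : option nat) == None by rewrite hr; lia.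
by have /eqP -> : ((coords e').2 j : option nat) == None by rewrite hr'; lia.
Qed.

End Configurations.

(** * Jumps and the maximum principle for nonzero points *)

Section Updates.

Definition update (k : nat -> option nat) (i n : nat) : nat -> option nat :=
  fun j => if j == i then Some n else k j.

Lemma update_weakly_increasing k i n : weakly_increasing k ->
  ((0 < i)%N -> Nbar_le (k i.-1) (Some n)) -> Nbar_le (Some n) (k i.+1) ->
  weakly_increasing (update k i n).
Proof.
move=> inc low up j l jl; rewrite /update.
have [ji | ji] := eqVneq j i; have [li | li] := eqVneq l i.
- exact: Nbar_le_refl.
- by apply: Nbar_le_trans up _; apply: inc; lia.
- by apply: Nbar_le_trans (low _); [apply: inc; lia|lia].
- exact: inc.
Qed.

Lemma update_level k p i n : has_level k p -> (i < p)%N -> has_level (update k i n) p.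
Proof.
move=> kp ip j; rewrite /update; have [->|_] := eqVneq j i; last exact: kp.
by rewrite leqNgt ip.
Qed.

Lemma update_level_succ k p n : has_level k p -> has_level (update k p n) p.+1.
Proof.
move=> kp j; rewrite /update; have [->|ji] := eqVneq j p; first by rewrite ltnn.
by rewrite kp; lia.
Qed.

Lemma has_level_some k p i : has_level k p -> (i < p)%N -> exists n, k i = Some n.
Proof.
move=> kp ip; have := kp i; case: (k i) => [n|]; first by exists n.
by rewrite eqxx leqNgt ip.
Qed.

End Updates.

Section Jumps.
Context {R : realType}.
Variables (N : nat) (q t a b : R) (d : R[i]).
Hypotheses (hq : 0 < q < 1) (ht : 0 < t < 1) (hb : b < 0) (ha : 0 < a).

Let t0 : 0 < t. Proof. by case/andP: ht. Qed.
Let t1 : t < 1. Proof. by case/andP: ht. Qed.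
Let q0 : 0 < q. Proof. by case/andP: hq. Qed.
Let q1 : q < 1. Proof. by case/andP: hq. Qed.

Local Notation E := (OmegaN N q t a b).

(** The configurations without zeros, on which the rates of the operator are
    finite. *)
Definition full (e : E) : Prop := exists p r, [/\ (p + r = N)%N,
  has_level ((coords e).1 : nat -> option nat) p &
  has_level ((coords e).2 : nat -> option nat) r].

(** This lets the positive and the negative points, which occupy two blocks of
    indices starting at off, be treated at once. *)
Lemma full_side (e : E) (i : 'I_N) : full e ->
  exists (base : R) (k : nat -> option nat) (off n : nat),
  [/\ base = a^-1 \/ base = b^-1, (off <= i)%N, k (i - off)%N = Some n &
    weakly_increasing k] /\
  [/\ forall j : 'I_N, (off <= j)%N -> k (j - off)%N <> None ->
        config e j = base * qpow q (k (j - off)%N) * t ^+ (j - off),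
      forall m, k m <> None -> (off + m < N)%N &
      forall n' z, ((0 < i - off)%N -> Nbar_le (k (i - off).-1) (Some n')) ->
        Nbar_le (Some n') (k (i - off).+1) -> q ^+ n'.+1 = z * q ^+ n.+1 ->
        exists e' : E, config e' = scale_at i z (config e)].
Proof.
move=> [p [r [prN hp hr]]]; set w := coords e in hp hr.
have prN' : (p + r <= N)%N by rewrite prN.
have cE := config_level hq ht hb ha prN' hp hr; rewrite -/w in cE.
have [[i1 i2] _] : Omega_le N w := coordsP e.
have [ip|pi] := ltnP i p.
  have [n wn] := has_level_some hp ip.
  exists a^-1, (w.1 : nat -> option nat), 0%N, n; split.
    by split; rewrite ?subn0//; left.
  split.
  - move=> j _; rewrite subn0 => wj; rewrite cE.
    by rewrite ltnNge -hp; case: eqP wj.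
  - by move=> m wm; rewrite add0n; apply: leq_trans prN'; rewrite ltn_addr// ltnNge -hp; apply/eqP.
  - move=> n' z; rewrite subn0 => low up zn.
    pose w' : Nbar_seq_pair := (update w.1 i n', w.2).
    have hp' : has_level (w'.1 : nat -> option nat) p by exact: update_level.
    have i1' : weakly_increasing (w'.1 : nat -> option nat).
      exact: update_weakly_increasing.
    have [|e' e'w] := @coords_surj R N q t a b hq ht hb ha w'.
      apply: (level_Omega_le i1' i2 _ _ prN').
        by have := hp' p; rewrite leqnn => /eqP.
      by have := hr r; rewrite leqnn => /eqP.
    exists e'; have hp2 := hp'; rewrite -e'w in hp2.
    have hr2 : has_level ((coords e').2 : nat -> option nat) r by rewrite e'w.
    rewrite (config_level hq ht hb ha prN' hp2 hr2) cE e'w.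
    apply/funext => j; rewrite /scale_at -(inj_eq val_inj) /=.
    have [->|ji] := eqVneq (j : nat) i.
      by rewrite ip /pos_point /= /update eqxx wn /= zn; ring.
    by rewrite /pos_point /neg_point /= /update (negPf ji).
have ir : (i - p < r)%N by have := ltn_ord i; lia.
have [n wn] := has_level_some hr ir.
exists b^-1, (w.2 : nat -> option nat), p, n; split.
  by split => //; right.
split.
- by move=> j pj _; rewrite cE ltnNge pj.
- move=> m wm; have : (m < r)%N by rewrite ltnNge -hr; apply/eqP.
  by rewrite -prN ltn_add2l.
- move=> n' z low up zn.
  pose w' : Nbar_seq_pair := (w.1, update w.2 (i - p)%N n').
  have hr' : has_level (w'.2 : nat -> option nat) r by exact: update_level.
  have i2' : weakly_increasing (w'.2 : nat -> option nat).
    exact: update_weakly_increasing.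
  have [|e' e'w] := @coords_surj R N q t a b hq ht hb ha w'.
    apply: (@level_Omega_le N w' p r i1 i2' _ _ prN').
      by have := hp p; rewrite leqnn => /eqP.
    by have := hr' r; rewrite leqnn => /eqP.
  exists e'; have hr2 := hr'; rewrite -e'w in hr2.
  have hp2 : has_level ((coords e').1 : nat -> option nat) p by rewrite e'w.
  rewrite (config_level hq ht hb ha prN' hp2 hr2) cE e'w.
  apply/funext => j; rewrite /scale_at -(inj_eq val_inj) /=.
  have [->|ji] := eqVneq (j : nat) i.
    by rewrite ltnNge pi /= /neg_point /= /update eqxx wn /= zn; ring.
  case: ltnP => // pj; rewrite /neg_point /= /update ifN//.
  by apply: contra ji => /eqP; lia.
Qed.

Lemma full_config_neq0 (e : E) i : full e -> config e i != 0.
Proof.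
move=> [p [r [prN hp hr]]].
have prN' : (p + r <= N)%N by rewrite prN.
rewrite (config_level hq ht hb ha prN' hp hr); case: ltnP => ip.
  by rewrite (pos_point_eq0 hq ht ha) hp -ltnNge.
by rewrite (neg_point_eq0 hq ht hb) hr -ltnNge; have := ltn_ord i; lia.
Qed.

(** Points of the same sign are separated by a factor t at least, and points
    of opposite sign have a negative ratio; this is what makes the weights
    nonnegative. *)
Lemma full_ratio (e : E) (i j : 'I_N) : full e -> i != j ->
  config e j / config e i <= t \/ t^-1 <= config e j / config e i.
Proof.
move=> fe ij; have ni := full_config_neq0 i fe; have nj := full_config_neq0 j fe.
move: fe ni nj => [p [r [prN hp hr]]].
have prN' : (p + r <= N)%N by rewrite prN.
rewrite (config_level hq ht hb ha prN' hp hr).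
have [[i1 i2] _] := coordsP e; set w := coords e in hp hr i1 i2 *.
have ij' : (i : nat) != j by [].
have [ip|pi] := ltnP i p; have [jp|pj] := ltnP j p => ni nj.
- have xi0 : 0 < pos_point q t a w i by rewrite lt0r ni pos_point_ge0.
  have xj0 : 0 < pos_point q t a w j by rewrite lt0r nj pos_point_ge0.
  have [lt_ij|lt_ji|e'] := ltngtP i j.
  + by left; rewrite ler_pdivrMr//; exact: pos_point_step.
  + right; rewrite ler_pdivlMr// mulrC ler_pdivrMr// mulrC; exact: pos_point_step.
  + by rewrite e' eqxx in ij'.
- left; apply: le_trans (ltW t0); apply: mulr_le0_ge0; first exact: neg_point_le0.
  by rewrite invr_ge0 pos_point_ge0.
- left; apply: le_trans (ltW t0); apply: mulr_ge0_le0; first exact: pos_point_ge0.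
  by rewrite invr_le0 neg_point_le0.
- have xi0 : neg_point q t b w (i - p) < 0 by rewrite lt_neqAle ni neg_point_le0.
  have xj0 : neg_point q t b w (j - p) < 0 by rewrite lt_neqAle nj neg_point_le0.
  have [lt_ij|lt_ji|e'] := ltngtP i j.
  + left; rewrite ler_ndivrMr//; apply: neg_point_step => //.
    exact: ltn_sub2r (leq_ltn_trans pi lt_ij) lt_ij.
  + right; rewrite ler_ndivlMr// mulrC ler_pdivlMr// mulrC; apply: neg_point_step => //.
    exact: ltn_sub2r (leq_ltn_trans pj lt_ji) lt_ji.
  + by rewrite e' eqxx in ij'.
Qed.

Lemma full_generic (e : E) : full e -> generic_point (config e).
Proof.
move=> fe; split=> [i|i j ij]; first exact: full_config_neq0.
apply/eqP; apply: contraT => nij.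
have := full_ratio fe nij; rewrite ij divff ?full_config_neq0//.
have : 1 < t^-1 by rewrite invf_gt1.
by move=> h []; have := t1; lra.
Qed.

Let factorE s (x y : R) : x != 0 -> x != y -> (s * x - y) / (x - y) = (s - y / x) / (1 - y / x).
Proof.
move=> x0 xy; have xy0 : x - y != 0 by rewrite subr_eq0.
by field; rewrite x0.
Qed.

Lemma factor_ge0 (e : E) (i j : 'I_N) s : full e -> i != j -> s = t \/ s = t^-1 ->
  0 <= (s * config e i - config e j) / (config e i - config e j).
Proof.
move=> fe ij st; have [x0 xinj] := full_generic fe.
rewrite factorE//; last by apply: contra ij => /eqP/xinj ->.
have it : 1 < t^-1 by rewrite invf_gt1.
have t1' := t1; have t0' := t0.
case: (full_ratio fe ij); set rho := _ / _ => h.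
  by apply: divr_ge0; [case: st => ->; lra|lra].
rewrite -mulrNN -invrN; apply: mulr_ge0; first by case: st => ->; lra.
by rewrite invr_ge0; lra.
Qed.

Lemma weight_ge0 (e : E) (i : 'I_N) s : full e -> s = t \/ s = t^-1 ->
  0 <= weight s i (config e).
Proof. by move=> fe st; apply: prodr_ge0 => j ji; apply: factor_ge0; rewrite 1?eq_sym. Qed.

Lemma weight_eq0 (i j : 'I_N) s (x : 'I_N -> R) : j != i -> s * x i = x j ->
  weight s i x = 0.
Proof. by move=> ji e; rewrite /weight (bigD1 j)//= e subrr !mul0r. Qed.

Lemma rate_scale_gt0 : 0 < rate_scale N t a b.
Proof.
by rewrite /rate_scale oppr_gt0 pmulr_rlt0 ?exprn_gt0// invr_lt0 pmulr_rlt0.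
Qed.

Lemma rate_plus_ge0 x : 0 <= rate_plus N q t a b d x.
Proof.
have h := rate_scale_gt0; rewrite /rate_plus; apply: mulr_ge0.
  by rewrite mulr_ge0// ltW.
by apply: addr_ge0; exact: sqr_ge0.
Qed.

Let coef_le1 n m : q ^+ n.+1 * t ^+ m <= q.
Proof.
have h1 : q ^+ n.+1 <= q by rewrite exprS ger_pMr// exprn_ile1// ltW.
have h2 : t ^+ m <= 1 by rewrite exprn_ile1// ltW.
have h3 : 0 <= t ^+ m by rewrite exprn_ge0// ltW.
have h4 : 0 <= q ^+ n.+1 by rewrite exprn_ge0// ltW.
nra.
Qed.

Lemma sigma_minus_ge0 base n m : base = a^-1 \/ base = b^-1 ->
  0 <= sigma_minus N q t a b (base * q ^+ n.+1 * t ^+ m).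
Proof.
move=> hbase; have k0 := rate_scale_gt0.
have -> : forall x, sigma_minus N q t a b x =
    rate_scale N t a b * q ^+ 2 * ((a * q^-1 - x^-1) * (b * q^-1 - x^-1)).
  by move=> x; rewrite /sigma_minus /rate_scale; ring.
apply: mulr_ge0; first by rewrite mulr_ge0 ?sqr_ge0// ltW.
set y := q ^+ n.+1 * t ^+ m.
have y0 : 0 < y by rewrite mulr_gt0 ?exprn_gt0.
have yq : q^-1 <= y^-1 by rewrite lef_pV2 ?posrE//; exact: coef_le1.
have iq : 0 < q^-1 by rewrite invr_gt0.
have iy : 0 < y^-1 by rewrite invr_gt0.
rewrite -mulrA -/y invfM.
case: hbase => ->; rewrite invrK.
  rewrite -mulrNN; apply: mulr_ge0; first by rewrite opprB -mulrBr mulr_ge0 ?subr_ge0// ltW.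
  by have := hb; have := ha; nra.
apply: mulr_ge0; first by have := hb; have := ha; nra.
by rewrite -mulrBr mulr_le0// ?subr_le0// ltW.
Qed.

(** The outermost possible point of each sign cannot move outwards. *)
Lemma sigma_minus_boundary base : base = a^-1 \/ base = b^-1 ->
  sigma_minus N q t a b (base * q ^+ 1 * t ^+ 0) = 0.
Proof.
move=> hbase; rewrite /sigma_minus expr1 expr0 mulr1 (invfM base).
by case: hbase => ->; rewrite invrK subrr ?mul0r ?mulr0.
Qed.

(** A point that cannot move inwards is followed by its multiple by t. *)
Lemma shift_up (e : E) (i : 'I_N) : full e ->
  weight t i (config e) = 0 \/
  exists e' : E, config e' = scale_at i q (config e).
Proof.
move=> fe; have [base [k [off [n [[hbase offi kn inc] [val bnd move]]]]]] := full_side i fe.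
set m := (i - off)%N in kn move.
have [km|km] := eqVneq (k m.+1) (Some n).
  have mN : (off + m.+1 < N)%N by apply: bnd; rewrite km.
  left; apply: (@weight_eq0 i (Ordinal mN)).
    by rewrite -(inj_eq val_inj) /=; apply/eqP; rewrite /m; lia.
  have e1 : (off + m.+1 - off = m.+1)%N by rewrite addKn.
  rewrite !val//= ?e1 ?km -/m ?kn//; last by rewrite leq_addr.
  by rewrite /= (exprS t m); ring.
right; apply: (move n.+1).
- by move=> m0; apply: Nbar_le_trans (_ : Nbar_le (Some n) _); rewrite ?leqnSn//= -kn;
    apply: inc; rewrite leq_pred.
- have := inc _ _ (leqnSn m); rewrite kn; case: (k m.+1) km => [l|]//= km.
  by rewrite leq_eqVlt => /predU1P[e'|//]; rewrite e' eqxx in km.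
- by rewrite exprS.
Qed.

(** A point that cannot move outwards is preceded by its multiple by t^-1, or
    is at the boundary of the space. *)
Lemma shift_down (e : E) (i : 'I_N) : full e ->
  weight t^-1 i (config e) * sigma_minus N q t a b (config e i) = 0 \/
  exists e' : E, config e' = scale_at i q^-1 (config e).
Proof.
move=> fe; have [base [k [off [n [[hbase offi kn inc] [val bnd move]]]]]] := full_side i fe.
set m := (i - off)%N in kn move.
have [m0|m0] := posnP m.
  case: n kn move => [|n] kn move.
    left; rewrite val// -/m ?kn// m0 /= sigma_minus_boundary// mulr0//.
  right; apply: (move n).
  - by rewrite m0.
  - have := inc _ _ (leqnSn m); rewrite kn; case: (k m.+1) => [l|]//=.
    exact: ltnW.
  - by rewrite (exprS q n.+1) mulKf ?gt_eqF.
have [km|km] := eqVneq (k m.-1) (Some n).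
  have mN : (off + m.-1 < N)%N by apply: bnd; rewrite km.
  left; rewrite (@weight_eq0 i (Ordinal mN)) ?mul0r//.
    by rewrite -(inj_eq val_inj) /=; apply/eqP; rewrite /m; lia.
  have e1 : (off + m.-1 - off = m.-1)%N by lia.
  rewrite !val//= ?e1 ?km ?kn//; last by lia.
  rewrite -/m ?kn /=; have -> : t ^+ m = t * t ^+ m.-1 by rewrite -exprS prednK.
  by rewrite mulrCA mulKf ?gt_eqF.
have lt : match k m.-1 with Some l => (l < n)%N | None => false end.
  have := inc _ _ (leq_pred m); rewrite kn; case: (k m.-1) km => [l|]//= km.
  by rewrite leq_eqVlt => /predU1P[e'|//]; rewrite e' eqxx in km.
case: n kn move km lt => [|n] kn move km lt; first by case: (k m.-1) lt.
right; apply: (move n).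
- by move=> _; case: (k m.-1) lt.
- have := inc _ _ (leqnSn m); rewrite kn; case: (k m.+1) => [l|]//=.
  exact: ltnW.
- by rewrite (exprS q n.+1) mulKf ?gt_eqF.
Qed.

(** Positive maximum principle at full configurations: the operator is
    there a combination of differences G(e') - G(e) with nonnegative
    rates, since the rate of a jump out of the space vanishes. *)
Lemma full_maximum (G : ('I_N -> R) -> R) (e : E) : full e ->
  (forall e' : E, G (config e') <= G (config e)) ->
  DN_real q t a b d G (config e) <= 0.
Proof.
move=> fe Gmax; rewrite /DN_real; apply: sumr_le0 => i _.
rewrite -[leRHS](addr0 0); apply: lerD.
  case: (shift_up i fe) => [->|[e' <-]]; first by rewrite !mul0r.
  apply: mulr_ge0_le0; last by rewrite subr_le0.
  by apply: mulr_ge0; [apply: weight_ge0 => //; left|exact: rate_plus_ge0].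
case: (shift_down i fe) => [->|[e' <-]]; first by rewrite mul0r.
apply: mulr_ge0_le0; last by rewrite subr_le0.
apply: mulr_ge0; first by apply: weight_ge0 => //; right.
have [base [k [off [n [[hbase offi kn inc] [val bnd _]]]]]] := full_side i fe.
by rewrite val// ?kn//; exact: sigma_minus_ge0.
Qed.

End Jumps.

(** * Configurations with zeros *)

Section OneVariable.
Context {R : realType} {N : nat}.

Definition set_entry (x : 'I_N -> R) (l : 'I_N) (y : R) : 'I_N -> R :=
  fun i => if i == l then y else x i.

Lemma set_entry_id (x : 'I_N -> R) l : set_entry x l (x l) = x.
Proof. by apply/funext => i; rewrite /set_entry; case: eqP => [->|]. Qed.

Lemma root_poly_set_entry (x : 'I_N -> R) l y :
  root_poly (set_entry x l y) * ('X - (x l)%:P) = root_poly x * ('X - y%:P).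
Proof.
rewrite /root_poly (bigD1 l)//= [in RHS](bigD1 l)//= /set_entry eqxx.
rewrite (eq_bigr (fun j => 'X - (x j)%:P)); first by ring.
by move=> j /negPf ->.
Qed.

Lemma set_entry_poly (f : mpoly N R) (x : 'I_N -> R) l :
  exists P : {poly R}, forall y, P.[y] = meval (set_entry x l y) f.
Proof.
exists (\sum_(m <- msupp f) mcoeff m f *: \prod_(i < N)
  ((if i == l then 'X else (x i)%:P) ^+ m i)).
move=> y; rewrite horner_sum mevalE; apply: eq_bigr => m _.
rewrite hornerZ horner_prod; congr (_ * _); apply: eq_bigr => i _.
rewrite horner_exp /set_entry; case: (i == l); first by rewrite hornerX.
by rewrite hornerC.
Qed.

Definition positive_part (x : 'I_N -> R) : R := \sum_(i < N) Num.max (x i) 0.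

End OneVariable.

Section AddParticle.
Context {R : realType}.
Variables (N : nat) (q t a b : R).
Hypotheses (hq : 0 < q < 1) (ht : 0 < t < 1) (hb : b < 0) (ha : 0 < a).

Let t0 : 0 < t. Proof. by case/andP: ht. Qed.
Let t1 : t < 1. Proof. by case/andP: ht. Qed.
Let q0 : 0 < q. Proof. by case/andP: hq. Qed.
Let q1 : q < 1. Proof. by case/andP: hq. Qed.

Local Notation E := (OmegaN N q t a b).

Definition positive_mass (e : E) : R := \sum_(j < N) pos_point q t a (coords e) j.

Lemma positive_part_config (e : E) : positive_part (config e) = positive_mass e.
Proof.
have [p [r [prN hp hr ->]]] := config_levels hq ht hb ha e.
apply: eq_bigr => i _; case: ltnP => ip.
  by rewrite max_l// pos_point_ge0.
rewrite max_r ?neg_point_le0//; apply/esym/eqP.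
by rewrite (pos_point_eq0 hq ht ha) hp.
Qed.

Lemma positive_mass_continuous : continuous positive_mass.
Proof.
by apply: (@sum_continuous R E N (fun j (e : E) => pos_point q t a (coords e) j)) => j e;
  exact: pos_point_continuous.
Qed.

Lemma prod_set_point (f f' : nat -> R) m : (m < N)%N -> f m = 0 ->
  (forall j, j != m -> f' j = f j) ->
  (\prod_(j < N) ('X - (f' j)%:P)) * 'X =
  (\prod_(j < N) ('X - (f j)%:P)) * ('X - (f' m)%:P) :> {poly R}.
Proof.
move=> mN fm ff'; rewrite (bigD1 (Ordinal mN))//= [in RHS](bigD1 (Ordinal mN))//= fm subr0.
rewrite (eq_bigr (fun j : 'I_N => 'X - (f j)%:P)); first by ring.
by move=> j jm; rewrite ff'//; apply: contra jm => /eqP e; apply/eqP/val_inj.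
Qed.

(** The first infinite coordinate of either sequence can be replaced by any
    large K. The new configuration is known up to the order of its points,
    which is enough to evaluate symmetric polynomials. *)
Lemma add_particle (e : E) p r : (p + r < N)%N ->
  has_level ((coords e).1 : nat -> option nat) p ->
  has_level ((coords e).2 : nat -> option nat) r ->
  exists (l : 'I_N) (K0 : nat), config e l = 0 /\ forall K, (K0 <= K)%N ->
  (exists e' : E,
    [/\ has_level ((coords e').1 : nat -> option nat) p.+1,
        has_level ((coords e').2 : nat -> option nat) r,
        root_poly (config e') =
          root_poly (set_entry (config e) l (a^-1 * q ^+ K.+1 * t ^+ p)) &
        positive_mass e' = positive_mass e + a^-1 * q ^+ K.+1 * t ^+ p]) /\
  (exists e' : E,
    [/\ has_level ((coords e').1 : nat -> option nat) p,
        has_level ((coords e').2 : nat -> option nat) r.+1,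
        root_poly (config e') =
          root_poly (set_entry (config e) l (b^-1 * q ^+ K.+1 * t ^+ r)) &
        positive_mass e' = positive_mass e]).
Proof.
move=> prN hp hr; have [[i1 i2] _] := coordsP e; set w := coords e in hp hr i1 i2 *.
have pN : (p < N)%N by apply: leq_ltn_trans prN; rewrite leq_addr.
have rN : (r < N)%N by apply: leq_ltn_trans prN; rewrite leq_addl.
have bound (k : nat -> option nat) m : has_level k m ->
    exists K0, forall K, (K0 <= K)%N -> (0 < m)%N -> Nbar_le (k m.-1) (Some K).
  move=> km; case: m km => [|m] km; first by exists 0%N.
  have [n kn] := has_level_some km (ltnSn m).
  by exists n => K nK _; rewrite /= kn.
have [K1 hK1] := bound _ _ hp; have [K2 hK2] := bound _ _ hr.
have cl : config e (Ordinal prN) = 0.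
  rewrite (config_level hq ht hb ha (ltnW prN) hp hr) /= ltnNge leq_addr /= addKn.
  by apply/eqP; rewrite (neg_point_eq0 hq ht hb) hr.
exists (Ordinal prN), (maxn K1 K2); split=> // K; rewrite geq_max => /andP[KK1 KK2].
have X0 : ('X : {poly R}) != 0 by rewrite polyX_eq0.
have XN0 : ('X^N : {poly R}) != 0 by rewrite monic_neq0// monicXn.
have none (k : nat -> option nat) m : has_level k m -> Nbar_le (Some K) (k m.+1).
  by move=> km; have := km m.+1; rewrite leqnSn => /eqP ->.
split.
  pose w' : Nbar_seq_pair := (update w.1 p K, w.2).
  have hp' : has_level (w'.1 : nat -> option nat) p.+1 by exact: update_level_succ.
  have i1' : weakly_increasing (w'.1 : nat -> option nat).
    by apply: update_weakly_increasing => //; [exact: hK1|exact: none].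
  have [|e' e'w] := @coords_surj R N q t a b hq ht hb ha w'.
    apply: (@level_Omega_le N w' p.+1 r i1' i2 _ _ prN).
      by have := hp' p.+1; rewrite leqnn => /eqP.
    by have := hr r; rewrite leqnn => /eqP.
  have yE : pos_point q t a w' p = a^-1 * q ^+ K.+1 * t ^+ p.
    by rewrite /pos_point /= /update eqxx.
  have offE j : j != p -> pos_point q t a w' j = pos_point q t a w j.
    by move=> jp; rewrite /pos_point /= /update (negPf jp).
  have wp : pos_point q t a w p = 0.
    by apply/eqP; rewrite (pos_point_eq0 hq ht ha) hp.
  exists e'; split; rewrite ?e'w//.
    apply: (mulIf XN0); apply: (mulIf X0); rewrite (root_poly_config hq ht hb ha) e'w.
    rewrite mulrAC (prod_set_point pN wp offE) yE.
    have := root_poly_set_entry (config e) (Ordinal prN) (a^-1 * q ^+ K.+1 * t ^+ p).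
    rewrite cl subr0 => h; rewrite mulrAC [RHS]mulrAC h.
    by rewrite [RHS]mulrAC (root_poly_config hq ht hb ha).
  rewrite /positive_mass e'w (bigD1 (Ordinal pN))//= [in RHS](bigD1 (Ordinal pN))//=.
  rewrite yE wp add0r addrC; congr (_ + _); apply: eq_bigr => j jp.
  by rewrite offE//; apply: contra jp => /eqP h; apply/eqP/val_inj.
pose w' : Nbar_seq_pair := (w.1, update w.2 r K).
have hr' : has_level (w'.2 : nat -> option nat) r.+1 by exact: update_level_succ.
have i2' : weakly_increasing (w'.2 : nat -> option nat).
  by apply: update_weakly_increasing => //; [exact: hK2|exact: none].
have [|e' e'w] := @coords_surj R N q t a b hq ht hb ha w'.
  apply: (@level_Omega_le N w' p r.+1 i1 i2' _ _ _); last by rewrite addnS.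
    by have := hp p; rewrite leqnn => /eqP.
  by have := hr' r.+1; rewrite leqnn => /eqP.
have yE : neg_point q t b w' r = b^-1 * q ^+ K.+1 * t ^+ r.
  by rewrite /neg_point /= /update eqxx.
have offE j : j != r -> neg_point q t b w' j = neg_point q t b w j.
  by move=> jp; rewrite /neg_point /= /update (negPf jp).
have wr : neg_point q t b w r = 0.
  by apply/eqP; rewrite (neg_point_eq0 hq ht hb) hr.
exists e'; split; rewrite ?e'w//.
  apply: (mulIf XN0); apply: (mulIf X0); rewrite (root_poly_config hq ht hb ha) e'w.
  rewrite -[LHS]mulrA (prod_set_point rN wr offE) yE.
  have := root_poly_set_entry (config e) (Ordinal prN) (b^-1 * q ^+ K.+1 * t ^+ r).
  rewrite cl subr0 => h; rewrite [RHS]mulrAC h.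
  by rewrite [RHS]mulrAC (root_poly_config hq ht hb ha) mulrA.
by rewrite /positive_mass e'w.
Qed.

Lemma points_small (c e : R) : 0 < e -> \forall K \near \oo, `|c * q ^+ K.+1| < e.
Proof.
move=> e0; have h0 : (fun k => c * q ^+ k.+1 : R) @ \oo --> (0 : R).
  rewrite -(mulr0 c); apply: cvgM; first exact: cvg_cst.
  by rewrite cvg_shiftS; apply: cvg_expr; rewrite ger0_norm// ltW.
move/cvgrPdist_lt: h0 => /(_ _ e0); apply: filterS => k.
by rewrite sub0r normrN.
Qed.

(** Adding a multiple of the positive part, which has a kink at the origin,
    moves the maxima away from the configurations with a zero: there the
    derivative in the direction of a new point y would have to be at most
    -eps from the right and at least 0 from the left. *)
Lemma maximum_full (f : mpoly N R) (eps : R) (e : E) : f \is symmetric -> 0 < eps ->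
  (forall e' : E, eval_sym f e' + eps * positive_mass e' <=
                  eval_sym f e + eps * positive_mass e) ->
  full e.
Proof.
move=> fs eps0 emax.
have [p [r [prN hp hr]]] := Omega_le_level (coordsP e).
exists p, r; split => //; apply/eqP; rewrite eqn_leq prN /= leqNgt; apply/negP => prN'.
have [l [K0 [el addE]]] := add_particle prN' hp hr.
have [P PE] := set_entry_poly f (config e) l.
have P0 : P.[0] = eval_sym f e by rewrite PE -el set_entry_id.
have [H HE] : exists H : {poly R}, forall y, P.[y] = P.[0] + y * H.[y].
  have /factor_theorem[H HE] : root (P - P.[0]%:P) 0.
    by rewrite /root hornerD hornerN hornerC subrr.
  exists H => y; have := congr1 (horner^~ y) HE.
  rewrite hornerM hornerD hornerN hornerC hornerXsubC subr0 => h.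
  by rewrite [y * _]mulrC -h addrC subrK.
have eps2 : 0 < eps / 2 by lra.
have Hc := @continuous_horner R H 0.
have /cvgrPdist_lt/(_ _ eps2) [dl /= dl0 dlP] := Hc.
have dlH y : `|y| < dl -> `|H.[0] - H.[y]| < eps / 2.
  by move=> ydl; apply: dlP; rewrite /= sub0r normrN.
have F1 := points_small (a^-1 * t ^+ p) dl0.
have F2 := points_small (b^-1 * t ^+ r) dl0.
have F3 : \forall K \near \oo, (K0 <= K)%N by exists K0.
have [K _ /(_ K (leqnn K)) [h1 h2 h3]] : \forall K \near \oo,
    [/\ `|a^-1 * t ^+ p * q ^+ K.+1| < dl, `|b^-1 * t ^+ r * q ^+ K.+1| < dl &
        (K0 <= K)%N].
  by near=> K; split; near: K.
have [[e1 [_ _ r1 m1]] [e2 [_ _ r2 m2]]] := addE K h3.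
have ev1 : eval_sym f e1 = P.[a^-1 * q ^+ K.+1 * t ^+ p].
  by rewrite PE; exact: meval_root_poly.
have ev2 : eval_sym f e2 = P.[b^-1 * q ^+ K.+1 * t ^+ r].
  by rewrite PE; exact: meval_root_poly.
have := emax e1; have := emax e2; rewrite ev1 ev2 m1 m2 -P0.
have := HE (a^-1 * q ^+ K.+1 * t ^+ p); have := HE (b^-1 * q ^+ K.+1 * t ^+ r).
rewrite mulrAC in h1; rewrite mulrAC in h2.
have := dlH _ h1; have := dlH _ h2.
have y1 : 0 < a^-1 * q ^+ K.+1 * t ^+ p by rewrite !mulr_gt0 ?invr_gt0 ?exprn_gt0.
have y2 : b^-1 * q ^+ K.+1 * t ^+ r < 0.
  by rewrite -mulrA nmulr_rlt0 ?invr_lt0// mulr_gt0 ?exprn_gt0.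
set z1 := _ * t ^+ p in y1 *; set z2 := _ * t ^+ r in y2 *.
rewrite !ltr_norml => /andP[u1 u2] /andP[u3 u4] E2 E1 v1 v2.
have w1 : 0 <= H.[z2] by rewrite -(nmulr_rle0 _ y2); lra.
have w2 : H.[z1] + eps <= 0 by rewrite -(pmulr_rle0 _ y1); lra.
lra.
Unshelve. all: by end_near. Qed.

(** The polynomial f, as a function of one point in place of a zero, has
    infinitely many roots by induction on the number of zeros. *)
Lemma eval_sym_full_eq0 (f : mpoly N R) : f \is symmetric ->
  (forall e : E, full e -> eval_sym f e = 0) -> forall e : E, eval_sym f e = 0.
Proof.
move=> fs ffull e; have [p [r [prN hp hr]]] := Omega_le_level (coordsP e).
have [m mE] : exists m, (m + (p + r) = N)%N by exists (N - (p + r))%N; rewrite subnK.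
elim: m e p r mE {prN} hp hr => [|m IH] e p r mE hp hr.
  by apply: ffull; exists p, r.
have prN : (p + r < N)%N by rewrite -mE addSn ltnS leq_addl.
have [l [K0 [el addE]]] := add_particle prN hp hr.
have [P PE] := set_entry_poly f (config e) l.
have -> : eval_sym f e = P.[0] by rewrite PE -el set_entry_id.
suff -> : P = 0 by rewrite horner0.
pose y K := a^-1 * q ^+ (K0 + K).+1 * t ^+ p.
apply: (@roots_geq_poly_eq0 _ _ [seq y K | K <- iota 0 (size P)]).
- apply/allP => _ /mapP[K _ ->]; rewrite /root PE.
  have [[e' [hp' hr' rE _]] _] := addE (K0 + K)%N (leq_addr _ _).
  rewrite -(meval_root_poly rE fs) -/(eval_sym f e') (IH e' p.+1 r)//.
  by rewrite addSn addnS.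
- rewrite map_inj_uniq ?iota_uniq// => i j.
  move=> /(mulIf (lt0r_neq0 (exprn_gt0 p t0))).
  have /mulfI h : a^-1 != 0 by rewrite invr_eq0 gt_eqF.
  have q1' : q != 1 by rewrite lt_eqF.
  by move=> /h /(ieexprIn q0 q1') [] /addnI.
- by rewrite size_map size_iota.
Qed.

End AddParticle.

(** * The drift of the positive part *)

Lemma add_scale_continuous (R : realType) (T : topologicalType) (c : R) (f g : T -> R) :
  continuous f -> continuous g -> continuous (fun x => f x + c * g x).
Proof.
move=> fc gc x; apply: cvgD; first exact: fc.
by apply: cvgM; [exact: cvg_cst|exact: gc].
Qed.

Section Drift.
Context {R : realType}.

(** Let P be the root polynomial. As P(y_i) = 0, the weight over y_i is the
    value at y_i of (P(s z) - P(z)) / ((s - 1) z^2), divided by the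
    [vandermonde_factor]. Lagrange interpolation kills the polynomial part of
    that quotient, whose degree is too small, and the polar part P_1 / z is
    free of s. *)
Lemma weight_over_point n (y : 'I_n -> R) s : s != 1 -> generic_point y ->
  \sum_(i < n) weight s i y / y i =
  (root_poly y)`_1 * \sum_(i < n) (y i * vandermonde_factor i y)^-1.
Proof.
move=> s1 [y0 yi]; case: n y y0 yi => [|n] y y0 yi; first by rewrite !big_ord0 mulr0.
pose P := root_poly y.
pose Q := \poly_(k < n) ((s ^+ k.+2 - 1) * P`_k.+2).
have PsE z : P.[s * z] - P.[z] = (s - 1) * P`_1 * z + z ^+ 2 * Q.[z].
  rewrite !(@horner_coef_wide _ n.+2 P) ?size_root_poly// -sumrB.
  rewrite !big_ord_recl /= !expr0 !mulr1 subrr add0r /bump /= !expr1; congr (_ + _).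
    by ring.
  rewrite horner_poly mulr_sumr; apply: eq_bigr => k _ /=.
  by rewrite !add1n exprMn (exprSr z k.+1) (exprSr z k); ring.
have s10 : s - 1 != 0 by rewrite subr_eq0.
have term i : weight s i y / y i =
    P`_1 * (y i * vandermonde_factor i y)^-1 + (s - 1)^-1 * (Q.[y i] / vandermonde_factor i y).
  have w0 := vandermonde_factor_neq0 i yi.
  have Pyi : P.[y i] = 0 by rewrite /P (root_poly_cofactor i) hornerM hornerXsubC subrr mul0r.
  have := PsE (y i); rewrite Pyi subr0 {1}/P (root_poly_cofactor i) hornerM hornerXsubC => h.
  have c : (cofactor_poly i y).[s * y i] = (P`_1 + (s - 1)^-1 * y i * Q.[y i]).
    apply: (mulfI (_ : (s - 1) * y i != 0)); first by rewrite mulf_neq0.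
    rewrite mulrBl mul1r h mulrDr; congr (_ + _); first by ring.
    by field.
  by rewrite weightE c; field; rewrite s10 w0 y0.
rewrite (eq_bigr _ (fun i _ => term i)) big_split /= -mulr_sumr -mulr_sumr.
rewrite lagrange_sum ?(leq_trans (size_poly _ _))//=.
rewrite [Q`__]nth_default ?mulr0 ?addr0//.
exact: size_poly.
Qed.

Lemma weight_split p r s (i : 'I_p) (x : 'I_(p + r) -> R) :
  weight s (lshift r i) x = weight s i (fun j => x (lshift r j)) *
    \prod_(j < r) ((s * x (lshift r i) - x (rshift p j)) /
                   (x (lshift r i) - x (rshift p j))).
Proof.
rewrite /weight big_split_ord /=; congr (_ * _).
by apply: eq_bigl => j /=; rewrite eq_sym eq_lrshift.
Qed.

(** A negative point x' lowers the ratio (t x - x') / (x - x') below 1 and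
    raises (t^-1 x - x') / (x - x') above 1, so the weights restricted to
    the positive points bound the difference of the full ones. *)
Lemma positive_weights_sum (t : R) p r (x : 'I_(p + r) -> R) : 0 < t < 1 ->
  generic_point x -> (forall i, 0 < x (lshift r i)) -> (forall j, x (rshift p j) < 0) ->
  (forall s i j, s = t \/ s = t^-1 -> i != j -> 0 <= (s * x i - x j) / (x i - x j)) ->
  0 <= \sum_(i < p) (weight t^-1 (lshift r i) x - weight t (lshift r i) x) /
    x (lshift r i).
Proof.
move=> /andP[t0 t1] [x0 xi] xpos xneg xfac.
have it1 : 1 < t^-1 by rewrite invf_gt1.
pose y (i : 'I_p) := x (lshift r i).
have yg : generic_point y by split=> [i|i j /xi/lshift_inj]; first exact: x0.
have zero : \sum_(i < p) (weight t^-1 i y - weight t i y) / y i = 0.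
  under eq_bigr do rewrite mulrBl.
  have n1 : t != 1 by rewrite lt_eqF.
  have n2 : t^-1 != 1 by rewrite gt_eqF.
  by rewrite sumrB !weight_over_point ?subrr.
rewrite -[leLHS]zero; apply: ler_sum => i _; rewrite !weight_split -/y.
rewrite ler_pM2r ?invr_gt0 ?xpos//.
have wy s : s = t \/ s = t^-1 -> 0 <= weight s i y.
  move=> hs; apply: prodr_ge0 => j ji; apply: xfac => //.
  by rewrite (inj_eq (@lshift_inj _ _)) eq_sym.
have up : 1 <= \prod_(j < r) ((t^-1 * x (lshift r i) - x (rshift p j)) /
                   (x (lshift r i) - x (rshift p j))).
  elim/big_rec: _ => // j z _ z1; rewrite -[leLHS]mulr1; apply: ler_pM => //.
  have xi0 := xpos i; have xj0 := xneg j.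
  rewrite ler_pdivlMr; last by lra.
  by rewrite mul1r; nra.
have down : \prod_(j < r) ((t * x (lshift r i) - x (rshift p j)) /
                   (x (lshift r i) - x (rshift p j))) <= 1.
  apply: prodr_ile1 => j _; have xi0 := xpos i; have xj0 := xneg j; apply/andP; split.
    by apply: xfac; [left|rewrite eq_lrshift].
  rewrite ler_pdivrMr; last by lra.
  by rewrite mul1r; nra.
have h1 := wy _ (or_introl erefl); have h2 := wy _ (or_intror erefl).
by apply: lerB; [rewrite ler_peMr|rewrite ler_piMr].
Qed.

Lemma positive_weights_sum_cond (t : R) N (x : 'I_N -> R) p : 0 < t < 1 ->
  (p <= N)%N -> generic_point x -> (forall i : 'I_N, (i < p)%N -> 0 < x i) ->
  (forall i : 'I_N, (p <= i)%N -> x i < 0) ->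
  (forall s i j, s = t \/ s = t^-1 -> i != j -> 0 <= (s * x i - x j) / (x i - x j)) ->
  0 <= \sum_(i < N | 0 < x i) (weight t^-1 i x - weight t i x) / x i.
Proof.
move=> ht pN; rewrite -(subnKC pN) in x *; move: (N - p)%N x => r x xg xpos xneg xfac.
rewrite big_mkcond big_split_ord /= [X in _ + X]big1 ?addr0; last first.
  by move=> j _; rewrite ltNge ltW//= xneg//= leq_addr.
have hp i : 0 < x (lshift r i) by apply: xpos => /=.
rewrite (eq_bigr (fun i => (weight t^-1 (lshift r i) x - weight t (lshift r i) x) /
    x (lshift r i))); last by move=> i _; rewrite hp.
apply: positive_weights_sum => // j; apply: xneg; exact: leq_addr.
Qed.

End Drift.

Section MaximumPrinciple.
Context {R : realType}.
Variables (N : nat) (q t a b : R) (d : R[i]).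
Hypotheses (hq : 0 < q < 1) (ht : 0 < t < 1) (hb : b < 0) (ha : 0 < a).

Let t0 : 0 < t. Proof. by case/andP: ht. Qed.
Let t1 : t < 1. Proof. by case/andP: ht. Qed.
Let q0 : 0 < q. Proof. by case/andP: hq. Qed.
Let q1 : q < 1. Proof. by case/andP: hq. Qed.

Local Notation E := (OmegaN N q t a b).

Lemma full_sign (e : E) : full e -> exists2 p, (p <= N)%N &
  (forall i : 'I_N, (i < p)%N -> 0 < config e i) /\
  (forall i : 'I_N, (p <= i)%N -> config e i < 0).
Proof.
move=> fe; have n0 := fun i => full_config_neq0 hq ht hb ha i fe.
move: fe n0 => [p [r [prN hp hr]]].
have prN' : (p + r <= N)%N by rewrite prN.
rewrite (config_level hq ht hb ha prN' hp hr) => n0.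
exists p; first by rewrite -prN leq_addr.
split=> i ip; have := n0 i; first by rewrite ip lt0r => ->; exact: pos_point_ge0.
by rewrite ltnNge ip /= lt_neqAle => ->; exact: neg_point_le0.
Qed.

Lemma weight_sum_bounded s : exists B, forall e : E, full e ->
  \sum_(i < N) weight s i (config e) <= B.
Proof.
have [U Us UE] := @symcoef_cofactor_tail R N s.
have [g gs gE] := symcoef_sum_sym (symcoefD (symcoef_cofactor 0)
  (symcoefM (symcoefZ s symcoef_var) Us)).
have [B BP] := compact_bounded (@OmegaN_compact R N q t a b hq ht hb ha)
  (eval_sym_continuous hq ht hb ha gs).
exists B => e fe; have [_ xi] := full_generic hq ht hb ha fe.
apply: le_trans (le_trans (ler_norm _) (BP e)); rewrite /eval_sym -gE//.
by apply: ler_sum => i _; rewrite weightE UE.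
Qed.

Lemma positive_mass_bounded : exists2 M, 0 <= M & forall e : E,
  0 <= positive_mass e <= M.
Proof.
have [M MP] := compact_bounded (@OmegaN_compact R N q t a b hq ht hb ha)
  (@positive_mass_continuous R N q t a b hq).
exists `|M| => // e; apply/andP; split.
  by apply: sumr_ge0 => j _; exact: pos_point_ge0.
exact: le_trans (ler_norm _) (le_trans (MP e) (ler_norm _)).
Qed.

(** The weights have bounded sums, being nonnegative with a symmetric
    polynomial as total. A positive point x_i contributes terms bounded by
    them and a multiple of the difference of its weights divided by x_i; the
    latter is unbounded, but its sum has a sign by [positive_weights_sum]. *)
Lemma positive_part_drift : exists2 C, 0 <= C & forall e : E, full e ->
  - C <= DN_real q t a b d (@positive_part R N) (config e).
Proof.
have [B1 B1P] := weight_sum_bounded t; have [B2 B2P] := weight_sum_bounded t^-1.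
have [M M0 MP] := positive_mass_bounded.
pose kap := rate_scale N t a b * q * (1 - q).
have kap0 : 0 < kap.
  by rewrite /kap !mulr_gt0 ?(rate_scale_gt0 N ht hb ha)// subr_gt0.
pose cc := complex.Re d ^+ 2 + complex.Im d ^+ 2.
pose cs := 2 * complex.Re d.
pose ga := a * b / q ^+ 2; pose de := (a + b) / q.
pose B := cc * M + `|cs| + (`|ga| * M + `|de|).
have cc0 : 0 <= cc by rewrite addr_ge0 ?sqr_ge0.
have B0 : 0 <= B by rewrite /B !addr_ge0 ?mulr_ge0.
exists (kap * (B * (`|B1| + `|B2|))).
  by apply: mulr_ge0; [exact: ltW|apply: mulr_ge0 => //; exact: addr_ge0].
move=> e fe; set x := config e.
have xg : generic_point x by exact: full_generic.
have A1 i := weight_ge0 hq ht hb ha i fe (or_introl erefl).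
have A2 i := weight_ge0 hq ht hb ha i fe (or_intror erefl).
have xM i : Num.max (x i) 0 <= M.
  have [_ hM] := andP (MP e); apply: le_trans hM.
  rewrite -(positive_part_config hq ht hb ha) /positive_part (bigD1 i)//=.
  by rewrite lerDl; apply: sumr_ge0 => j _; rewrite le_max lexx orbT.
have jump i s : 0 < s -> positive_part (scale_at i s x) - positive_part x =
    (s - 1) * Num.max (x i) 0.
  move=> s0; rewrite /positive_part (bigD1 i)//= [X in _ - X](bigD1 i)//= /scale_at eqxx.
  rewrite (eq_bigr (fun j => Num.max (x j) 0)); last by move=> j /negPf ->.
  rewrite -{1}(mulr0 s) -maxr_pMr ?ltW//; ring.
have q0' := q0; have iq0 : 0 < q^-1 by rewrite invr_gt0.
have term i : kap * (- (B * (weight t i x + weight t^-1 i x))) +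
    kap * (if 0 < x i then (weight t^-1 i x - weight t i x) / x i else 0) <=
  weight t i x * rate_plus N q t a b d (x i) *
    (positive_part (scale_at i q x) - positive_part x) +
  weight t^-1 i x * sigma_minus N q t a b (x i) *
    (positive_part (scale_at i q^-1 x) - positive_part x).
  rewrite !jump//; have := A1 i; have := A2 i; have := xM i; rewrite -/x.
  set A := weight t i x; set A' := weight t^-1 i x.
  have [xi0|xi0] := ltP 0 (x i); last first.
    move=> _ hA' hA; rewrite !mulr0 !addr0 mulrN oppr_le0.
    by apply: mulr_ge0; [exact: ltW|apply: mulr_ge0 => //; exact: addr_ge0].
  move=> xiM hA' hA.
  have -> : A * rate_plus N q t a b d (x i) * ((q - 1) * x i) +
      A' * sigma_minus N q t a b (x i) * ((q^-1 - 1) * x i) =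
      kap * (- (A * (cc * x i - cs)) + A' * (ga * x i - de) + (A' - A) / x i).
    rewrite /rate_plus /sigma_minus /kap /cc /cs /ga /de /rate_scale.
    have b0 : b != 0 by rewrite lt_eqF.
    have a0 : a != 0 by rewrite gt_eqF.
    by field; rewrite b0 a0 !gt_eqF.
  rewrite -mulrDr ler_pM2l// lerD2r.
  have h1 : cc * x i - cs <= B.
    have := ler_norm (- cs); rewrite normrN => ?.
    have := ler_wpM2l cc0 xiM; have := mulr_ge0 (normr_ge0 ga) M0.
    have := normr_ge0 de; rewrite /B; lra.
  have h2 : - B <= ga * x i - de.
    have := ler_norm de; have := ler_norm (- ga); rewrite normrN => h3 h4.
    have h5 : - ga * x i <= `|ga| * M.
      by apply: le_trans (ler_wpM2r (ltW xi0) h3) _; exact: ler_wpM2l.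
    have := mulr_ge0 cc0 M0; have := normr_ge0 cs; rewrite /B; lra.
  have := ler_wpM2l hA h1; have := ler_wpM2l hA' h2; lra.
apply: le_trans (ler_sum _ (fun i _ => term i)).
rewrite big_split /= -!mulr_sumr -big_mkcond /= sumrN -mulr_sumr big_split /=.
have [p pN [xpos xneg]] := full_sign fe.
have pos : 0 <= \sum_(i < N | 0 < x i) (weight t^-1 i x - weight t i x) / x i.
  apply: (positive_weights_sum_cond ht pN xg xpos xneg) => s i j hs ij.
  exact: (factor_ge0 hq ht hb ha).
apply: ler_wpDr; first by apply: mulr_ge0 pos; exact: ltW.
rewrite mulrN lerN2 ler_pM2l//; apply: ler_wpM2l => //.
by apply: lerD; [apply: le_trans (B1P e fe) (ler_norm _)|apply: le_trans (B2P e fe) (ler_norm _)].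
Qed.

(** The maximum of f plus a small multiple of the positive part is attained
    at a full configuration. *)
Lemma approximate_maximum (f : mpoly N R) (eps : R) : f \is symmetric -> 0 < eps ->
  exists e : E, [/\ full e, forall e' : E, eval_sym f e' <= eval_sym f e + eps &
    DN_real q t a b d (fun y => meval y f) (config e) <= eps].
Proof.
move=> fs eps0; have [C C0 CP] := positive_part_drift.
have [M M0 MP] := positive_mass_bounded.
have h0 : 0 < eps / (C + M + 1) by apply: divr_gt0 => //; lra.
set h := eps / _ in h0.
have hC : h * C <= eps.
  rewrite /h mulrAC ler_pdivrMr; last by lra.
  by apply: ler_wpM2l; [exact: ltW|lra].
have hM : h * M <= eps.
  rewrite /h mulrAC ler_pdivrMr; last by lra.
  by apply: ler_wpM2l; [exact: ltW|lra].
pose u (e : E) := eval_sym f e + h * positive_mass e.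
have uc : continuous u.
  have fc : continuous (eval_sym f : E -> R) by exact: eval_sym_continuous.
  have mc := @positive_mass_continuous R N q t a b hq.
  exact: (@add_scale_continuous R E h _ _ fc mc).
have E0 : [set: E] !=set0.
  pose w : Nbar_seq_pair := (fun=> None, fun=> None).
  have [|e _] := @coords_surj R N q t a b hq ht hb ha w; last by exists e.
  by apply: (@level_Omega_le N w 0 0).
have [e _ emax] : exists2 e : E, e \in [set: E] & forall e', e' \in [set: E] -> u e' <= u e.
  apply: (compact_EVT_max E0); first exact: OmegaN_compact.
  exact: continuous_subspaceT.
have {}emax e' : u e' <= u e by apply: emax; rewrite inE.
have fe : full e by apply: (maximum_full hq ht hb ha fs h0).
exists e; split=> //.
  move=> e'; have := emax e'; rewrite /u; have /andP[m1 m2] := MP e; have /andP[m3 m4] := MP e'.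
  have := ler_wpM2l (ltW h0) m2; have := mulr_ge0 (ltW h0) m3; lra.
pose G := fun y => meval y f + h * positive_part y.
have Gmax (e' : E) : G (config e') <= G (config e).
  by have := emax e'; rewrite /u /G /eval_sym -!(positive_part_config hq ht hb ha).
have := full_maximum d hq ht hb ha fe Gmax.
have -> : DN_real q t a b d G (config e) = DN_real q t a b d (fun y => meval y f) (config e) +
    h * DN_real q t a b d (@positive_part R N) (config e).
  rewrite /DN_real mulr_sumr -big_split /=; apply: eq_bigr => i _.
  by rewrite /G; ring.
have := ler_wpM2l (ltW h0) (CP e fe); rewrite mulrN; lra.
Qed.

End MaximumPrinciple.

(** * The pre-generator *)

Section Krylov.
Context {R : realType} {U : lmodType R}.
Variables (V : U -> Prop) (B : U -> U).
Hypothesis VL : forall (k : R) u v, V u -> V v -> V (k *: u + v).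
Hypothesis V0 : V 0.
Hypothesis VB : forall v, V v -> V (B v).
Hypothesis BL : forall (k : R) u v, V u -> V v -> B (k *: u + v) = k *: B u + B v.
Hypothesis Binj : forall v, V v -> B v = 0 -> v = 0.

Let B0 : B 0 = 0.
Proof. by have := BL (-1) V0 V0; rewrite !scaleN1r !addNr. Qed.

Let Viter v n : V v -> V (iter n B v).
Proof. by move=> Vv; elim: n => //= n; exact: VB. Qed.

Let Vsum v n (r : nat -> R) : V v -> V (\sum_(i < n) r i *: iter i B v).
Proof.
move=> Vv; elim: n => [|n IH]; first by rewrite big_ord0.
by rewrite big_ord_recr /= addrC; apply: VL => //; exact: Viter.
Qed.

Let Bsum v n (r : nat -> R) : V v ->
  B (\sum_(i < n) r i *: iter i B v) = \sum_(i < n) r i *: iter i.+1 B v.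
Proof.
move=> Vv; elim: n => [|n IH]; first by rewrite !big_ord0.
by rewrite !big_ord_recr /= addrC BL ?IH 1?addrC//; [exact: Viter|exact: Vsum].
Qed.

Let relation_range v n (r : nat -> R) : V v -> (exists2 i, (i <= n)%N & r i != 0) ->
  \sum_(i < n.+1) r i *: iter i B v = 0 -> exists2 w, V w & B w = v.
Proof.
move=> Vv; elim: n r => [|n IH] r [i il ri].
  move: il ri; rewrite leqn0 => /eqP -> ri.
  rewrite big_ord_recr big_ord0 /= add0r => /eqP; rewrite scaler_eq0 (negPf ri) /=.
  by move=> /eqP ->; exists 0.
rewrite big_ord_recl /= => rel.
have [r0|r0] := eqVneq (r 0%N) 0.
  apply: (IH (fun j => r j.+1)).
    case: i il ri => [|i] il ri; first by rewrite r0 eqxx in ri.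
    by exists i.
  apply: Binj; first exact: (Vsum _ (fun j => r j.+1)).
  by rewrite (Bsum _ (fun j => r j.+1))// -[RHS]rel r0 scale0r add0r.
exists (\sum_(j < n.+1) (- (r 0%N)^-1 * r j.+1) *: iter j B v).
  exact: (Vsum _ (fun j => - (r 0%N)^-1 * r j.+1)).
rewrite (Bsum _ (fun j => - (r 0%N)^-1 * r j.+1))//.
under eq_bigr do rewrite -scalerA.
rewrite -scaler_sumr.
move/eqP: rel; rewrite addrC addr_eq0 => /eqP rel.
by rewrite [X in _ *: X]rel scaleNr scalerN opprK scalerA mulVf// scale1r.
Qed.

(** The iterates of a vector are linearly dependent, and by injectivity the
    lowest term of a relation between them can be solved for. *)
Lemma injective_onto (I : finType) (u : I -> U) :
  (forall v, V v -> exists c : I -> R, v = \sum_i c i *: u i) ->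
  forall v, V v -> exists2 w, V w & B w = v.
Proof.
move=> span v Vv.
have /choice[c cP] n := span _ (Viter n Vv).
pose C : 'M[R]_(#|I|.+1, #|I|) := \matrix_(i, j) c i (enum_val j).
have [k k0] : exists k, row k (kermx C) != 0.
  apply/existsP; apply: contraT; rewrite negb_exists => /forallP h.
  have : kermx C == 0.
    by apply/eqP/row_matrixP => k; rewrite row0; apply/eqP; have := h k; rewrite negbK.
  by rewrite kermx_eq0 /row_free ltn_eqF// ltnS; exact: rank_leq_col.
pose r (i : nat) := if insub i is Some j then kermx C k (j : 'I_#|I|.+1) else 0.
have rE (j : 'I_#|I|.+1) : r j = kermx C k j by rewrite /r valK.
apply: (@relation_range v #|I| r Vv).
  have [j jP] : exists j, row k (kermx C) 0 j != 0.
    apply/existsP; apply: contraR k0; rewrite negb_exists => /forallP h.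
    by apply/eqP/rowP => j; rewrite [RHS]mxE; apply/eqP; have := h j; rewrite negbK.
  by exists j; [rewrite -ltnS|rewrite rE; move: jP; rewrite mxE].
under eq_bigr => i _.
  rewrite rE cP scaler_sumr.
  over.
rewrite exchange_big /= big1// => x _.
under eq_bigr do rewrite scalerA.
rewrite -scaler_suml.
have : (kermx C *m C) k (enum_rank x) = 0 by rewrite mulmx_ker mxE.
rewrite mxE => h; rewrite (_ : \sum_(i < _) _ = 0) ?scale0r// -[RHS]h.
by apply: eq_bigr => i _; rewrite [C _ _]mxE enum_rankK.
Qed.

End Krylov.

Section Assembly.
Context {R : realType}.
Variables (N : nat) (q t a b : R) (c d : R[i]).
Hypotheses (hq : 0 < q < 1) (ht : 0 < t < 1) (hb : b < 0) (ha : 0 < a)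
  (hcd : c = Num.conj d).

Local Notation E := (OmegaN N q t a b).
Local Notation D := (@DN R N q t a b c d).
Local Notation Dr f := (DN_real q t a b d (fun y => meval y f)).

Lemma DN_spec f : f \is symmetric -> D f \is symmetric /\
  forall x, generic_point x -> meval x (D f) = Dr f x.
Proof.
move=> fs; rewrite /DN; case: xgetP => [g _ [gs gE]|no].
  split=> // x xg; apply: (@complexI R); rewrite /= gE//.
  by rewrite (DN_funE _ _ _ _ hcd).
have [g gs gE] := DN_real_symmetric d hq ht hb ha fs.
case: (no g); split=> // x xg.
by rewrite (DN_funE _ _ _ _ hcd) gE.
Qed.

Lemma eval_sym_full_eq f g : f \is symmetric -> g \is symmetric ->
  (forall e : E, full e -> eval_sym f e = eval_sym g e) ->
  eval_sym f = eval_sym g :> (E -> R).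
Proof.
move=> fs gs fg; apply/funext => e; apply/eqP; rewrite -subr_eq0 -mevalB; apply/eqP.
apply: (eval_sym_full_eq0 hq ht hb ha (rpredB fs gs)) => {}e fe.
by rewrite /eval_sym mevalB; apply/eqP; rewrite subr_eq0; apply/eqP/fg.
Qed.

Lemma eval_DN f (e : E) : f \is symmetric -> full e -> eval_sym (D f) e = Dr f (config e).
Proof.
move=> fs fe; have [_ H] := DN_spec fs; rewrite /eval_sym H//.
exact: (full_generic hq ht hb ha).
Qed.

(** The polynomial f - g vanishes on the whole space, so it has a maximum
    and a minimum at each full configuration. *)
Lemma eval_DN_eq f g : f \is symmetric -> g \is symmetric ->
  eval_sym f = eval_sym g :> (E -> R) -> eval_sym (D f) = eval_sym (D g) :> (E -> R).
Proof.
move=> fs gs fg; apply: eval_sym_full_eq; [by case: (DN_spec fs)|by case: (DN_spec gs)|].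
move=> e fe; rewrite !eval_DN//.
pose G := fun y => meval y f - meval y g.
have G0 (e' : E) : G (config e') = 0.
  by apply/eqP; rewrite subr_eq0; apply/eqP; exact: (congr1 (fun F => F e') fg).
have h1 : DN_real q t a b d G (config e) <= 0.
  by apply: (full_maximum d hq ht hb ha fe) => e'; rewrite !G0.
have h2 : DN_real q t a b d (fun y => - G y) (config e) <= 0.
  by apply: (full_maximum d hq ht hb ha fe) => e'; rewrite !G0.
have e1 : DN_real q t a b d G (config e) = Dr f (config e) - Dr g (config e).
  by rewrite /DN_real -sumrB; apply: eq_bigr => i _; rewrite /G; ring.
have e2 : DN_real q t a b d (fun y => - G y) (config e) = Dr g (config e) - Dr f (config e).
  by rewrite /DN_real -sumrB; apply: eq_bigr => i _; rewrite /G; ring.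
by apply/eqP; rewrite eq_le; apply/andP; split; lra.
Qed.

Definition sym_functions : set (E -> R) :=
  [set (eval_sym f : E -> R) | f in [set f : mpoly N R | f \is symmetric]].

(** The operator read on functions; by [eval_DN_eq] the choice of the
    polynomial is immaterial. *)
Definition DN_on_functions (v : E -> R) : E -> R :=
  eval_sym (D (xget 0 [set f | f \is symmetric /\ eval_sym f = v :> (E -> R)])).

Local Notation V := sym_functions.
Local Notation A := DN_on_functions.

Lemma DN_on_eval f : f \is symmetric -> A (eval_sym f) = eval_sym (D f).
Proof.
move=> fs; rewrite /DN_on_functions; case: xgetP => [g _ [gs gE]|no].
  exact: eval_DN_eq.
by case: (no f).
Qed.

Lemma eval_symL (k : R) f g : eval_sym (k *: f + g) = k *: eval_sym f + eval_sym g :> (E -> R).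
Proof. by apply/funext => e; rewrite /eval_sym mevalD mevalZ. Qed.

Lemma symmetric_comb (k : R) (f g : mpoly N R) : f \is symmetric -> g \is symmetric ->
  k *: f + g \is symmetric.
Proof. by move=> fs gs; rewrite rpredD// rpredZ. Qed.

Lemma DN_on_linear (k : R) u v : V u -> V v -> A (k *: u + v) = k *: A u + A v.
Proof.
move=> [f fs <-] [g gs <-]; have [Dfs _] := DN_spec fs; have [Dgs _] := DN_spec gs.
have kfg : k *: f + g \is symmetric by exact: symmetric_comb.
rewrite -eval_symL !DN_on_eval// -eval_symL.
have [Ds _] := DN_spec kfg.
have kD : k *: D f + D g \is symmetric by exact: symmetric_comb.
apply: (eval_sym_full_eq Ds kD) => e fe.
rewrite eval_DN// [RHS]mevalD mevalZ -!/(eval_sym _ e) !eval_DN//.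
rewrite /DN_real mulr_sumr -big_split /=; apply: eq_bigr => i _.
by rewrite !mevalD !mevalZ; ring.
Qed.

(** If x nearly maximizes f and (D f)(x) is nearly at most 0, then f is at
    most f(x) - h (D f)(x) up to a small error. *)
Lemma DN_dissipative (h : R) v M : 0 <= h -> V v ->
  bounded_by (v - h *: A v) M -> bounded_by v M.
Proof.
suff H f : 0 <= h -> f \is symmetric -> bounded_by (eval_sym f - h *: A (eval_sym f) : E -> R) M ->
    forall e : E, eval_sym f e <= M.
  move=> h0 [f fs <-] fM e; have hf := H f h0 fs fM e.
  have Nf : eval_sym (- f) = - eval_sym f :> (E -> R).
    by apply/funext => u; rewrite /eval_sym mevalN.
  have Nfs : - f \is symmetric by rewrite rpredN.
  have AN : A (- eval_sym f) = - A (eval_sym f).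
    have Vf : V (eval_sym f) by exists f.
    have V0 : V 0.
      exists 0; first exact: rpred0.
      by apply/funext => u; rewrite /eval_sym meval0.
    have A0 : A 0 = 0.
      by have := DN_on_linear (-1) V0 V0; rewrite !scaleN1r !addNr.
    by have := DN_on_linear (-1) Vf V0; rewrite !scaleN1r A0 !addr0.
  have := H (- f) h0 Nfs; rewrite Nf AN scalerN opprK => hNf.
  have /hNf/(_ e) : bounded_by (- eval_sym f + h *: A (eval_sym f)) M.
    by have := bounded_byN fM; rewrite opprB addrC.
  by rewrite fctE ler_norml hf andbT lerNl.
move=> h0 fs fM e; apply/ler_addgt0Pr => dl dl0.
have h1 : 0 < 1 + h by lra.
have eps0 : 0 < dl / (1 + h) by exact: divr_gt0.
have [e0 [fe0 emax De0]] := approximate_maximum d hq ht hb ha fs eps0.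
set eps := dl / _ in eps0 emax De0.
have := fM e0; rewrite DN_on_eval// !fctE eval_DN// ler_norml => /andP[_].
rewrite /GRing.scale /= => hM.
have := ler_wpM2l h0 De0; have := emax e.
have : dl = eps + h * eps by rewrite /eps; field; lra.
lra.
Qed.

Lemma sym_functions_linear (k : R) u v : V u -> V v -> V (k *: u + v).
Proof.
move=> [f fs <-] [g gs <-]; exists (k *: f + g); last exact: eval_symL.
by rewrite /= rpredD// rpredZ.
Qed.

Lemma DN_on_stable v : V v -> V (A v).
Proof.
move=> [f fs <-]; rewrite DN_on_eval//; exists (D f) => //.
by case: (DN_spec fs).
Qed.

Lemma sym_functions1 : V 1.
Proof.
exists 1; first exact: rpred1.
by apply/funext => e; rewrite /eval_sym meval1.
Qed.

(** The symmetric polynomials of degree at most that of f form an invariant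
    space spanned by finitely many functions. *)
Lemma DN_onto (h : R) v : 0 <= h -> V v -> exists2 w, V w & w - h *: A w = v.
Proof.
move=> h0 [f fs <-].
pose Vn (v : E -> R) := exists g : mpoly N R,
  [/\ g \is symmetric, (msize g <= msize f)%N & eval_sym g = v :> (E -> R)].
have VnV u : Vn u -> V u by move=> [g [gs _ <-]]; exists g.
have VnL (k : R) u w : Vn u -> Vn w -> Vn (k *: u + w).
  move=> [g [gs gf <-]] [g' [gs' gf' <-]]; exists (k *: g + g'); split.
  - by rewrite rpredD// rpredZ.
  - apply: leq_trans (msizeD_le _ _) _; rewrite geq_max gf' andbT.
    exact: leq_trans (msizeZ_le _ _) gf.
  - exact: eval_symL.
have VnA u : Vn u -> Vn (A u).
  move=> [g [gs gf <-]]; have [g' [gs' gf' gE']] := DN_real_degree d hq ht hb ha gs.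
  exists g'; split => //; first exact: leq_trans gf' gf.
  rewrite DN_on_eval//; apply: eval_sym_full_eq => //; first by case: (DN_spec gs).
  move=> e fe; rewrite eval_DN// gE'//; exact: (full_generic hq ht hb ha).
have Vn0 : Vn 0.
  exists 0; split; [exact: rpred0|by rewrite msize0|].
  by apply/funext => u; rewrite /eval_sym meval0.
have A0 : A 0 = 0.
  by have := DN_on_linear (-1) (VnV _ Vn0) (VnV _ Vn0); rewrite !scaleN1r !addNr.
have key := @injective_onto R (E -> R) Vn (fun w => w - h *: A w) VnL Vn0.
have [|||||w Vw wE] := key _ _ _ (bmultinom N (msize f))
    (fun m => eval_sym (mpolyX R m) : E -> R) _ (eval_sym f).
- move=> u Vu; rewrite -scaleN1r scalerA (_ : u + _ = (-1 * h) *: A u + u); last by rewrite addrC.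
  by apply: VnL => //; exact: VnA.
- move=> k u w Vu Vw; rewrite DN_on_linear; [|exact: VnV|exact: VnV].
  by fun_ring.
- move=> u Vu u0; apply: bounded_by0; apply: (DN_dissipative h0 (VnV _ Vu)).
  by rewrite u0 => x; rewrite normr0.
- move=> u [g [gs gf <-]]; exists (fun m : bmultinom N (msize f) => mcoeff m g).
  apply/funext => e; rewrite /eval_sym {1}(mpolywE gf) (rmorph_sum (meval _)) /=.
  by rewrite fct_sumE; apply: eq_bigr => m _; rewrite mevalZ.
- by exists f.
by exists w => //; exact: VnV.
Qed.

Lemma DN_dissipative_core : dissipative_core V A.
Proof.
split.
- exact: sym_functions_linear.
- exact: sym_functions1.
- exact: DN_on_stable.
- exact: DN_on_linear.
- have s1 : 1 \is @symmetric N R by exact: rpred1.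
  have -> : 1 = eval_sym 1 :> (E -> R).
    by apply/funext => e; rewrite /eval_sym meval1.
  rewrite DN_on_eval// (_ : 0 = eval_sym 0); last first.
    by apply/funext => e; rewrite /eval_sym meval0.
  apply: eval_sym_full_eq; [by case: (DN_spec s1)|exact: rpred0|].
  move=> e fe; rewrite eval_DN// /eval_sym meval0 /DN_real big1// => i _.
  by rewrite !meval1 subrr !mulr0 addr0.
- exact: DN_dissipative.
- exact: DN_onto.
Qed.

Lemma sym_functions_continuous v : V v -> continuous v.
Proof. by move=> [f fs <-]; exact: eval_sym_continuous. Qed.

Lemma sym_functions_dense (f : E -> R) (eps : R) : continuous f -> 0 < eps ->
  exists2 v, V v & bounded_by (f - v) eps.
Proof.
apply: (stone_weierstrass (@OmegaN_compact R N q t a b hq ht hb ha)).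
- exact: sym_functions_continuous.
- exact: sym_functions_linear.
- move=> u v [g gs <-] [g' gs' <-]; exists (g * g'); first exact: rpredM.
  by apply/funext => e; rewrite /eval_sym mevalM.
- exact: sym_functions1.
- move=> e e' /(symmetric_separates hq ht hb ha)[g gs ge].
  by exists (eval_sym g) => //; exists g.
Qed.

Lemma DN_graphE : @DN_graph R N q t a b c d =
  [set ((v : {uniform E -> R}), (A v : {uniform E -> R})) | v in V].
Proof.
apply/seteqP; split => -[u v].
  by move=> [f fs [<- <-]]; exists (eval_sym f); [exists f|rewrite DN_on_eval].
by move=> [_ [f fs <-] [<- <-]]; exists f => //; rewrite DN_on_eval.
Qed.

Lemma DN_pre_generator : exists T : R -> (E -> R) -> E -> R,
  feller_semigroup T /\ pre_generator (@DN_graph R N q t a b c d) T.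
Proof.
exists (limit_semigroup V A); rewrite DN_graphE.
apply: (dissipative_core_pre_generator DN_dissipative_core).
- exact: sym_functions_continuous.
- exact: sym_functions_dense.
- exact: (compact_bounded (@OmegaN_compact R N q t a b hq ht hb ha)).
Qed.

End Assembly.

Theorem theorem5p7 (R : realType) (N : nat) (q t a b : R) (c d : complex R)
    (hN : (2 <= N)%N) (hq : 0 < q < 1) (ht : 0 < t < 1) (hb : b < 0) (ha : 0 < a)
    (hcd : c = Num.conj d) (hc : c \isn't Num.real) :
  exists T : R -> (OmegaN N q t a b -> R) -> (OmegaN N q t a b -> R),
    feller_semigroup T /\ pre_generator (@DN_graph R N q t a b c d) T.
Proof. exact: DN_pre_generator. Qed.
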